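(* Let $u=u(x;a,E,c)$ be a $T$-periodic traveling wave profile with $T_a,T_E$ not both zero, let $T,M,P$ be its period, mass and momentum regarded as functions of $(a,E,c)$, and let $\mathbf{M}(\mu)$ be the monodromy matrix of $\partial_x\mathcal{L}[u]v=\mu v$. Then $$\operatorname{tr}(\mathbf{M}_{\mu\mu}(0))=\{T,P\}_{E,c}+2\{M,P\}_{a,E},\qquad \operatorname{tr}(\mathbf{M}_{\mu\mu\mu}(0))=-\tfrac32\{T,M,P\}_{a,E,c}.$$ Consequently the modulational stability index $\Delta=\frac12(\operatorname{tr}(\mathbf{M}_{\mu\mu}(0)))^3-3(\operatorname{tr}(\mathbf{M}_{\mu\mu\mu}(0)))^2$ satisfies $$\Delta=\tfrac12\big(\{T,P\}_{E,c}+2\{M,P\}_{a,E}\big)^3-3\big(\tfrac32\{T,M,P\}_{a,E,c}\big)^2.$$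
   Context: Let $f\in C^2(\mathbb{R})$, $F'=f$, and for real parameters $(a,E,c)$ set $V(u;a,c)=F(u)-\frac{c}{2}u^2-au$. Standing assumption: $(a,E,c)$ lies in the interior of the parameter region for which $V(\cdot;a,c)$ has a local minimum and there are simple roots $u_-<u_+$ of $V(u;a,c)=E$ with $V(u;a,c)<E$ on $(u_-,u_+)$. Then $u(x)=u(x;a,E,c)$ denotes the nonconstant periodic solution of $\frac12u_x^2+V(u;a,c)=E$ (so $u_{xx}+f(u)-cu=a$) with $u(0)=u_-$, $u_x(0)=0$. Its period, mass and momentum are the $C^1$ functions of $(a,E,c)$ $$T=2\int_{u_-}^{u_+}\frac{du}{\sqrt{2(E-V(u;a,c))}},\quad M=\int_0^Tu\,dx,\quad P=\int_0^Tu^2\,dx.$$ Set $\mathcal{L}[u]=-\partial_x^2-f'(u)+c$. For $\mu\in\mathbb{C}$ let $\mathbf{M}(\mu)=\Phi(T,\mu)$, where $\Phi_x=\mathbf{H}(x;\mu)\Phi$, $\Phi(0,\mu)=\mathbf{I}$ and $\mathbf{H}(x;\mu)=\begin{pmatrix}0&1&0\\ 0&0&1\\ -\mu-u_xf''(u)&-f'(u)+c&0\end{pmatrix}$; this is the first order system for $\partial_x\mathcal{L}[u]v=\mu v$. Subscripts $\mu$ denote derivatives in $\mu$. Jacobian notation: $\{g,h\}_{y,z}=\begin{vmatrix} g_y & h_y \\ g_z & h_z \end{vmatrix}$ and $\{g,h,k\}_{y,z,w}=\begin{vmatrix} g_y & h_y & k_y \\ g_z & h_z & k_z \\ g_w &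 h_w & k_w \end{vmatrix}$. *)

(* Defs.v *)
From Stdlib Require Export Reals.
From Coquelicot Require Export Coquelicot.
Open Scope R_scope.

Definition is_C2 (f : R -> R) : Prop :=
  forall x, (forall k, (k <= 2)%nat -> ex_derive_n f k x) /\
            continuous (Derive_n f 2) x.

Definition potential (F : R -> R) (a c v : R) : R :=
  F v - c / 2 * v ^ 2 - a * v.

(* [u_minus] and [u_plus] are simple roots of V = E bounding a potential well. *)
Definition is_well (F : R -> R) (a E c u_minus u_plus : R) : Prop :=
  let V := potential F a c in
  (exists m, locally m (fun v => V m <= V v)) /\
  u_minus < u_plus /\
  V u_minus = E /\ Derive V u_minus <> 0 /\
  V u_plus = E /\ Derive V u_plus <> 0 /\
  (forall v, u_minus < v < u_plus -> V v < E).

(* At fixed parameters there may be several wells, so the roots are given as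
   functions of (a,E,c) that form a continuous branch at the base point;
   requiring [is_well] on a neighbourhood places (a,E,c) in the interior of the
   parameter region.  Since the roots are simple, continuity at the base point
   determines the branch on a neighbourhood. *)
Definition is_root_branch (F : R -> R) (u_minus u_plus : R -> R -> R -> R)
    (a E c : R) : Prop :=
  locally (a, E, c)
    (fun p => let '(a', E', c') := p in
       is_well F a' E' c' (u_minus a' E' c') (u_plus a' E' c')) /\
  continuous (fun p : R * R * R => let '(a', E', c') := p in u_minus a' E' c')
    (a, E, c) /\
  continuous (fun p : R * R * R => let '(a', E', c') := p in u_plus a' E' c')
    (a, E, c).

(* The second order equation excludes the spurious solutions of the first order
   one that rest at a turning point for a while. *)
Definition is_profile (f F : R -> R) (a E c u_minus : R) (u : R -> R) : Prop :=
  (forall x, ex_derive u x) /\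
  (forall x, / 2 * (Derive u x) ^ 2 + potential F a c (u x) = E) /\
  (forall x, is_derive (Derive u) x (a - f (u x) + c * u x)) /\
  (exists x y, u x <> u y) /\
  (exists L, 0 < L /\ forall x, u (x + L) = u x) /\
  u 0 = u_minus /\ Derive u 0 = 0.

Definition is_profile_family (f F : R -> R) (u_minus : R -> R -> R -> R)
    (u : R -> R -> R -> R -> R) (a E c : R) : Prop :=
  locally (a, E, c)
    (fun p => let '(a', E', c') := p in
       is_profile f F a' E' c' (u_minus a' E' c') (u a' E' c')).

Definition period (F : R -> R) (u_minus u_plus : R -> R -> R -> R)
    (a E c : R) : R :=
  2 * RInt_gen (fun v => / sqrt (2 * (E - potential F a c v)))
        (at_right (u_minus a E c)) (at_left (u_plus a E c)).

Definition mass (T : R -> R -> R -> R) (u : R -> R -> R -> R -> R)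
    (a E c : R) : R :=
  RInt (u a E c) 0 (T a E c).

Definition momentum (T : R -> R -> R -> R) (u : R -> R -> R -> R -> R)
    (a E c : R) : R :=
  RInt (fun x => u a E c x ^ 2) 0 (T a E c).

Definition d_a (g : R -> R -> R -> R) (a E c : R) : R :=
  Derive (fun a' => g a' E c) a.
Definition d_E (g : R -> R -> R -> R) (a E c : R) : R :=
  Derive (fun E' => g a E' c) E.
Definition d_c (g : R -> R -> R -> R) (a E c : R) : R :=
  Derive (fun c' => g a E c') c.

(* {g,h}_{y,z}, where [dy] and [dz] are two of [d_a], [d_E], [d_c]. *)
Definition jacobian2 (dy dz : (R -> R -> R -> R) -> R -> R -> R -> R)
    (g h : R -> R -> R -> R) (a E c : R) : R :=
  dy g a E c * dz h a E c - dy h a E c * dz g a E c.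

(* {g,h,k}_{y,z,w}, by expansion along the first row. *)
Definition jacobian3 (dy dz dw : (R -> R -> R -> R) -> R -> R -> R -> R)
    (g h k : R -> R -> R -> R) (a E c : R) : R :=
  dy g a E c * jacobian2 dz dw h k a E c
  - dy h a E c * jacobian2 dz dw g k a E c
  + dy k a E c * jacobian2 dz dw g h a E c.

Definition mat_trace {n : nat} (A : @matrix C n n) : C :=
  sum_n (fun i => coeff_mat zero A i i) (Nat.pred n).

(* Entrywise derivative; used with K = R (in x) and K = C (complex derivative
   in mu). *)
Definition is_mat_derive {K : AbsRing} {V : NormedModule K} {m n : nat}
    (A : K -> @matrix V m n) (x : K) (B : @matrix V m n) : Prop :=
  forall i j, (i < m)%nat -> (j < n)%nat ->
    is_derive (fun y => coeff_mat zero (A y) i j) x (coeff_mat zero B i j).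

Definition spectral_matrix (f : R -> R) (c : R) (u : R -> R) (mu : C) (x : R) :
    @matrix C 3 3 :=
  [ [ RtoC 0, RtoC 1, RtoC 0 ],
    [ RtoC 0, RtoC 0, RtoC 1 ],
    [ (- mu - RtoC (Derive u x * Derive_n f 2 (u x)))%C,
      RtoC (- Derive f (u x) + c), RtoC 0 ] ].

Definition is_fundamental_matrix (f : R -> R) (c : R) (u : R -> R) (mu : C)
    (Phi : R -> @matrix C 3 3) : Prop :=
  Phi 0 = (Mone : @matrix C 3 3) /\
  forall x, is_mat_derive (K := R_AbsRing) (V := C_R_NormedModule) Phi x
              (Mmult (spectral_matrix f c u mu x : @matrix C_Ring 3 3) (Phi x)).

Definition is_mu_derivative (A B : C -> @matrix C 3 3) : Prop :=
  forall mu, is_mat_derive (K := C_AbsRing) (V := C_NormedModule) A mu (B mu).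

(* [M2] and [M3] stand for the second and third mu-derivatives of the monodromy
   matrix at mu = 0. *)
Definition stability_index (M2 M3 : @matrix C 3 3) : C :=
  (RtoC (/ 2) * mat_trace M2 ^ 3 - RtoC 3 * mat_trace M3 ^ 2)%C.

(* Main.v *)
Require Import Defs.
From Stdlib Require Import Reals.
From Coquelicot Require Import Coquelicot.
From Stdlib Require Import Lra Lia Classical.
Open Scope R_scope.

(** Differentiating the profile equation in the parameters gives [L u_x = 0],
    [L u_a = -1], [L u_E = 0], [L u_c = -u], while the period of [u] turns into
    jumps over one period: [u_a], [u_E], [u_c] change by [-T_a u_x], [-T_E u_x],
    [-T_c u_x].  Hence [u_x], [u_a], [u_E] solve the equation at [mu = 0], and
    [u_x - mu u_c] solves it up to [mu^2].  Integrating [(L v)' = mu v] against 1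
    and [u] gives the remaining two components of the jump of the exact solutions
    as [mu] times integrals of these functions, that is, as derivatives of [M] and
    [P].  So [M(mu) - 1] is similar to a matrix whose entries are, to leading order
    in [mu], the derivatives of [T], [M], [P]; its determinant is of order [mu^3]
    and its second invariant [e2] is of order [mu^2].

    For solutions [v] at [mu] and [w] at [-mu], the expression
    [L v L w - mu (w v' - v w')] does not depend on [x], so [M(-mu)] is similar to
    the inverse of [M(mu)].  With [det M = 1] this gives
    [det (M(mu) - 1) = tr M(mu) - tr M(-mu)] and
    [e2 (M(mu) - 1) = tr M(-mu) - 2 tr M(mu) + 3], which determine the Taylor
    coefficients of the trace; the Maxwell relations [M_E = T_a], [P_E = 2 T_c],
    [P_a = 2 M_c] bring them to the stated form. *)

(** The leading terms of the entries of [M(mu) - 1] give its trace only to first order; its second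
    and third derivatives would require further correctors to the solutions. The determinant and
    [e2] do not: their leading terms come from the leading entries alone, and the symmetry between
    [mu] and [-mu] trades them for the trace. The corrector [- mu u_c] arises because [L u_c = -u]
    makes [(L (- mu u_c))' = mu u_x]. The other obstacle is regularity. With [f] only C^2, the
    derivatives of the profile in the parameters come from Gronwall estimates: a displacement of
    order [h] first, then a remainder [o(h)] uniform in [x]. The candidate derivative is explicit,
    by variation of constants from one solution [e] of [L e = 0], which is read off the fundamental
    matrix at [mu = 0]. The period integral is singular at both ends, so it is replaced by the
    return time, a zero of [u_x], and differentiated implicitly. Limits in [mu] are taken along the
    real axis, where the monodromy matrix is real; complex differentiability is obtained separately,
    from Duhamel's formula. *)

(** * Elementary real analysis and Gronwall estimates *)

Lemma is_derive_eq (f : R -> R) (x l l' : R) :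
  is_derive f x l -> l = l' -> is_derive f x l'.
Proof. now intros H <-. Qed.

Lemma is_derive_Rplus (f g : R -> R) (x l m : R) :
  is_derive f x l -> is_derive g x m -> is_derive (fun t => f t + g t) x (l + m).
Proof. intros Hf Hg; exact (is_derive_plus f g x l m Hf Hg). Qed.

Lemma is_derive_Rminus (f g : R -> R) (x l m : R) :
  is_derive f x l -> is_derive g x m -> is_derive (fun t => f t - g t) x (l - m).
Proof. intros Hf Hg; exact (is_derive_minus f g x l m Hf Hg). Qed.

Lemma is_derive_Ropp (f : R -> R) (x l : R) :
  is_derive f x l -> is_derive (fun t => - f t) x (- l).
Proof. intros Hf; exact (is_derive_opp f x l Hf). Qed.

Lemma is_derive_Rmult (f g : R -> R) (x l m : R) :
  is_derive f x l -> is_derive g x m ->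
  is_derive (fun t => f t * g t) x (l * g x + f x * m).
Proof. intros Hf Hg; exact (is_derive_mult f g x l m Hf Hg Rmult_comm). Qed.

Lemma is_derive_Rsqr (f : R -> R) (x l : R) :
  is_derive f x l -> is_derive (fun t => f t ^ 2) x (2 * f x * l).
Proof.
  intros Hf; apply is_derive_ext with (f := fun t => f t * f t).
  - intros t; simpl; ring.
  - eapply is_derive_eq; [apply is_derive_Rmult; eassumption | cbv beta; ring].
Qed.

Lemma is_derive_Rconst (k x : R) : is_derive (fun _ : R => k) x 0.
Proof. exact (is_derive_const k x). Qed.

Lemma is_derive_Rid (x : R) : is_derive (fun t : R => t) x 1.
Proof. exact (is_derive_id x). Qed.

(** Differentiates along the syntax of the function and closes the leaves with hypotheses. The
    derivative comes out unsimplified, so it is mostly called after [is_derive_eq], which leaves the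
    comparison to [ring] or [field]. *)
Ltac der :=
  lazymatch goal with
  | |- is_derive (fun _ => ?k) _ _ => apply is_derive_Rconst
  | |- is_derive (fun t => t) _ _ => apply is_derive_Rid
  | |- is_derive (fun t => @?f t + @?g t) _ _ => apply (is_derive_Rplus f g); [der | der]
  | |- is_derive (fun t => @?f t - @?g t) _ _ => apply (is_derive_Rminus f g); [der | der]
  | |- is_derive (fun t => - @?f t) _ _ => apply (is_derive_Ropp f); der
  | |- is_derive (fun t => @?f t * @?g t) _ _ => apply (is_derive_Rmult f g); [der | der]
  | |- is_derive (fun t => @?f t ^ 2) _ _ => apply (is_derive_Rsqr f); der
  | |- is_derive (fun t => ?g t) ?x ?l => change (is_derive g x l); der
  | |- is_derive ?g ?x ?l =>
    multimatch goal with
    | H : is_derive g x _ |- _ => exact H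
    | H : is_derive (fun t => g t) x _ |- _ => exact H
    | H : forall x, is_derive g x _ |- _ => apply H
    | H : forall x, is_derive (fun t => g t) x _ |- _ => apply H
    | H : forall x, _ -> is_derive g x _ |- _ => eapply H; eassumption
    | H : is_derive (fun _ => _) x _ |- _ => exact H
    | H : forall x, is_derive (fun _ => _) x _ |- _ => apply H
    end
  end.

Lemma continuous_of_derive (f : R -> R) (x l : R) :
  is_derive f x l -> continuous f x.
Proof. intros H; apply (ex_derive_continuous (V := R_NormedModule) f x); now exists l. Qed.

Lemma is_derive_continuity_pt (f : R -> R) (x l : R) :
  is_derive f x l -> continuity_pt f x.
Proof. intros H; apply continuity_pt_filterlim; exact (continuous_of_derive f x l H). Qed.

Lemma mean_value (f f' : R -> R) (x y : R) :
  x <= y -> (forall t, x <= t <= y -> is_derive f t (f' t)) ->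
  exists t, x <= t <= y /\ f y - f x = f' t * (y - x).
Proof.
  intros Hxy Hd.
  destruct (MVT_gen f x y f') as [t [Ht E]].
  - intros t; rewrite Rmin_left, Rmax_right by lra; intros; apply Hd; lra.
  - intros t; rewrite Rmin_left, Rmax_right by lra; intros.
    eapply is_derive_continuity_pt, Hd; lra.
  - rewrite Rmin_left, Rmax_right in Ht by lra; now exists t.
Qed.

Lemma mean_value_bound (f f' : R -> R) (A B K x y : R) :
  (forall t, A <= t <= B -> is_derive f t (f' t)) ->
  (forall t, A <= t <= B -> Rabs (f' t) <= K) ->
  A <= x <= B -> A <= y <= B -> Rabs (f x - f y) <= K * Rabs (x - y).
Proof.
  intros Hd HK.
  assert (W : forall x y, A <= x <= B -> A <= y <= B -> x <= y ->
    Rabs (f x - f y) <= K * Rabs (x - y)).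
  { intros x' y' Hx Hy Hxy.
    destruct (mean_value f f' x' y') as [t [Ht E]]; [lra | intros; apply Hd; lra | ].
    rewrite Rabs_minus_sym, (Rabs_minus_sym x'), E, Rabs_mult.
    apply Rmult_le_compat_r; [apply Rabs_pos | apply HK; lra]. }
  intros Hx Hy; destruct (Rle_dec x y).
  - now apply W.
  - rewrite Rabs_minus_sym, (Rabs_minus_sym x); apply W; lra.
Qed.

(** The mean value bound is used twice, for [f'] between [v] and [w] and then for [f] minus its
    tangent, which costs the factor 1/2 of the sharp constant. *)
Lemma taylor1_bound (f f' f'' : R -> R) (A B K v w : R) :
  (forall t, is_derive f t (f' t)) -> (forall t, is_derive f' t (f'' t)) ->
  (forall t, A <= t <= B -> Rabs (f'' t) <= K) ->
  A <= v <= B -> A <= w <= B ->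
  Rabs (f v - f w - f' w * (v - w)) <= K * (v - w) ^ 2.
Proof.
  intros H1 H2 HK Hv Hw.
  assert (L : forall t, Rmin v w <= t <= Rmax v w ->
    Rabs (f' t - f' w) <= K * Rabs (v - w)).
  { intros t Ht.
    assert (A <= t <= B).
    { unfold Rmin, Rmax in Ht; destruct (Rle_dec v w); lra. }
    assert (K0 : 0 <= K) by (eapply Rle_trans; [apply Rabs_pos | apply (HK w); lra]).
    eapply Rle_trans; [apply (mean_value_bound f' f'' A B K) |]; try lra; auto.
    apply Rmult_le_compat_l; [lra |].
    unfold Rmin, Rmax in Ht; destruct (Rle_dec v w).
    - rewrite (Rabs_left1 (v - w)), Rabs_left1; lra.
    - rewrite (Rabs_right (v - w)), Rabs_right; lra. }
  pose (g := fun t => f t - f' w * t).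
  replace (f v - f w - f' w * (v - w)) with (g v - g w) by (unfold g; ring).
  replace (K * (v - w) ^ 2) with (K * Rabs (v - w) * Rabs (v - w)).
  2:{ rewrite <- (pow2_abs (v - w)); ring. }
  apply (mean_value_bound g (fun t => f' t - f' w) (Rmin v w) (Rmax v w)).
  - intros t _; unfold g; eapply is_derive_eq; [der | ring].
  - intros t Ht; now apply L.
  - split; [apply Rmin_l | apply Rmax_l].
  - split; [apply Rmin_r | apply Rmax_r].
Qed.

Lemma bounded_on_segment (g : R -> R) (A B : R) :
  (forall x, continuous g x) ->
  exists K, 0 <= K /\ forall x, A <= x <= B -> Rabs (g x) <= K.
Proof.
  intros Hc; destruct (Rle_dec A B) as [HAB | HAB].
  - destruct (continuity_ab_maj (fun x => Rabs (g x)) A B HAB) as [m [Hm _]].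
    + intros x _; apply continuity_pt_filterlim.
      apply (continuous_comp g Rabs x); [apply Hc | apply continuous_Rabs].
    + exists (Rabs (g m)); split; [apply Rabs_pos | exact Hm].
  - exists 0; split; [lra | intros; lra].
Qed.

Lemma strictly_increasing (f f' : R -> R) (A B : R) :
  (forall t, A <= t <= B -> is_derive f t (f' t)) ->
  (forall t, A < t < B -> 0 < f' t) ->
  forall x y, A <= x -> x < y -> y <= B -> f x < f y.
Proof.
  intros Hd Hp x y Hx Hxy Hy.
  destruct (MVT_cor2 f f' x y Hxy) as [t [E Ht]].
  - intros t Ht; apply is_derive_Reals, Hd; lra.
  - assert (0 < f' t) by (apply Hp; lra). nra.
Qed.

Lemma derive_pos_local (f : R -> R) (x l : R) :
  is_derive f x l -> 0 < l ->
  exists e, 0 < e /\ (forall t, x < t < x + e -> f x < f t) /\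
    (forall t, x - e < t < x -> f t < f x).
Proof.
  intros Hd Hl; apply is_derive_Reals in Hd.
  destruct (Hd l Hl) as [d Hd'].
  exists d; split; [apply cond_pos | split]; intros t Ht.
  - specialize (Hd' (t - x)); replace (x + (t - x)) with t in Hd' by ring.
    apply Rabs_def2 in Hd'; [ | lra | rewrite Rabs_right; lra].
    assert (0 < (f t - f x) / (t - x)) by lra.
    assert (f t - f x = (f t - f x) / (t - x) * (t - x)) by (field; lra). nra.
  - specialize (Hd' (t - x)); replace (x + (t - x)) with t in Hd' by ring.
    apply Rabs_def2 in Hd'; [ | lra | rewrite Rabs_left; lra].
    assert (0 < (f t - f x) / (t - x)) by lra.
    assert (f t - f x = (f t - f x) / (t - x) * (t - x)) by (field; lra). nra.
Qed.

Lemma derive_neg_local (f : R -> R) (x l : R) :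
  is_derive f x l -> l < 0 ->
  exists e, 0 < e /\ (forall t, x < t < x + e -> f t < f x) /\
    (forall t, x - e < t < x -> f x < f t).
Proof.
  intros Hd Hl.
  destruct (derive_pos_local (fun t => - f t) x (- l)) as [e [He [H1 H2]]];
    [der | lra |].
  exists e; split; [exact He | split]; intros t Ht;
    [specialize (H1 t Ht) | specialize (H2 t Ht)]; lra.
Qed.

Lemma intermediate_value (f : R -> R) (A B y : R) :
  (forall x, continuous f x) -> A <= B -> Rmin (f A) (f B) <= y <= Rmax (f A) (f B) ->
  exists x, A <= x <= B /\ f x = y.
Proof.
  intros Hc HAB Hy.
  destruct (IVT_gen f A B y) as [x [Hx E]]; [ | exact Hy | ].
  - intros x; apply continuity_pt_filterlim, Hc.
  - rewrite Rmin_left, Rmax_right in Hx by lra; now exists x.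
Qed.

(** The function [(N + eta) exp (- K x)] does not increase. Keeping [eta] next to [N] treats a
    forcing term without dividing by [K], so [K = 0] is no special case. *)
Lemma gronwall (N N' : R -> R) (X K eta : R) :
  (forall x, 0 <= x <= X -> is_derive N x (N' x)) ->
  (forall x, 0 <= x <= X -> N' x <= K * (N x + eta)) ->
  forall x, 0 <= x <= X -> N x + eta <= (N 0 + eta) * exp (K * x).
Proof.
  intros Hd HK x Hx.
  pose (g := fun t => (N t + eta) * exp (- K * t)).
  assert (Hg : forall t, 0 <= t <= X ->
    is_derive g t ((N' t - K * (N t + eta)) * exp (- K * t))).
  { intros t Ht; unfold g.
    assert (is_derive (fun t => exp (- K * t)) t (- K * exp (- K * t)))
      by (auto_derive; [easy | ring]).
    specialize (Hd t Ht).
    eapply is_derive_eq; [der | cbv beta; ring]. }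
  destruct (mean_value g (fun t => (N' t - K * (N t + eta)) * exp (- K * t)) 0 x
    (proj1 Hx)) as [t [Ht E]].
  { intros t Ht; apply Hg; lra. }
  assert (g x <= g 0).
  { assert (0 < exp (- K * t)) by apply exp_pos.
    assert (N' t <= K * (N t + eta)) by (apply HK; lra).
    assert (0 <= (K * (N t + eta) - N' t) * exp (- K * t) * x).
    { apply Rmult_le_pos; [apply Rmult_le_pos; lra | lra]. }
    nra. }
  unfold g in H; rewrite Rmult_0_r, exp_0, Rmult_1_r in H.
  assert (X1 : exp (- K * x) * exp (K * x) = 1).
  { rewrite <- exp_plus; replace (- K * x + K * x) with 0 by ring; apply exp_0. }
  assert (0 < exp (K * x)) by apply exp_pos.
  replace (N x + eta) with ((N x + eta) * exp (- K * x) * exp (K * x))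
    by (rewrite Rmult_assoc, X1; ring).
  apply Rmult_le_compat_r; lra.
Qed.

Lemma exp_growth (K x X : R) : 0 <= K -> x <= X -> exp (K * x) <= exp (K * X).
Proof.
  intros HK Hx; destruct (Rle_lt_or_eq_dec (K * x) (K * X)) as [H | ->];
    [nra | left; now apply exp_increasing | lra].
Qed.

(** Gronwall for the energy [y^2 + y1^2]. Here [rho] measures the forcing, and [1 + 2 K] collects
    [2 y y1 <= y^2 + y1^2] and [2 y1 y2 <= 2 K (y^2 + y1^2 + rho^2)]. *)
Lemma second_order_gronwall (y y1 y2 : R -> R) (X K rho : R) :
  0 <= K -> 0 <= rho ->
  (forall x, 0 <= x <= X -> is_derive y x (y1 x)) ->
  (forall x, 0 <= x <= X -> is_derive y1 x (y2 x)) ->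
  (forall x, 0 <= x <= X -> Rabs (y2 x) <= K * (Rabs (y x) + rho)) ->
  forall x, 0 <= x <= X ->
    y x ^ 2 + y1 x ^ 2 <= (y 0 ^ 2 + y1 0 ^ 2 + rho ^ 2) * exp ((1 + 2 * K) * X).
Proof.
  intros HK Hr D1 D2 HB x Hx.
  pose (N := fun x => y x ^ 2 + y1 x ^ 2).
  assert (G : N x + rho ^ 2 <= (N 0 + rho ^ 2) * exp ((1 + 2 * K) * x)).
  { apply (gronwall N (fun x => 2 * y x * y1 x + 2 * y1 x * y2 x) X); [ | | exact Hx].
    - intros t Ht; unfold N; specialize (D1 t Ht); specialize (D2 t Ht); der.
    - intros t Ht; unfold N.
      assert (2 * y1 t * y2 t <= 2 * Rabs (y1 t) * (K * (Rabs (y t) + rho))).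
      { eapply Rle_trans; [apply Rle_abs |].
        rewrite !Rabs_mult, (Rabs_right 2) by lra.
        apply Rmult_le_compat_l; [ | now apply HB].
        apply Rmult_le_pos; [lra | apply Rabs_pos]. }
      rewrite <- (pow2_abs (y t)), <- (pow2_abs (y1 t)).
      assert (y t * y1 t <= Rabs (y t) * Rabs (y1 t))
        by (rewrite <- Rabs_mult; apply Rle_abs).
      pose proof (Rabs_pos (y t)); pose proof (Rabs_pos (y1 t)).
      set (p := Rabs (y t)) in *; set (r := Rabs (y1 t)) in *.
      pose proof (pow2_ge_0 (p - r)); pose proof (pow2_ge_0 (r - rho)).
      pose proof (pow2_ge_0 p); pose proof (pow2_ge_0 rho).
      assert (2 * (r * (p + rho)) <= 2 * (p ^ 2 + r ^ 2 + rho ^ 2)) by lra.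
      assert (K * (2 * (r * (p + rho))) <= K * (2 * (p ^ 2 + r ^ 2 + rho ^ 2)))
        by (apply Rmult_le_compat_l; lra).
      lra. }
  fold (N x); fold (N 0).
  assert (exp ((1 + 2 * K) * x) <= exp ((1 + 2 * K) * X)) by (apply exp_growth; lra).
  assert (0 <= N 0 + rho ^ 2) by (unfold N; nra).
  assert (0 <= rho ^ 2) by nra.
  assert ((N 0 + rho ^ 2) * exp ((1 + 2 * K) * x) <=
          (N 0 + rho ^ 2) * exp ((1 + 2 * K) * X)) by (apply Rmult_le_compat_l; lra).
  change (y 0 ^ 2 + y1 0 ^ 2) with (N 0); lra.
Qed.

(** * The periodic orbit and its period *)

Lemma C2_derive (f : R -> R) (x : R) : is_C2 f -> is_derive f x (Derive f x).
Proof.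
  intros H; apply Derive_correct, (proj1 (H x) 1%nat); lia.
Qed.

Lemma C2_derive2 (f : R -> R) (x : R) :
  is_C2 f -> is_derive (Derive f) x (Derive_n f 2 x).
Proof.
  intros H; apply Derive_correct, (proj1 (H x) 2%nat); lia.
Qed.

Lemma C2_lipschitz (f : R -> R) (A B : R) : is_C2 f ->
  exists K, 0 <= K /\ forall v w, A <= v <= B -> A <= w <= B ->
    Rabs (f v - f w) <= K * Rabs (v - w) /\
    Rabs (f v - f w - Derive f w * (v - w)) <= K * (v - w) ^ 2.
Proof.
  intros H.
  destruct (bounded_on_segment (Derive f) A B) as [K1 [P1 H1]].
  { intros x; eapply continuous_of_derive, C2_derive2, H. }
  destruct (bounded_on_segment (Derive_n f 2) A B) as [K2 [P2 H2]].
  { intros x; apply H. }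
  exists (K1 + K2); split; [lra |]; intros v w Hv Hw; split.
  - eapply Rle_trans; [apply (mean_value_bound f (Derive f) A B K1); auto |].
    + intros t _; now apply C2_derive.
    + pose proof (Rabs_pos (v - w)); nra.
  - eapply Rle_trans;
      [apply (taylor1_bound f (Derive f) (Derive_n f 2) A B K2); auto |].
    + intros t; now apply C2_derive.
    + intros t; now apply C2_derive2.
    + pose proof (Rmult_le_pos _ _ P1 (pow2_ge_0 (v - w))); lra.
Qed.

(** The difference of the two solutions satisfies the second order estimate without forcing and with
    zero data. Confinement to [[A, B]] supplies a Lipschitz constant for [f], which is only locally
    Lipschitz. *)
Lemma newton_uniqueness (f : R -> R) (a c A B X : R) (y y1 z z1 : R -> R) :
  is_C2 f ->
  (forall x, 0 <= x <= X -> is_derive y x (y1 x)) ->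
  (forall x, 0 <= x <= X -> is_derive y1 x (a - f (y x) + c * y x)) ->
  (forall x, 0 <= x <= X -> is_derive z x (z1 x)) ->
  (forall x, 0 <= x <= X -> is_derive z1 x (a - f (z x) + c * z x)) ->
  (forall x, 0 <= x <= X -> A <= y x <= B /\ A <= z x <= B) ->
  y 0 = z 0 -> y1 0 = z1 0 ->
  forall x, 0 <= x <= X -> y x = z x /\ y1 x = z1 x.
Proof.
  intros Hf Dy Dy1 Dz Dz1 HAB E0 E1 x Hx.
  destruct (C2_lipschitz f A B Hf) as [K [K0 HK]].
  assert (G := second_order_gronwall (fun x => y x - z x) (fun x => y1 x - z1 x)
    (fun x => (a - f (y x) + c * y x) - (a - f (z x) + c * z x)) X (K + Rabs c) 0).
  assert (G' := fun H1 H2 H3 H4 H5 => G H1 H2 H3 H4 H5 x Hx); clear G.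
  cbv beta in G'; rewrite E0, E1 in G'.
  assert ((y x - z x) ^ 2 + (y1 x - z1 x) ^ 2 <= 0).
  { eapply Rle_trans; [apply G' | right; ring].
    - pose proof (Rabs_pos c); lra.
    - lra.
    - intros t Ht; apply is_derive_Rminus; auto.
    - intros t Ht; apply is_derive_Rminus; auto.
    - intros t Ht.
      replace (a - f (y t) + c * y t - (a - f (z t) + c * z t))
        with (- (f (y t) - f (z t)) + c * (y t - z t)) by ring.
      eapply Rle_trans; [apply Rabs_triang |].
      rewrite Rabs_Ropp, Rabs_mult.
      destruct (HAB t Ht) as [H1 H2].
      pose proof (proj1 (HK _ _ H1 H2)); lra. }
  pose proof (pow2_ge_0 (y x - z x)); pose proof (pow2_ge_0 (y1 x - z1 x)).
  split; apply Rminus_diag_uniq, Rsqr_0_uniq; unfold Rsqr; lra.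
Qed.

Lemma potential_derive (f F : R -> R) (a c v : R) :
  (forall v, is_derive F v (f v)) ->
  is_derive (potential F a c) v (f v - c * v - a).
Proof.
  intros HF; unfold potential; eapply is_derive_eq; [der | field].
Qed.

Section Orbit.

Context (f F : R -> R) (a E c um up : R) (u : R -> R).
Context (f_C2 : is_C2 f) (HF : forall v, is_derive F v (f v)).
Context (W : is_well F a E c um up) (O : is_profile f F a E c um u).

(** A simple root gives only a nonzero slope; with the wrong sign the potential would exceed [E]
    just inside the well. *)
Lemma well_slopes : f um - c * um - a < 0 /\ 0 < f up - c * up - a.
Proof.
  destruct W as (_ & Hlt & Em & Dm & Ep & Dp & Hin).
  pose proof (potential_derive f F a c um HF) as Hm.
  pose proof (potential_derive f F a c up HF) as Hp.
  rewrite (is_derive_unique _ _ _ Hm) in Dm.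
  rewrite (is_derive_unique _ _ _ Hp) in Dp.
  split.
  - destruct (Rtotal_order (f um - c * um - a) 0) as [H | [H | H]]; [easy | easy |].
    destruct (derive_pos_local _ _ _ Hm H) as [e [He [H1 _]]].
    set (v := um + Rmin e (up - um) / 2).
    assert (0 < Rmin e (up - um)) by (apply Rmin_case; lra).
    pose proof (Rmin_l e (up - um)); pose proof (Rmin_r e (up - um)).
    assert (potential F a c um < potential F a c v) by (apply H1; unfold v; lra).
    assert (potential F a c v < E) by (apply Hin; unfold v; lra). lra.
  - destruct (Rtotal_order (f up - c * up - a) 0) as [H | [H | H]]; [ | easy | easy].
    destruct (derive_neg_local _ _ _ Hp H) as [e [He [_ H1]]].
    set (v := up - Rmin e (up - um) / 2).
    assert (0 < Rmin e (up - um)) by (apply Rmin_case; lra).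
    pose proof (Rmin_l e (up - um)); pose proof (Rmin_r e (up - um)).
    assert (potential F a c up < potential F a c v) by (apply H1; unfold v; lra).
    assert (potential F a c v < E) by (apply Hin; unfold v; lra). lra.
Qed.

Lemma profile_derive (x : R) : is_derive u x (Derive u x).
Proof. apply Derive_correct, O. Qed.

Lemma profile_derive2 (x : R) : is_derive (Derive u) x (a - f (u x) + c * u x).
Proof. apply O. Qed.

Lemma profile_start : u 0 = um /\ Derive u 0 = 0.
Proof. destruct O as (_ & _ & _ & _ & _ & H); exact H. Qed.

Lemma profile_energy (x : R) : / 2 * Derive u x ^ 2 + potential F a c (u x) = E.
Proof. apply O. Qed.

Lemma profile_continuous (x : R) : continuous u x.
Proof. eapply continuous_of_derive, profile_derive. Qed.

(** Conservation of energy forbids values with [V > E], and the slopes make [V > E] just outside the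
    well. By continuity an orbit leaving [[um, up]] would take such values. *)
Lemma profile_in_well (x : R) : um <= u x <= up.
Proof.
  assert (P : forall v, (exists y, u y = v) -> potential F a c v <= E).
  { intros v [y <-]; pose proof (profile_energy y); nra. }
  destruct well_slopes as [Hm Hp]; destruct profile_start as [S0 _].
  assert (I : forall v, Rmin (u x) um <= v <= Rmax (u x) um -> exists y, u y = v).
  { intros v Hv; destruct (Rle_dec 0 x) as [H | H].
    - destruct (intermediate_value u 0 x v) as [y [_ Hy]];
        [apply profile_continuous | lra | rewrite S0, Rmin_comm, Rmax_comm; lra |].
      now exists y.
    - destruct (intermediate_value u x 0 v) as [y [_ Hy]];
        [apply profile_continuous | lra | now rewrite S0 |].
      now exists y. }
  destruct W as (_ & Hlt & Em & _ & Ep & _ & _).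
  destruct (derive_neg_local _ _ _ (potential_derive f F a c um HF) Hm)
    as [e [He [_ H1]]].
  destruct (derive_pos_local _ _ _ (potential_derive f F a c up HF) Hp)
    as [e' [He' [H1' _]]].
  split; apply Rnot_lt_le; intros H.
  (* [um - d] is close enough to [um] for the slope to decide the sign and still lies between [u x]
     and [um]. *)
  - set (d := Rmin (e / 2) (um - u x)).
    assert (0 < d) by (apply Rmin_case; lra).
    assert (d <= e / 2) by apply Rmin_l. assert (d <= um - u x) by apply Rmin_r.
    assert (potential F a c um < potential F a c (um - d)) by (apply H1; lra).
    assert (potential F a c (um - d) <= E).
    { apply P, I; rewrite Rmin_left, Rmax_right by lra; lra. }
    lra.
  - set (d := Rmin (e' / 2) (u x - up)).
    assert (0 < d) by (apply Rmin_case; lra).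
    assert (d <= e' / 2) by apply Rmin_l. assert (d <= u x - up) by apply Rmin_r.
    assert (potential F a c up < potential F a c (up + d)) by (apply H1'; lra).
    assert (potential F a c (up + d) <= E).
    { apply P, I; rewrite Rmin_right, Rmax_left by lra; lra. }
    lra.
Qed.

(** [tau] is the supremum of the times before which [u] has kept increasing. There the velocity
    vanishes, so the energy puts [u tau] at an end of the well, and it cannot be the lower one. *)
Lemma profile_rise : exists tau, 0 < tau /\ (forall x, 0 < x < tau -> 0 < Derive u x) /\
  u tau = up /\ Derive u tau = 0.
Proof.
  destruct well_slopes as [Hm _]; destruct profile_start as [S0 S1].
  destruct (derive_pos_local (Derive u) 0 _ (profile_derive2 0)) as [e [He [Hpos _]]].
  { rewrite S0; lra. }
  rewrite S1, Rplus_0_l in Hpos.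
  destruct O as (_ & _ & _ & _ & (L & HL & Per) & _).
  set (S := fun t => 0 < t /\ forall x, 0 < x < t -> 0 < Derive u x).
  (* Periodicity bounds these times: [u] cannot increase strictly over a whole period. *)
  assert (Sb : bound S).
  { exists L; intros t [Ht Hx]; apply Rnot_lt_le; intros HLt.
    assert (u 0 < u L).
    { apply (strictly_increasing u (Derive u) 0 L); try lra.
      - intros s _; apply profile_derive.
      - intros s Hs; apply Hx; lra. }
    specialize (Per 0); rewrite Rplus_0_l in Per; lra. }
  destruct (completeness S Sb) as [tau [Hub Hlub]].
  { exists e; split; [exact He | intros; apply Hpos; lra]. }
  assert (He' : e <= tau) by (apply Hub; split; [exact He | intros; apply Hpos; lra]).
  assert (Hin : forall x, 0 < x < tau -> 0 < Derive u x).
  { intros x Hx; apply NNPP; intros HN.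
    assert (tau <= x); [ | lra].
    apply Hlub; intros t [Ht Hx']; apply Rnot_lt_le; intros Hxt.
    apply HN, Hx'; lra. }
  assert (Hc : forall x, continuous (Derive u) x)
    by (intros x; eapply continuous_of_derive, profile_derive2).
  (* A negative velocity at [tau] would already be negative somewhat earlier; a positive one would
     prolong the rise. *)
  assert (H0 : Derive u tau = 0).
  { destruct (Rtotal_order (Derive u tau) 0) as [H | [H | H]]; [ | easy |].
    - destruct (intermediate_value (Derive u) (tau / 2) tau (Derive u tau / 2))
        as [x [Hx Ex]]; [exact Hc | lra | |].
      + assert (0 < Derive u (tau / 2)) by (apply Hin; lra).
        rewrite Rmin_right, Rmax_left; lra.
      + destruct (Rle_lt_or_eq_dec x tau (proj2 Hx)) as [Hl | ->]; [ | lra].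
        assert (0 < Derive u x) by (apply Hin; lra). lra.
    - assert (Hl : locally tau (fun x => 0 < Derive u x)).
      { apply (Hc tau (fun v => 0 < v)), (open_gt 0 (Derive u tau)), H. }
      destruct Hl as [d Hd].
      assert (tau + d / 2 <= tau); [ | pose proof (cond_pos d); lra].
      pose proof (cond_pos d).
      apply Hub; split; [lra | intros x Hx].
      destruct (Rlt_dec x tau); [apply Hin; lra |].
      apply Hd; unfold ball; simpl; unfold AbsRing_ball, abs, minus, plus, opp; simpl.
      rewrite Rabs_right; lra. }
  exists tau; repeat split; [lra | exact Hin | | exact H0].
  pose proof (profile_energy tau) as He1; rewrite H0 in He1.
  assert (u 0 < u tau).
  { apply (strictly_increasing u (Derive u) 0 tau); try lra.
    - intros s _; apply profile_derive.
    - exact Hin. }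
  pose proof (profile_in_well tau) as [_ Hle].
  destruct (Rle_lt_or_eq_dec _ _ Hle) as [Hl | Hl]; [ | exact Hl].
  destruct W as (_ & _ & _ & _ & _ & _ & Hin').
  assert (potential F a c (u tau) < E) by (apply Hin'; lra). lra.
Qed.

(** The equation is autonomous and invariant under time reversal, so [u (tau + s)] and [u (tau - s)]
    are two solutions with the same data at a turning point. *)
Lemma profile_reflect (tau : R) : 0 < tau -> Derive u tau = 0 ->
  forall s, 0 <= s <= tau -> u (tau + s) = u (tau - s) /\
    Derive u (tau + s) = - Derive u (tau - s).
Proof.
  intros Ht H0.
  apply (newton_uniqueness f a c um up tau (fun s => u (tau + s))
    (fun s => Derive u (tau + s)) (fun s => u (tau - s)) (fun s => - Derive u (tau - s)));
    [exact f_C2 | | | | | | now rewrite Rplus_0_r, Rminus_0_r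
     | rewrite Rplus_0_r, Rminus_0_r; lra].
  - intros x _; eapply is_derive_eq.
    + apply (is_derive_comp u (fun s => tau + s)); [apply profile_derive | der].
    + unfold scal; simpl; unfold mult; simpl; ring.
  - intros x _; eapply is_derive_eq.
    + apply (is_derive_comp (Derive u) (fun s => tau + s)); [apply profile_derive2 | der].
    + unfold scal; simpl; unfold mult; simpl; ring.
  - intros x _; eapply is_derive_eq.
    + apply (is_derive_comp u (fun s => tau - s)); [apply profile_derive | der].
    + unfold scal; simpl; unfold mult; simpl; ring.
  - intros x _; eapply is_derive_eq.
    + apply is_derive_Ropp.
      apply (is_derive_comp (Derive u) (fun s => tau - s)); [apply profile_derive2 | der].
    + unfold scal; simpl; unfold mult; simpl; ring.
  - intros x _; split; apply profile_in_well.
Qed.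

(** Substituting [v = u x] turns the integrand into 1, because conservation of energy gives
    [sqrt (2 (E - V (u x))) = u' x] while [u] rises. The integral is improper at both turning
    points, so this is done strictly inside and the end times are then pushed to 0 and [tau]. *)
Lemma profile_travel_time (tau : R) : 0 < tau ->
  (forall x, 0 < x < tau -> 0 < Derive u x) -> u tau = up ->
  is_RInt_gen (fun v => / sqrt (2 * (E - potential F a c v)))
    (at_right um) (at_left up) tau.
Proof.
  intros Ht Hpos Hup.
  destruct profile_start as [S0 _].
  pose proof (strictly_increasing u (Derive u) 0 tau (fun x _ => profile_derive x) Hpos)
    as Hinc.
  set (g := fun v => / sqrt (2 * (E - potential F a c v))).
  assert (Hg : forall x1 x2, 0 < x1 < tau -> 0 < x2 < tau ->
    is_RInt g (u x1) (u x2) (x2 - x1)).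
  { intros x1 x2 H1 H2.
    assert (Hb : forall x, Rmin x1 x2 <= x <= Rmax x1 x2 -> 0 < x < tau).
    { intros x; unfold Rmin, Rmax; destruct (Rle_dec x1 x2); lra. }
    assert (Hs : forall x, 0 < x < tau ->
      2 * (E - potential F a c (u x)) = Derive u x ^ 2).
    { intros x Hx; pose proof (profile_energy x); lra. }
    assert (Hgc : forall x, 0 < x < tau -> continuous g (u x)).
    { intros x Hx; specialize (Hs x Hx); specialize (Hpos x Hx).
      assert (0 < 2 * (E - potential F a c (u x))) by (rewrite Hs; nra).
      unfold g; apply (continuous_comp (fun v => sqrt (2 * (E - potential F a c v))) Rinv).
      - apply (continuous_comp (fun v => 2 * (E - potential F a c v)) sqrt).
        + pose proof (potential_derive f F a c (u x) HF) as D.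
          eapply continuous_of_derive; der.
        + apply continuous_sqrt.
      - apply continuous_Rinv, Rgt_not_eq, sqrt_lt_R0; lra. }
    assert (Hval : forall x, 0 < x < tau -> Derive u x * g (u x) = 1).
    { intros x Hx; unfold g; rewrite Hs by exact Hx; specialize (Hpos x Hx).
      rewrite sqrt_pow2 by lra; field; lra. }
    assert (I : is_RInt (fun x => scal (Derive u x) (g (u x))) x1 x2
                  (RInt g (u x1) (u x2))).
    { apply (is_RInt_comp (V := R_CompleteNormedModule) g u (Derive u) x1 x2).
      - intros x Hx; apply Hgc, Hb, Hx.
      - intros x Hx; split; [apply profile_derive |].
        eapply continuous_of_derive, profile_derive2. }
    assert (I' : is_RInt (fun _ : R => 1) x1 x2 (RInt g (u x1) (u x2))).
    { eapply is_RInt_ext; [ | exact I].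
      intros x Hx; apply Hval, Hb; lra. }
    assert (RInt g (u x1) (u x2) = x2 - x1) as <-.
    { rewrite <- (is_RInt_unique _ _ _ _ I'), RInt_const.
      unfold scal; simpl; unfold mult; simpl; ring. }
    apply (RInt_correct (V := R_CompleteNormedModule) g),
      (ex_RInt_continuous (V := R_CompleteNormedModule) g); intros v Hv.
    (* Continuity of [g] is known only at values that the orbit takes while rising. *)
    assert (Hx : exists x, 0 < x < tau /\ u x = v).
    { destruct (Rle_dec x1 x2).
      - destruct (intermediate_value u x1 x2 v) as [x [Hx Ex]];
          [apply profile_continuous | lra | exact Hv |].
        exists x; split; [lra | exact Ex].
      - destruct (intermediate_value u x2 x1 v) as [x [Hx Ex]];
          [apply profile_continuous | lra | rewrite Rmin_comm, Rmax_comm; exact Hv |].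
        exists x; split; [lra | exact Ex]. }
    destruct Hx as [x [Hx <-]]; now apply Hgc. }
  intros P [eps HP].
  (* Each end time is off by at most [e <= eps / 3], so the travel time differs from [tau] by less
     than [eps]; [e <= tau / 3] keeps the two ends apart. *)
  set (e := Rmin (eps / 3) (tau / 3)).
  assert (Hep := cond_pos eps).
  assert (He : 0 < e) by (apply Rmin_case; lra).
  assert (e <= eps / 3) by apply Rmin_l. assert (e <= tau / 3) by apply Rmin_r.
  assert (u 0 < u e) by (apply Hinc; lra).
  assert (u (tau - e) < u tau) by (apply Hinc; lra).
  rewrite S0 in *; rewrite Hup in *.
  apply (Filter_prod _ _ _ (fun v => um < v < u e) (fun v => u (tau - e) < v < up)).
  - exists (mkposreal (u e - um) ltac:(lra)); intros v Hv Hv'.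
    unfold ball in Hv; simpl in Hv; unfold AbsRing_ball, abs, minus, plus, opp in Hv;
      simpl in Hv. apply Rabs_def2 in Hv; lra.
  - exists (mkposreal (up - u (tau - e)) ltac:(lra)); intros v Hv Hv'.
    unfold ball in Hv; simpl in Hv; unfold AbsRing_ball, abs, minus, plus, opp in Hv;
      simpl in Hv. apply Rabs_def2 in Hv; lra.
  - intros v w Hv Hw; simpl.
    destruct (intermediate_value u 0 e v) as [x [Hx Ex]];
      [apply profile_continuous | lra | rewrite S0, Rmin_left, Rmax_right; lra |].
    destruct (intermediate_value u (tau - e) tau w) as [y [Hy Ey]];
      [apply profile_continuous | lra | rewrite Hup, Rmin_left, Rmax_right; lra |].
    assert (x <> 0) by (intros ->; lra). assert (y <> tau) by (intros ->; lra).
    exists (y - x); split.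
    + rewrite <- Ex, <- Ey; apply Hg; lra.
    + apply HP; unfold ball; simpl; unfold AbsRing_ball, abs, minus, plus, opp; simpl.
      apply Rabs_def1; lra.
Qed.

End Orbit.

(** The sign on the second half later bounds the turning time from above when the parameters
    vary. *)
Definition is_half_period (u : R -> R) (up tau : R) : Prop :=
  0 < tau /\ (forall x, 0 < x < tau -> 0 < Derive u x) /\ u tau = up /\
  (forall x, tau < x < 2 * tau -> Derive u x < 0).

(** The integral that defines the period is twice the rise time, and reflection at the top returns
    the orbit to [u_minus] with zero velocity. *)
Lemma period_spec (f F : R -> R) (u_minus u_plus : R -> R -> R -> R) (a E c : R)
    (u : R -> R) :
  is_C2 f -> (forall v, is_derive F v (f v)) ->
  is_well F a E c (u_minus a E c) (u_plus a E c) ->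
  is_profile f F a E c (u_minus a E c) u ->
  let T := period F u_minus u_plus a E c in
  is_half_period u (u_plus a E c) (T / 2) /\
  u T = u_minus a E c /\ Derive u T = 0.
Proof.
  intros Hf HF W O.
  destruct (profile_rise f F a E c _ _ u HF W O) as (tau & Ht & Hpos & Hup & H0).
  assert (T2 : period F u_minus u_plus a E c = 2 * tau).
  { unfold period; f_equal; apply is_RInt_gen_unique.
    eapply profile_travel_time; eauto. }
  intros T; unfold T; rewrite T2; replace (2 * tau / 2) with tau by field.
  pose proof (profile_reflect f F a E c _ _ u Hf HF W O tau Ht H0) as Hr.
  destruct (profile_start f F a E c _ u O) as [S0 S1].
  split; [repeat split; auto | ].
  - intros x Hx; destruct (Hr (x - tau)) as [_ Hx']; [lra |].
    replace (tau + (x - tau)) with x in Hx' by ring; rewrite Hx'.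
    assert (0 < Derive u (tau - (x - tau))) by (apply Hpos; lra). lra.
  - destruct (Hr tau) as [Hx Hx']; [lra |].
    replace (tau + tau) with (2 * tau) in * by ring.
    rewrite Rminus_diag_eq in * by reflexivity; rewrite S0, S1 in *; lra.
Qed.

(** * Dependence on the parameters *)

Lemma locally_R (x : R) (P : R -> Prop) :
  locally x P <-> exists d, 0 < d /\ forall y, Rabs (y - x) < d -> P y.
Proof.
  split.
  - intros [d Hd]; exists d; split; [apply cond_pos | exact Hd].
  - intros (d & Hd & H); exists (mkposreal d Hd); exact H.
Qed.

Lemma derive_approx (f : R -> R) (x l : R) :
  is_derive f x l <->
  forall eps, 0 < eps -> locally x (fun y => Rabs (f y - f x - l * (y - x)) <= eps * Rabs (y - x)).
Proof.
  rewrite is_derive_Reals; split.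
  - intros H eps He; destruct (H eps He) as [d Hd].
    apply locally_R; exists d; split; [apply cond_pos |]; intros y Hy.
    destruct (Req_dec y x) as [-> | Hn].
    + replace (f x - f x - l * (x - x)) with 0 by ring.
      rewrite Rminus_diag, Rabs_R0; lra.
    + specialize (Hd (y - x) ltac:(lra) Hy).
      replace (x + (y - x)) with y in Hd by ring.
      replace (f y - f x - l * (y - x)) with (((f y - f x) / (y - x) - l) * (y - x))
        by (field; lra).
      rewrite Rabs_mult; apply Rmult_le_compat_r; [apply Rabs_pos | lra].
  - intros H eps He.
    assert (He2 : 0 < eps / 2) by lra.
    destruct (proj1 (locally_R _ _) (H _ He2)) as (d & Hd & H').
    exists (mkposreal d Hd); intros h Hh Hhd; simpl in Hhd.
    specialize (H' (x + h)); replace (x + h - x) with h in H' by ring.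
    replace ((f (x + h) - f x) / h - l) with ((f (x + h) - f x - l * h) / h)
      by (field; exact Hh).
    rewrite Rabs_div by exact Hh.
    assert (0 < Rabs h) by (apply Rabs_pos_lt, Hh).
    apply Rle_lt_trans with (eps / 2); [ | lra].
    apply Rle_div_l; [lra | auto].
Qed.

Lemma continuous_near (g : R -> R) (x eps : R) :
  continuous g x -> 0 < eps -> locally x (fun y => Rabs (g y - g x) < eps).
Proof.
  intros Hg He; apply (Hg (fun v => Rabs (v - g x) < eps)), locally_R.
  now exists eps.
Qed.

(** Serves both for the lower turning value and for the period. Continuity of [y] first yields a
    bound of order [h] for [y h - y 0], which is then fed back into the tangent approximation of
    [g]. *)
Lemma implicit_derive (g y r : R -> R) (l b : R) :
  is_derive g (y 0) b -> b <> 0 -> continuous y 0 ->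
  locally 0 (fun h => g (y h) - g (y 0) = h * r h) ->
  (forall eps, 0 < eps -> locally 0 (fun h => Rabs (r h - l) <= eps)) ->
  is_derive y 0 (l / b).
Proof.
  intros Hg Hb Hy He Hr; apply derive_approx; intros eps Heps.
  assert (B : 0 < Rabs b) by (apply Rabs_pos_lt, Hb).
  set (C := Rabs l + 1). assert (HC : 0 < C) by (pose proof (Rabs_pos l); unfold C; lra).
  (* The first bound lets [eta |z|] be absorbed into [|b| |z|]; the second makes the fed-back error
     [eta (2 C |h|)] at most half of the allowed [eps b^2 |h|]. *)
  set (eta := Rmin (Rabs b / 2) (eps * Rabs b * Rabs b / (4 * C))).
  assert (Heta : 0 < eta).
  { apply Rmin_case; [lra |].
    apply Rdiv_lt_0_compat; [ | lra].
    apply Rmult_lt_0_compat; [apply Rmult_lt_0_compat | ]; lra. }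
  assert (E1 : eta <= Rabs b / 2) by apply Rmin_l.
  assert (E2 : eta * C <= eps * Rabs b * Rabs b / 4).
  { apply Rle_trans with (eps * Rabs b * Rabs b / (4 * C) * C).
    - apply Rmult_le_compat_r; [lra | apply Rmin_r].
    - right; field; lra. }
  assert (Hg' := proj1 (derive_approx _ _ _) Hg eta Heta).
  assert (Hyg : locally 0 (fun h => Rabs (g (y h) - g (y 0) - b * (y h - y 0)) <=
                 eta * Rabs (y h - y 0))) by exact (Hy _ Hg').
  assert (Hr1 := Hr 1 Rlt_0_1).
  assert (Hr2 := Hr (eps * Rabs b / 2) ltac:(apply Rdiv_lt_0_compat; [ | lra]; nra)).
  generalize (filter_and _ _ (filter_and _ _ Hyg He) (filter_and _ _ Hr1 Hr2)).
  apply filter_imp; intros h [[H1 H2] [H3 H4]].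
  rewrite H2 in H1; rewrite Rminus_0_r.
  set (z := y h - y 0) in *.
  assert (R1 : Rabs (r h) <= C).
  { replace (r h) with ((r h - l) + l) by ring.
    eapply Rle_trans; [apply Rabs_triang | unfold C; lra]. }
  assert (Z : Rabs b * Rabs z <= 2 * (Rabs h * C)).
  { rewrite <- Rabs_mult.
    replace (b * z) with (h * r h - (h * r h - b * z)) by ring.
    assert (Rabs (h * r h - (h * r h - b * z)) <= Rabs (h * r h) + Rabs (h * r h - b * z)).
    { eapply Rle_trans; [apply Rabs_triang | rewrite Rabs_Ropp; lra]. }
    assert (eta * Rabs z <= Rabs b / 2 * Rabs z)
      by (apply Rmult_le_compat_r; [apply Rabs_pos | exact E1]).
    assert (Rabs (h * r h) <= Rabs h * C).
    { rewrite Rabs_mult; apply Rmult_le_compat_l; [apply Rabs_pos | exact R1]. }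
    assert (Rabs b * Rabs z = Rabs (h * r h - (h * r h - b * z))).
    { rewrite <- Rabs_mult; f_equal; ring. }
    lra. }
  assert (K : Rabs b * Rabs (z - l / b * h) <= eps * Rabs h * Rabs b).
  { rewrite <- Rabs_mult.
    replace (b * (z - l / b * h)) with (- (h * r h - b * z) + h * (r h - l))
      by (field; exact Hb).
    eapply Rle_trans; [apply Rabs_triang |].
    rewrite Rabs_Ropp, (Rabs_mult h).
    assert (Rabs h * Rabs (r h - l) <= Rabs h * (eps * Rabs b / 2))
      by (apply Rmult_le_compat_l; [apply Rabs_pos | exact H4]).
    assert (Rabs b * (eta * Rabs z) <= Rabs b * (eps * Rabs b / 2 * Rabs h)).
    { apply Rle_trans with (eta * (2 * (Rabs h * C))).
      - replace (Rabs b * (eta * Rabs z)) with (eta * (Rabs b * Rabs z)) by ring.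
        apply Rmult_le_compat_l; lra.
      - replace (eta * (2 * (Rabs h * C))) with (2 * Rabs h * (eta * C)) by ring.
        apply Rle_trans with (2 * Rabs h * (eps * Rabs b * Rabs b / 4)).
        + apply Rmult_le_compat_l; [pose proof (Rabs_pos h); lra | exact E2].
        + right; field. }
    apply Rmult_le_reg_l in H0; [ | exact B]. lra. }
  apply Rmult_le_reg_l with (Rabs b); [exact B | lra].
Qed.

Lemma integral_derive (g : R -> R) (x : R) :
  (forall t, continuous g t) -> is_derive (fun t => RInt g 0 t) x (g x).
Proof.
  intros Hg; apply (is_derive_RInt g _ 0); [ | apply Hg].
  apply filter_forall; intros t; apply (RInt_correct (V := R_CompleteNormedModule)),
    (ex_RInt_continuous (V := R_CompleteNormedModule)); intros; apply Hg.
Qed.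

Lemma continuous_ex_RInt (g : R -> R) (A B : R) :
  (forall t, continuous g t) -> ex_RInt g A B.
Proof.
  intros Hg; apply (ex_RInt_continuous (V := R_CompleteNormedModule)); intros; apply Hg.
Qed.

(** Integrand and upper limit vary together. Taking [X] beyond [Th 0] keeps the moving limit inside
    the range of the uniform expansion. *)
Lemma derive_integral_family (yh : R -> R -> R) (y w Th : R -> R) (X : R)
    (T' : R) :
  (forall t, continuous y t) -> (forall t, continuous w t) ->
  locally 0 (fun h => forall t, continuous (yh h) t) ->
  0 < Th 0 < X -> is_derive Th 0 T' ->
  (forall eps, 0 < eps -> locally 0 (fun h => forall x, 0 <= x <= X ->
     Rabs (yh h x - y x - h * w x) <= eps * Rabs h)) ->
  is_derive (fun h => RInt (yh h) 0 (Th h)) 0 (y (Th 0) * T' + RInt w 0 (Th 0)).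
Proof.
  intros Hy Hw Hyh HT DT Ha.
  (* The integral splits into a remainder [A], the unperturbed integrand up to the moving limit,
     [B], and [h] times the integral [W] of the first variation. *)
  set (A := (fun h => RInt (fun x => yh h x - y x - h * w x) 0 (Th h)) : R -> R).
  set (B := (fun h => RInt y 0 (Th h)) : R -> R).
  set (W := (fun h => RInt w 0 (Th h)) : R -> R).
  assert (HTc : locally 0 (fun h => 0 < Th h < X)).
  { assert (Hc := continuous_of_derive _ _ _ DT).
    assert (G1 : locally 0 (fun h => Th h < X))
      by exact (Hc (fun t => t < X) (open_lt X _ (proj2 HT))).
    assert (G2 : locally 0 (fun h => 0 < Th h))
      by exact (Hc (fun t => 0 < t) (open_gt 0 _ (proj1 HT))).
    generalize (filter_and _ _ G1 G2); apply filter_imp; intros h [H1 H2]; lra. }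
  assert (DB : is_derive B 0 (y (Th 0) * T')).
  { eapply is_derive_eq.
    - apply (is_derive_comp (fun t => RInt y 0 t) Th); [now apply integral_derive | exact DT].
    - unfold scal; simpl; unfold mult; simpl; ring. }
  assert (DW : is_derive W 0 (w (Th 0) * T')).
  { eapply is_derive_eq.
    - apply (is_derive_comp (fun t => RInt w 0 t) Th); [now apply integral_derive | exact DT].
    - unfold scal; simpl; unfold mult; simpl; ring. }
  assert (HA : forall eps, 0 < eps -> locally 0 (fun h => Rabs (A h) <= eps * Rabs h)).
  { intros eps He.
    assert (He' : 0 < eps / X) by (apply Rdiv_lt_0_compat; lra).
    generalize (filter_and _ _ (filter_and _ _ Hyh HTc) (Ha _ He')).
    apply filter_imp; intros h [[H1 H2] H3]; unfold A.
    eapply Rle_trans; [apply (abs_RInt_le_const _ 0 (Th h) (eps / X * Rabs h)) |].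
    - lra.
    - apply continuous_ex_RInt; intros t.
      apply (continuous_minus (V := R_NormedModule)).
      + apply (continuous_minus (V := R_NormedModule)); [apply H1 | apply Hy].
      + apply (continuous_scal_r (V := R_NormedModule)), Hw.
    - intros t Ht; apply H3; lra.
    - rewrite Rminus_0_r.
      replace (eps * Rabs h) with (X * (eps / X * Rabs h)) by (field; lra).
      apply Rmult_le_compat_r; [ | lra].
      apply Rmult_le_pos; [lra | apply Rabs_pos]. }
  assert (A0 : A 0 = 0).
  { assert (H := locally_singleton _ _ (HA 1 Rlt_0_1)).
    cbv beta in H; rewrite Rabs_R0, Rmult_0_r in H.
    pose proof (Rabs_pos (A 0)).
    destruct (Req_dec (A 0) 0) as [| Hn]; [easy | pose proof (Rabs_pos_lt _ Hn); lra]. }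
  assert (DA : is_derive A 0 0).
  { apply derive_approx; intros eps He; generalize (HA eps He); apply filter_imp.
    intros h Hh; rewrite A0, Rmult_0_l, !Rminus_0_r; exact Hh. }
  apply is_derive_ext_loc with (f := fun h => A h + B h + h * W h).
  - generalize (filter_and _ _ Hyh HTc); apply filter_imp; intros h [H1 H2]; unfold A, B, W.
    assert (I1 := continuous_ex_RInt (yh h) 0 (Th h) H1).
    assert (I2 := continuous_ex_RInt y 0 (Th h) Hy).
    assert (I3 := continuous_ex_RInt w 0 (Th h) Hw).
    rewrite (RInt_minus (V := R_CompleteNormedModule) (fun x => yh h x - y x) (fun x => h * w x)).
    2: now apply (ex_RInt_minus (V := R_NormedModule)).
    2: now apply (ex_RInt_scal (V := R_NormedModule)).
    rewrite (RInt_minus (V := R_CompleteNormedModule) (yh h) y) by assumption.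
    assert (I4 : RInt (fun x => h * w x) 0 (Th h) = h * RInt w 0 (Th h))
      by exact (RInt_scal (V := R_CompleteNormedModule) w 0 (Th h) h I3).
    rewrite I4; unfold minus, plus, opp; simpl; ring.
  - eapply is_derive_eq; [der | unfold W; cbv beta; ring].
Qed.

(** With this coefficient [q] the linearized operator is [L = - d^2/dx^2 - q]. *)
Definition linear_coefficient (f : R -> R) (c : R) (u : R -> R) (x : R) : R :=
  Derive f (u x) - c.

(* The derivative of the profile with respect to E. *)
Definition is_energy_variation (b : R) (q e e1 : R -> R) : Prop :=
  (forall x, is_derive e x (e1 x)) /\ (forall x, is_derive e1 x (- q x * e x)) /\
  e 0 = - / b /\ e1 0 = 0.

(* Variation of constants for [w'' = - q w + da + dc u] in the basis [u_x], [e] of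
   the homogeneous equation, whose Wronskian is 1: this is the derivative of the
   profile in the direction (da, dE, dc). *)
Definition variation (u e : R -> R) (da dE dc : R) (x : R) : R :=
  e x * (da * u x + dE + dc / 2 * u x ^ 2)
  - Derive u x * RInt (fun t => e t * (da + dc * u t)) 0 x.

(** The derivative of [variation]: the contributions of its two coefficients cancel, as always in
    variation of constants. *)
Definition variation1 (f u e e1 : R -> R) (a c da dE dc : R) (x : R) : R :=
  e1 x * (da * u x + dE + dc / 2 * u x ^ 2)
  - (a - f (u x) + c * u x) * RInt (fun t => e t * (da + dc * u t)) 0 x.

Section Branch.

Context (f F : R -> R) (a E c um up : R) (u : R -> R) (da dE dc : R).
Context (f_C2 : is_C2 f) (HF : forall v, is_derive F v (f v)).
Context (W : is_well F a E c um up) (O : is_profile f F a E c um u).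

Let q := linear_coefficient f c u.
Let b := a - f um + c * um.
Context (e e1 : R -> R) (He : is_energy_variation b q e e1).
Let w := variation u e da dE dc.
Let w1 := variation1 f u e e1 a c da dE dc.

Lemma well_curvature_pos : 0 < b.
Proof. destruct (well_slopes f F a E c um up HF W); unfold b; lra. Qed.

Lemma profile_derive3 (x : R) :
  is_derive (fun t => a - f (u t) + c * u t) x (- q x * Derive u x).
Proof.
  pose proof (profile_derive f F a E c um u O x).
  assert (is_derive (fun t => f (u t)) x (Derive f (u x) * Derive u x)).
  { eapply is_derive_eq;
      [apply (is_derive_comp f u); [now apply C2_derive | eassumption] |].
    unfold scal; simpl; unfold mult; simpl; ring. }
  eapply is_derive_eq; [der | unfold q, linear_coefficient; cbv beta; ring].
Qed.

(** Both [u_x] and [e] solve [w'' = - q w], and the value at 0 is [- b * (- / b)]. *)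
Lemma energy_wronskian (x : R) : 0 <= x ->
  Derive u x * e1 x - (a - f (u x) + c * u x) * e x = 1.
Proof.
  intros Hx; destruct He as (D1 & D2 & E0 & E1).
  pose (u2 := fun x => a - f (u x) + c * u x).
  assert (D3 : forall x, is_derive u2 x (- q x * Derive u x)) by exact profile_derive3.
  assert (D4 : forall x, is_derive (Derive u) x (u2 x))
    by exact (profile_derive2 f F a E c um u O).
  destruct (mean_value (fun x => Derive u x * e1 x - u2 x * e x) (fun _ => 0) 0 x Hx)
    as [t [_ Et]].
  { intros t _; eapply is_derive_eq; [der | cbv beta; ring]. }
  unfold u2 in Et.
  destruct (profile_start f F a E c um u O) as [S0 S1].
  rewrite S0, S1, E0, E1 in Et. fold b in Et. pose proof well_curvature_pos.
  assert (b * - / b = -1) by (field; lra). lra.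
Qed.

Lemma variation_integrand_continuous (x : R) :
  continuous (fun t => e t * (da + dc * u t)) x.
Proof.
  destruct He as (D1 & _); pose proof (profile_derive f F a E c um u O) as D.
  eapply continuous_of_derive; der.
Qed.

Lemma variation_derive (x : R) : is_derive w x (w1 x).
Proof.
  destruct He as (D1 & _).
  pose proof (profile_derive f F a E c um u O) as D.
  pose proof (profile_derive2 f F a E c um u O) as D'.
  pose proof (fun x => integral_derive _ x variation_integrand_continuous) as DI.
  unfold w, variation; eapply is_derive_eq; [der |].
  unfold w1, variation1; cbv beta; field.
Qed.

Lemma variation_derive2 (x : R) : 0 <= x ->
  is_derive w1 x (- q x * w x + da + dc * u x).
Proof.
  intros Hx; pose proof (energy_wronskian x Hx) as Wr; destruct He as (D1 & D2 & _).
  pose proof (profile_derive f F a E c um u O) as D.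
  pose (u2 := fun x => a - f (u x) + c * u x).
  assert (D' : forall x, is_derive u2 x (- q x * Derive u x)) by exact profile_derive3.
  pose proof (fun x => integral_derive _ x variation_integrand_continuous) as DI.
  apply is_derive_ext with (f := fun x =>
    e1 x * (da * u x + dE + dc / 2 * u x ^ 2)
    - u2 x * RInt (fun t => e t * (da + dc * u t)) 0 x); [reflexivity |].
  eapply is_derive_eq; [der |].
  unfold w, variation, u2; cbv beta.
  transitivity (- q x * w x + (da + dc * u x) * 1); [ | unfold w, variation; ring].
  rewrite <- Wr; unfold w, variation; field.
Qed.

(** [w 0] is what implicit differentiation of [V (u_minus) = E] gives, since the slope of [V] there
    is [- b]. *)
Lemma variation_start :
  w 0 = - (da * um + dE + dc / 2 * um ^ 2) / b /\ w1 0 = 0.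
Proof.
  destruct (profile_start f F a E c um u O) as [S0 S1]; destruct He as (_ & _ & E0 & E1).
  pose proof well_curvature_pos; unfold w, w1, variation, variation1.
  rewrite RInt_point, S0, S1, E0, E1; unfold zero; simpl; split; field; lra.
Qed.

End Branch.

Section Family.

Context (f F : R -> R) (a E c um up : R) (u : R -> R) (da dE dc : R).
Context (f_C2 : is_C2 f) (HF : forall v, is_derive F v (f v)).
Context (W : is_well F a E c um up) (O : is_profile f F a E c um u).

Let q := linear_coefficient f c u.
Let b := a - f um + c * um.
Context (e e1 : R -> R) (He : is_energy_variation b q e e1).
Let w := variation u e da dE dc.
Let w1 := variation1 f u e e1 a c da dE dc.

Context (vh wh Th : R -> R) (uh : R -> R -> R).
Context (HW : locally 0 (fun h =>
  is_well F (a + h * da) (E + h * dE) (c + h * dc) (vh h) (wh h) /\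
  is_profile f F (a + h * da) (E + h * dE) (c + h * dc) (vh h) (uh h))).
Context (v0 : vh 0 = um) (vc : continuous vh 0).
Context (w0 : wh 0 = up) (wc : continuous wh 0).

(** The potential is affine in the parameters, so at the perturbed root the unperturbed potential
    differs from [E] by exactly [h * N (vh h)]. *)
Lemma branch_root_derive : is_derive vh 0 (w 0).
Proof.
  pose proof (well_curvature_pos f F a E c um up HF W) as Hb.
  destruct (variation_start f F a E c um up u da dE dc HF W O e e1 He) as [Hw0 _].
  fold w in Hw0; fold b in Hw0, Hb.
  set (N := fun v => da * v + dE + dc / 2 * v ^ 2).
  replace (w 0) with (N um / - b) by (rewrite Hw0; unfold N; field; lra).
  apply (implicit_derive (potential F a c) vh (fun h => N (vh h))).
  - rewrite v0; eapply is_derive_eq; [now apply potential_derive | unfold b; ring].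
  - lra.
  - exact vc.
  - revert HW; apply filter_imp; intros h [(_ & _ & Eh & _) _].
    destruct W as (_ & _ & E0 & _); rewrite v0, E0.
    unfold potential in *; unfold N; lra.
  - intros eps Heps.
    assert (NC : continuous (fun h => N (vh h)) 0).
    { apply (continuous_comp vh N); [exact vc |].
      eapply continuous_of_derive; unfold N; der. }
    generalize (continuous_near _ _ _ NC Heps); apply filter_imp; intros h Hh.
    cbv beta in Hh; rewrite v0 in Hh; lra.
Qed.

(** One compact interval for all nearby orbits makes the Lipschitz and Taylor constants of [f]
    uniform in [h]. *)
Lemma orbit_bounds : locally 0 (fun h => forall x,
  um - 1 <= uh h x <= up + 1 /\ um - 1 <= u x <= up + 1).
Proof.
  generalize (filter_and _ _ HW (filter_and _ _
    (continuous_near _ _ _ vc Rlt_0_1) (continuous_near _ _ _ wc Rlt_0_1))).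
  apply filter_imp; intros h [[H1 H2] [H3 H4]] x.
  rewrite v0 in H3; rewrite w0 in H4; apply Rabs_def2 in H3; apply Rabs_def2 in H4.
  pose proof (profile_in_well f F _ _ _ _ _ _ HF H1 H2 x).
  pose proof (profile_in_well f F _ _ _ _ _ _ HF W O x).
  lra.
Qed.

(** The a priori estimate of order [h]: it turns the Taylor remainder of [f] along the orbit into a
    term of order [h^2]. *)
Lemma profile_lipschitz (X : R) : 0 <= X ->
  exists C, 0 <= C /\ locally 0 (fun h => forall x, 0 <= x <= X ->
    (uh h x - u x) ^ 2 <= C * h ^ 2).
Proof.
  intros HX.
  destruct (C2_lipschitz f (um - 1) (up + 1) f_C2) as [K [K0 HK]].
  (* [U] bounds the orbits, [B] the forcing caused by the changed parameters, [V] the displacement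
     of the starting point per unit of [h]; [L >= 1] lets [B |h|] be absorbed as [L (B |h|)]. *)
  set (U := Rabs (um - 1) + Rabs (up + 1)).
  set (B := Rabs da + Rabs dc * U).
  set (L := K + Rabs c + 1).
  set (V := Rabs (w 0) + 1).
  set (G := exp ((1 + 2 * L) * X)).
  assert (U0 : 0 <= U).
  { unfold U; pose proof (Rabs_pos (um - 1)); pose proof (Rabs_pos (up + 1)); lra. }
  assert (B0 : 0 <= B).
  { unfold B; pose proof (Rabs_pos da).
    pose proof (Rmult_le_pos _ _ (Rabs_pos dc) U0); lra. }
  assert (L1 : 1 <= L) by (unfold L; pose proof (Rabs_pos c); lra).
  assert (HG : 0 < G) by apply exp_pos.
  exists ((V ^ 2 + B ^ 2) * G); split.
  { pose proof (pow2_ge_0 V); pose proof (pow2_ge_0 B); apply Rmult_le_pos; lra. }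
  generalize (filter_and _ _ (filter_and _ _ HW orbit_bounds)
    (proj1 (derive_approx _ _ _) branch_root_derive 1 Rlt_0_1)).
  apply filter_imp; intros h [[[HW' HO'] HB] Hv] x Hx.
  rewrite v0, Rminus_0_r, Rmult_1_l in Hv.
  destruct (profile_start f F _ _ _ _ _ O) as [S0 S1].
  destruct (profile_start f F _ _ _ _ _ HO') as [S0' S1'].
  assert (G1 := second_order_gronwall (fun x => uh h x - u x)
    (fun x => Derive (uh h) x - Derive u x)
    (fun x => (a + h * da - f (uh h x) + (c + h * dc) * uh h x)
              - (a - f (u x) + c * u x)) X L (B * Rabs h)).
  assert (G2 := fun H1 H2 H3 H4 H5 => G1 H1 H2 H3 H4 H5 x Hx); clear G1.
  cbv beta in G2; rewrite S0, S1, S0', S1' in G2.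
  assert (Vb : (vh h - um) ^ 2 <= V ^ 2 * h ^ 2).
  { rewrite <- (pow2_abs (vh h - um)), <- (pow2_abs h), <- Rpow_mult_distr.
    apply pow_incr; split; [apply Rabs_pos |].
    replace (vh h - um) with ((vh h - um - w 0 * h) + w 0 * h) by ring.
    eapply Rle_trans; [apply Rabs_triang |]; rewrite (Rabs_mult (w 0)); unfold V; lra. }
  assert (R2 : (B * Rabs h) ^ 2 = B ^ 2 * h ^ 2)
    by (rewrite Rpow_mult_distr, pow2_abs; ring).
  assert (R : (uh h x - u x) ^ 2 + (Derive (uh h) x - Derive u x) ^ 2 <=
    ((vh h - um) ^ 2 + (0 - 0) ^ 2 + (B * Rabs h) ^ 2) * G).
  { apply G2.
    - lra.
    - apply Rmult_le_pos; [exact B0 | apply Rabs_pos].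
    - intros t _; apply is_derive_Rminus; eapply profile_derive; eassumption.
    - intros t _; apply is_derive_Rminus; eapply profile_derive2; eassumption.
    - intros t _; destruct (HB t) as [P1 P2].
      replace (a + h * da - f (uh h t) + (c + h * dc) * uh h t - (a - f (u t) + c * u t))
        with (- (f (uh h t) - f (u t)) + (c * (uh h t - u t) + h * (da + dc * uh h t)))
        by ring.
      eapply Rle_trans; [apply Rabs_triang |].
      eapply Rle_trans; [apply Rplus_le_compat_l, Rabs_triang |].
      rewrite Rabs_Ropp, !(Rabs_mult _ (_ + _)), (Rabs_mult c).
      pose proof (proj1 (HK _ _ P1 P2)).
      assert (Rabs (uh h t) <= U).
      { unfold U; apply Rabs_le.
        pose proof (Rle_abs (up + 1)); pose proof (Rabs_maj2 (um - 1)).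
        pose proof (Rabs_pos (up + 1)); pose proof (Rabs_pos (um - 1)); lra. }
      assert (Rabs (da + dc * uh h t) <= B).
      { eapply Rle_trans; [apply Rabs_triang |]; rewrite Rabs_mult; unfold B.
        apply Rplus_le_compat_l, Rmult_le_compat_l; [apply Rabs_pos | assumption]. }
      assert (Rabs h * Rabs (da + dc * uh h t) <= Rabs h * B)
        by (apply Rmult_le_compat_l; [apply Rabs_pos | assumption]).
      assert (0 <= B * Rabs h) by (apply Rmult_le_pos; [exact B0 | apply Rabs_pos]).
      assert (B * Rabs h <= L * (B * Rabs h)).
      { rewrite <- (Rmult_1_l (B * Rabs h)) at 1. apply Rmult_le_compat_r; lra. }
      pose proof (Rabs_pos (uh h t - u t)). unfold L in *. lra. }
  rewrite R2 in R.
  pose proof (pow2_ge_0 (Derive (uh h) x - Derive u x)).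
  eapply Rle_trans; [ | eapply Rle_trans; [exact R |]]; [lra |].
  replace ((V ^ 2 + B ^ 2) * G * h ^ 2) with ((V ^ 2 * h ^ 2 + B ^ 2 * h ^ 2) * G) by ring.
  apply Rmult_le_compat_r; lra.
Qed.

(** The remainder obeys the linearized equation up to a forcing of at most [D h^2], which is below
    [eta |h|] once [h] is small, and it starts within [eta |h|] of 0. *)
Lemma profile_expansion (X eps : R) : 0 <= X -> 0 < eps ->
  locally 0 (fun h => forall x, 0 <= x <= X ->
    Rabs (uh h x - u x - h * w x) <= eps * Rabs h /\
    Rabs (Derive (uh h) x - Derive u x - h * w1 x) <= eps * Rabs h).
Proof.
  intros HX Heps.
  destruct (C2_lipschitz f (um - 1) (up + 1) f_C2) as [K [K0 HK]].
  destruct (profile_lipschitz X HX) as [C [C0 HC]].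
  destruct (bounded_on_segment q 0 X) as [Q [Q0 HQ]].
  { intros x; unfold q, linear_coefficient.
    apply (continuous_minus (V := R_NormedModule)); [ | apply continuous_const].
    apply (continuous_comp u (Derive f)).
    - eapply continuous_of_derive, profile_derive, O.
    - eapply continuous_of_derive, C2_derive2, f_C2. }
  set (L := Q + 1). set (D := K * C + Rabs dc * (C + 1)).
  assert (D0 : 0 <= D).
  { unfold D; pose proof (Rmult_le_pos _ _ K0 C0).
    pose proof (Rmult_le_pos (Rabs dc) (C + 1) (Rabs_pos dc) ltac:(lra)); lra. }
  set (G := exp ((1 + 2 * L) * X)).
  assert (HG : 0 < G) by apply exp_pos.
  assert (G1 : 1 <= G).
  { unfold G; rewrite <- exp_0 at 1.
    destruct (Rle_lt_or_eq_dec 0 ((1 + 2 * L) * X)) as [H | <-]; [ | | lra].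
    - apply Rmult_le_pos; unfold L; lra.
    - left; now apply exp_increasing. }
  (* Gronwall returns [2 eta^2 G h^2] for the square of the remainder; this value of [eta] and
     [G >= 1] bring it below [eps^2 h^2]. *)
  set (eta := eps / (2 * G)).
  assert (Heta : 0 < eta) by (apply Rdiv_lt_0_compat; lra).
  assert (Hsm : locally 0 (fun h => D * Rabs h <= eta)).
  { apply locally_R; exists (eta / (D + 1)); split; [apply Rdiv_lt_0_compat; lra |].
    intros h Hh; rewrite Rminus_0_r in Hh.
    apply Rle_trans with ((D + 1) * (eta / (D + 1))); [ | right; field; lra].
    apply Rmult_le_compat; try lra; apply Rabs_pos. }
  generalize (filter_and _ _ (filter_and _ _ (filter_and _ _ HW orbit_bounds) HC)
    (filter_and _ _ Hsm (proj1 (derive_approx _ _ _) branch_root_derive eta Heta))).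
  apply filter_imp; intros h [[[[HW' HO'] HB] Hlip] [Hs Hv]] x Hx.
  rewrite v0, Rminus_0_r in Hv.
  destruct (profile_start f F _ _ _ _ _ O) as [S0 S1].
  destruct (profile_start f F _ _ _ _ _ HO') as [S0' S1'].
  destruct (variation_start f F a E c um up u da dE dc HF W O e e1 He) as [_ Hw0].
  fold w1 in Hw0.
  assert (A1 := second_order_gronwall (fun x => uh h x - u x - h * w x)
    (fun x => Derive (uh h) x - Derive u x - h * w1 x)
    (fun x => (a + h * da - f (uh h x) + (c + h * dc) * uh h x)
              - (a - f (u x) + c * u x) - h * (- q x * w x + da + dc * u x))
    X L (eta * Rabs h)).
  assert (A2 := fun H1 H2 H3 H4 H5 => A1 H1 H2 H3 H4 H5 x Hx); clear A1.
  cbv beta in A2; rewrite S0, S1, S0', S1', Hw0 in A2.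
  assert (Vb : (vh h - um - h * w 0) ^ 2 <= (eta * Rabs h) ^ 2).
  { rewrite <- (pow2_abs (vh h - um - h * w 0)); apply pow_incr; split; [apply Rabs_pos |].
    rewrite (Rmult_comm h); exact Hv. }
  assert (R : (uh h x - u x - h * w x) ^ 2 + (Derive (uh h) x - Derive u x - h * w1 x) ^ 2 <=
    ((vh h - um - h * w 0) ^ 2 + (0 - 0 - h * 0) ^ 2 + (eta * Rabs h) ^ 2) * G).
  { apply A2.
    - unfold L; lra.
    - apply Rmult_le_pos; [lra | apply Rabs_pos].
    - intros t _.
      pose proof (profile_derive f F _ _ _ _ _ O t).
      pose proof (profile_derive f F _ _ _ _ _ HO' t).
      pose proof (variation_derive f F a E c um u da dE dc O e e1 He t) as Dw.
      fold w in Dw; fold w1 in Dw.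
      eapply is_derive_eq; [der | cbv beta; ring].
    - intros t Ht.
      pose proof (profile_derive2 f F _ _ _ _ _ O t).
      pose proof (profile_derive2 f F _ _ _ _ _ HO' t).
      pose proof (variation_derive2 f F a E c um up u da dE dc f_C2 HF W O e e1 He t
        (proj1 Ht)) as Dw.
      fold w in Dw; fold w1 in Dw; fold q in Dw.
      eapply is_derive_eq; [der | cbv beta; ring].
    - intros t Ht; destruct (HB t) as [P1 P2]; specialize (Hlip t Ht).
      set (d := uh h t - u t) in *.
      replace (a + h * da - f (uh h t) + (c + h * dc) * uh h t - (a - f (u t) + c * u t)
               - h * (- q t * w t + da + dc * u t))
        with (- (f (uh h t) - f (u t) - Derive f (u t) * d)
              + (- (q t * (d - h * w t)) + h * (dc * d)))
        by (unfold q, linear_coefficient, d; ring).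
      eapply Rle_trans; [apply Rabs_triang |].
      eapply Rle_trans; [apply Rplus_le_compat_l, Rabs_triang |].
      rewrite !Rabs_Ropp, (Rabs_mult (q t)), (Rabs_mult h), (Rabs_mult dc).
      assert (I1 := proj2 (HK _ _ P1 P2)); fold d in I1.
      assert (I2 : K * d ^ 2 <= K * C * h ^ 2).
      { rewrite Rmult_assoc; apply Rmult_le_compat_l; lra. }
      assert (I3 : Rabs (q t) * Rabs (d - h * w t) <= Q * Rabs (d - h * w t))
        by (apply Rmult_le_compat_r; [apply Rabs_pos | now apply HQ]).
      assert (I4 : Rabs d <= (C + 1) * Rabs h).
      { apply Rsqr_incr_0_var; [ | apply Rmult_le_pos; [lra | apply Rabs_pos]].
        unfold Rsqr. replace (Rabs d * Rabs d) with (d ^ 2) by (rewrite <- (pow2_abs d); ring).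
        replace ((C + 1) * Rabs h * ((C + 1) * Rabs h)) with ((C + 1) ^ 2 * h ^ 2)
          by (rewrite <- (pow2_abs h); ring).
        eapply Rle_trans; [exact Hlip |].
        apply Rmult_le_compat_r; [apply pow2_ge_0 | nra]. }
      assert (I5 : Rabs h * (Rabs dc * Rabs d) <= Rabs dc * (C + 1) * h ^ 2).
      { rewrite <- (pow2_abs h).
        replace (Rabs dc * (C + 1) * Rabs h ^ 2)
          with (Rabs h * (Rabs dc * ((C + 1) * Rabs h))) by ring.
        apply Rmult_le_compat_l; [apply Rabs_pos |].
        apply Rmult_le_compat_l; [apply Rabs_pos | exact I4]. }
      assert (I6 : D * h ^ 2 <= eta * Rabs h).
      { rewrite <- (pow2_abs h).
        replace (D * Rabs h ^ 2) with (D * Rabs h * Rabs h) by ring.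
        apply Rmult_le_compat_r; [apply Rabs_pos | exact Hs]. }
      assert (I7 : 0 <= eta * Rabs h) by (apply Rmult_le_pos; [lra | apply Rabs_pos]).
      assert (I8 : 0 <= Q * (eta * Rabs h)) by (apply Rmult_le_pos; lra).
      pose proof (Rabs_pos (d - h * w t)).
      unfold D in I6; unfold L; lra. }
  assert (R' : (uh h x - u x - h * w x) ^ 2 + (Derive (uh h) x - Derive u x - h * w1 x) ^ 2
    <= (eps * Rabs h) ^ 2).
  { eapply Rle_trans; [exact R |].
    apply Rle_trans with (2 * (eta * Rabs h) ^ 2 * G).
    - apply Rmult_le_compat_r; [lra |]. replace (0 - 0 - h * 0) with 0 by ring. lra.
    - unfold eta; rewrite !Rpow_mult_distr, pow2_abs.
      replace (2 * ((eps / (2 * G)) ^ 2 * h ^ 2) * G) with (eps ^ 2 * h ^ 2 * / (2 * G))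
        by (field; lra).
      rewrite <- (Rmult_1_r (eps ^ 2 * h ^ 2)) at 2.
      apply Rmult_le_compat_l; [apply Rmult_le_pos; apply pow2_ge_0 |].
      rewrite <- Rinv_1; apply Rinv_le_contravar; lra. }
  assert (P : 0 <= eps * Rabs h) by (apply Rmult_le_pos; [lra | apply Rabs_pos]).
  set (r := uh h x - u x - h * w x) in *.
  set (r1 := Derive (uh h) x - Derive u x - h * w1 x) in *.
  pose proof (pow2_ge_0 r); pose proof (pow2_ge_0 r1).
  split; apply Rsqr_incr_0_var; try exact P; unfold Rsqr.
  - replace (Rabs r * Rabs r) with (r ^ 2) by (rewrite <- (pow2_abs r); ring). lra.
  - replace (Rabs r1 * Rabs r1) with (r1 ^ 2) by (rewrite <- (pow2_abs r1); ring). lra.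
Qed.

Context (HT : locally 0 (fun h =>
  is_half_period (uh h) (wh h) (Th h / 2) /\ Derive (uh h) (Th h) = 0)).
Context (T0 : is_half_period u up (Th 0 / 2) /\ u (Th 0) = um /\ Derive u (Th 0) = 0).

Lemma profile_uniform (X eps : R) : 0 <= X -> 0 < eps ->
  locally 0 (fun h => forall x, 0 <= x <= X ->
    Rabs (uh h x - u x) < eps /\ Rabs (Derive (uh h) x - Derive u x) < eps).
Proof.
  intros HX Heps.
  assert (Dw : forall x, is_derive w x (w1 x)) by
    exact (variation_derive f F a E c um u da dE dc O e e1 He).
  destruct (bounded_on_segment w 0 X) as [B [B0 HB]].
  { intros x; eapply continuous_of_derive, Dw. }
  destruct He as (De & De1 & _).
  pose proof (profile_derive f F _ _ _ _ _ O) as Du.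
  pose proof (profile_derive3 f F a E c um u f_C2 O) as Du2.
  pose proof (fun x => integral_derive _ x
     (variation_integrand_continuous f F a E c um u da dc O e e1 He)) as DI.
  destruct (bounded_on_segment w1 0 X) as [B1 [B10 HB1]].
  { intros x; unfold w1, variation1.
    apply (continuous_minus (V := R_NormedModule)).
    - eapply continuous_of_derive; der.
    - apply (continuous_mult (K := R_AbsRing)).
      + eapply continuous_of_derive, Du2.
      + eapply continuous_of_derive, DI. }
  assert (Hs : locally 0 (fun h => Rabs h < eps / (B + B1 + 1))).
  { apply locally_R; exists (eps / (B + B1 + 1)); split; [apply Rdiv_lt_0_compat; lra |].
    intros h; now rewrite Rminus_0_r. }
  generalize (filter_and _ _ Hs (profile_expansion X 1 HX Rlt_0_1)).
  apply filter_imp; intros h [H1 H2] x Hx.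
  destruct (H2 x Hx) as [H3 H4]; specialize (HB x Hx); specialize (HB1 x Hx).
  assert (Hk : (B + B1 + 1) * Rabs h < eps).
  { apply Rmult_lt_compat_l with (r := B + B1 + 1) in H1; [ | lra].
    replace ((B + B1 + 1) * (eps / (B + B1 + 1))) with eps in H1 by (field; lra). lra. }
  pose proof (Rabs_pos h).
  assert (Rabs (h * w x) <= Rabs h * B)
    by (rewrite Rabs_mult; apply Rmult_le_compat_l; lra).
  assert (Rabs (h * w1 x) <= Rabs h * B1)
    by (rewrite Rabs_mult; apply Rmult_le_compat_l; lra).
  assert (0 <= Rabs h * B) by (apply Rmult_le_pos; lra).
  assert (0 <= Rabs h * B1) by (apply Rmult_le_pos; lra).
  split.
  - replace (uh h x - u x) with ((uh h x - u x - h * w x) + h * w x) by ring.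
    eapply Rle_lt_trans; [apply Rabs_triang | lra].
  - replace (Derive (uh h) x - Derive u x)
      with ((Derive (uh h) x - Derive u x - h * w1 x) + h * w1 x) by ring.
    eapply Rle_lt_trans; [apply Rabs_triang | lra].
Qed.

(** The turning time must be localized before it can be differentiated, since [u_x] has several
    zeros. It is not much later than [tau], because nearby orbits have negative velocity at
    [tau + d'], and not much earlier, because [u] stays away from [up] before [tau - d']. *)
Lemma period_continuous : continuous Th 0.
Proof.
  destruct T0 as ((Ht & Hpos & Hup & Hneg) & _).
  intros P HP; apply locally_R in HP; destruct HP as (d & Hd & HP).
  change (locally 0 (fun h => P (Th h))).
  apply (filter_imp (fun h => Rabs (Th h - Th 0) < d)); [intros h Hh; now apply HP |].
  set (tau := Th 0 / 2) in *.
  set (d' := Rmin (d / 3) (tau / 2)).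
  assert (D1 : 0 < d') by (apply Rmin_case; lra).
  assert (D2 : d' <= d / 3) by apply Rmin_l. assert (D3 : d' <= tau / 2) by apply Rmin_r.
  assert (Hn : Derive u (tau + d') < 0) by (apply Hneg; lra).
  assert (Hl : u (tau - d') < up).
  { rewrite <- Hup; apply (strictly_increasing u (Derive u) 0 tau); try lra.
    - intros t _; eapply profile_derive, O.
    - exact Hpos. }
  set (eta := (up - u (tau - d')) / 2).
  assert (Heta : 0 < eta) by (unfold eta; lra).
  assert (L1 := profile_uniform (2 * tau) eta ltac:(lra) Heta).
  assert (L2 := continuous_near _ _ eta wc Heta).
  assert (L3 := profile_uniform (2 * tau) (- Derive u (tau + d')) ltac:(lra) ltac:(lra)).
  generalize (filter_and _ _ (filter_and _ _ L1 L2) (filter_and _ _ HT L3)).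
  apply filter_imp; intros h [[H1 H2] [[(H3 & H4 & H5 & _) _] H6]].
  rewrite w0 in H2; apply Rabs_def2 in H2.
  assert (Th h / 2 <= tau + d').
  { apply Rnot_lt_le; intros Hlt.
    assert (0 < Derive (uh h) (tau + d')) by (apply H4; lra).
    destruct (H6 (tau + d')) as [_ H7]; [lra |]. apply Rabs_def2 in H7; lra. }
  assert (tau - d' <= Th h / 2).
  { apply Rnot_lt_le; intros Hlt.
    destruct (H1 (Th h / 2)) as [H7 _]; [lra |].
    rewrite H5 in H7; apply Rabs_def2 in H7.
    assert (u (Th h / 2) < u (tau - d')).
    { apply (strictly_increasing u (Derive u) 0 tau); try lra.
      - intros t _; eapply profile_derive, O.
      - exact Hpos. }
    unfold eta in *; lra. }
  assert (Th 0 = 2 * tau) by (unfold tau; field).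
  apply Rabs_def1; lra.
Qed.

(** Differentiating [u_x (T) = 0] gives [b T' + w1 (T) = 0]; the rest is differentiation of
    integrals with a moving end, where [u (T) = um]. *)
Lemma family_derivatives :
  is_derive Th 0 (- w1 (Th 0) / b) /\
  is_derive (fun h => RInt (uh h) 0 (Th h)) 0
    (um * (- w1 (Th 0) / b) + RInt w 0 (Th 0)) /\
  is_derive (fun h => RInt (fun x => uh h x ^ 2) 0 (Th h)) 0
    (um ^ 2 * (- w1 (Th 0) / b) + RInt (fun x => 2 * u x * w x) 0 (Th 0)).
Proof.
  pose proof (well_curvature_pos f F a E c um up HF W) as Hb; fold b in Hb.
  destruct T0 as ((Ht & _) & Tu & Tu1).
  assert (HTc := period_continuous).
  assert (Dw : forall x, is_derive w x (w1 x)) by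
    exact (variation_derive f F a E c um u da dE dc O e e1 He).
  pose proof (profile_derive f F _ _ _ _ _ O) as Du.
  pose proof (profile_derive2 f F _ _ _ _ _ O) as Du1.
  assert (Cu : forall x, continuous u x) by (intros; eapply continuous_of_derive, Du).
  assert (Cw : forall x, continuous w x) by (intros; eapply continuous_of_derive, Dw).
  assert (Cw1 : continuous w1 (Th 0)).
  { eapply continuous_of_derive,
      (variation_derive2 f F a E c um up u da dE dc f_C2 HF W O e e1 He); lra. }
  set (X := 2 * Th 0).
  assert (HTX : locally 0 (fun h => 0 < Th h < X)).
  { generalize (continuous_near _ _ (Th 0) HTc ltac:(lra)); apply filter_imp.
    intros h Hh; apply Rabs_def2 in Hh; unfold X; lra. }
  assert (DT : is_derive Th 0 (- w1 (Th 0) / b)).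
  (* The quotient [u_x (Th h) / h] is given its limit as value at [h = 0], where the required
     factorization holds trivially. *)
  { apply (implicit_derive (Derive u) Th
      (fun h => if Req_EM_T h 0 then - w1 (Th 0) else Derive u (Th h) / h)).
    - eapply is_derive_eq; [apply Du1 | rewrite Tu; reflexivity].
    - lra.
    - exact HTc.
    - apply filter_forall; intros h; rewrite Tu1.
      destruct (Req_EM_T h 0) as [-> | Hn]; [rewrite Tu1; ring | field; exact Hn].
    - intros eps Heps.
      assert (Hw1 : locally 0 (fun h => Rabs (w1 (Th h) - w1 (Th 0)) < eps / 2)).
      { exact (HTc _ (continuous_near _ _ (eps / 2) Cw1 ltac:(lra))). }
      assert (L := profile_expansion X (eps / 2) ltac:(unfold X; lra) ltac:(lra)).
      generalize (filter_and _ _ (filter_and _ _ HTX Hw1) (filter_and _ _ HT L)).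
      apply filter_imp; intros h [[H1 H2] [[_ H3] H4]].
      destruct (Req_EM_T h 0) as [-> | Hn].
      + rewrite Rminus_diag, Rabs_R0; lra.
      + destruct (H4 (Th h)) as [_ H5]; [lra |]; rewrite H3 in H5.
        assert (Hh : 0 < Rabs h) by (apply Rabs_pos_lt, Hn).
        replace (Derive u (Th h) / h - - w1 (Th 0))
          with (- ((0 - Derive u (Th h) - h * w1 (Th h)) / h) - (w1 (Th h) - w1 (Th 0)))
          by (field; exact Hn).
        eapply Rle_trans; [apply Rabs_triang |].
        rewrite !Rabs_Ropp, Rabs_div by exact Hn.
        assert (Rabs (0 - Derive u (Th h) - h * w1 (Th h)) / Rabs h <= eps / 2)
          by (apply Rle_div_l; [exact Hh | exact H5]).
        lra. }
  assert (Cuh : locally 0 (fun h => forall x, continuous (uh h) x)).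
  { revert HW; apply filter_imp; intros h [_ Oh] x.
    eapply continuous_of_derive, profile_derive, Oh. }
  split; [exact DT | split].
  - rewrite <- Tu; apply (derive_integral_family uh u w Th X); auto.
    + unfold X; lra.
    + intros eps Heps.
      generalize (profile_expansion X eps ltac:(unfold X; lra) Heps); apply filter_imp.
      intros h Hh x Hx; now apply Hh.
  - rewrite <- Tu.
    apply (derive_integral_family (fun h x => uh h x ^ 2) (fun x => u x ^ 2)
      (fun x => 2 * u x * w x) Th X).
    + intros x; eapply continuous_of_derive; der.
    + intros x; eapply continuous_of_derive; der.
    + revert HW; apply filter_imp; intros h [_ Oh] x.
      pose proof (profile_derive f F _ _ _ _ _ Oh x).
      eapply continuous_of_derive; der.
    + unfold X; lra.
    + exact DT.
    + destruct (bounded_on_segment u 0 X Cu) as [B [B0 HB]].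
      destruct (bounded_on_segment w 0 X Cw) as [B' [B'0 HB']].
      intros eps Heps.
      (* [2 B + 1] bounds [u + uh] once [|uh - u| < 1], and [B'] bounds [w]; the two error terms
         then add up to [eps |h|]. *)
      set (k := 2 * B + 1 + B').
      assert (Hk : 0 < eps / k) by (apply Rdiv_lt_0_compat; unfold k; lra).
      assert (Hk1 : 0 < Rmin 1 (eps / k)) by (apply Rmin_case; lra).
      assert (L1 := profile_expansion X (eps / k) ltac:(unfold X; lra) Hk).
      assert (L2 := profile_uniform X (Rmin 1 (eps / k)) ltac:(unfold X; lra) Hk1).
      generalize (filter_and _ _ L1 L2).
      apply filter_imp; intros h [H1 H2] x Hx.
      destruct (H1 x Hx) as [H3 _]; destruct (H2 x Hx) as [H4 _].
      specialize (HB x Hx); specialize (HB' x Hx).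
      replace (uh h x ^ 2 - u x ^ 2 - h * (2 * u x * w x))
        with ((uh h x - u x - h * w x) * (2 * u x + (uh h x - u x))
              + h * (w x * (uh h x - u x))) by ring.
      eapply Rle_trans; [apply Rabs_triang |].
      rewrite (Rabs_mult h), (Rabs_mult (w x)), (Rabs_mult (_ - _ - _)).
      pose proof (Rmin_l 1 (eps / k)); pose proof (Rmin_r 1 (eps / k)).
      assert (I1 : Rabs (2 * u x + (uh h x - u x)) <= 2 * B + 1).
      { eapply Rle_trans; [apply Rabs_triang |].
        rewrite Rabs_mult, (Rabs_right 2); lra. }
      assert (I2 : Rabs (uh h x - u x - h * w x) * Rabs (2 * u x + (uh h x - u x)) <=
        eps / k * Rabs h * (2 * B + 1)).
      { apply Rmult_le_compat; try apply Rabs_pos; assumption. }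
      assert (I3 : Rabs h * (Rabs (w x) * Rabs (uh h x - u x)) <= Rabs h * (B' * (eps / k))).
      { apply Rmult_le_compat_l; [apply Rabs_pos |].
        apply Rmult_le_compat; try apply Rabs_pos; lra. }
      replace (eps * Rabs h) with (eps / k * Rabs h * (2 * B + 1) + Rabs h * (B' * (eps / k))).
      * lra.
      * unfold k; field; lra.
Qed.

End Family.

(** * The linearized equation *)

(** Componentwise, so that mean values and Gronwall estimates for real functions carry over to the
    complex system. *)
Definition is_Cderive (y : R -> C) (x : R) (l : C) : Prop :=
  is_derive (fun t => fst (y t)) x (fst l) /\ is_derive (fun t => snd (y t)) x (snd l).

Definition Ccontinuous (y : R -> C) : Prop :=
  forall x, continuous (fun t => fst (y t)) x /\ continuous (fun t => snd (y t)) x.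

Definition Cint (g : R -> C) (x : R) : C :=
  (RInt (fun t => fst (g t)) 0 x, RInt (fun t => snd (g t)) 0 x).

Lemma is_derive_C (y : R -> C) (x : R) (l : C) :
  is_derive (K := R_AbsRing) (V := C_R_NormedModule) y x l -> is_Cderive y x l.
Proof.
  intros H; split.
  - apply (filterdiff_comp' y (fun z : C => fst z) x _ (fun z => fst z) H).
    apply filterdiff_linear, (is_linear_fst (U := R_NormedModule) (V := R_NormedModule)).
  - apply (filterdiff_comp' y (fun z : C => snd z) x _ (fun z => snd z) H).
    apply filterdiff_linear, (is_linear_snd (U := R_NormedModule) (V := R_NormedModule)).
Qed.

Lemma is_Cderive_eq (y : R -> C) (x : R) (l l' : C) :
  is_Cderive y x l -> l = l' -> is_Cderive y x l'.
Proof. now intros H <-. Qed.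

Lemma is_Cderive_plus (y z : R -> C) (x : R) (l m : C) :
  is_Cderive y x l -> is_Cderive z x m -> is_Cderive (fun t => y t + z t)%C x (l + m)%C.
Proof. intros [H1 H2] [H3 H4]; split; simpl; der. Qed.

Lemma is_Cderive_minus (y z : R -> C) (x : R) (l m : C) :
  is_Cderive y x l -> is_Cderive z x m -> is_Cderive (fun t => y t - z t)%C x (l - m)%C.
Proof. intros [H1 H2] [H3 H4]; split; simpl; der. Qed.

Lemma is_Cderive_opp (y : R -> C) (x : R) (l : C) :
  is_Cderive y x l -> is_Cderive (fun t => - y t)%C x (- l)%C.
Proof. intros [H1 H2]; split; simpl; der. Qed.

Lemma is_Cderive_mult (y z : R -> C) (x : R) (l m : C) :
  is_Cderive y x l -> is_Cderive z x m ->
  is_Cderive (fun t => y t * z t)%C x (l * z x + y x * m)%C.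
Proof.
  intros [H1 H2] [H3 H4]; split; simpl; (eapply is_derive_eq; [der | cbv beta; ring]).
Qed.

Lemma is_Cderive_const (k : C) (x : R) : is_Cderive (fun _ => k) x (RtoC 0).
Proof. split; apply is_derive_Rconst. Qed.

Ltac Cder :=
  lazymatch goal with
  | |- is_Cderive (fun t => (@?f t + @?g t)%C) _ _ =>
      apply (is_Cderive_plus f g); [Cder | Cder]
  | |- is_Cderive (fun t => (@?f t - @?g t)%C) _ _ =>
      apply (is_Cderive_minus f g); [Cder | Cder]
  | |- is_Cderive (fun t => (- @?f t)%C) _ _ => apply (is_Cderive_opp f); Cder
  | |- is_Cderive (fun t => (@?f t * @?g t)%C) _ _ =>
      apply (is_Cderive_mult f g); [Cder | Cder]
  | |- is_Cderive (fun t => ?g t) ?x ?l => change (is_Cderive g x l); Cder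
  | H : is_Cderive ?g ?x _ |- is_Cderive ?g ?x _ => exact H
  end.

Lemma is_Cderive_RtoC (y : R -> R) (x l : R) :
  is_derive y x l -> is_Cderive (fun t => RtoC (y t)) x (RtoC l).
Proof. intros H; split; unfold RtoC; simpl; [exact H | apply is_derive_Rconst]. Qed.

Lemma is_Cderive_Cint (g : R -> C) (x : R) : Ccontinuous g -> is_Cderive (Cint g) x (g x).
Proof.
  intros H; split.
  - exact (integral_derive (fun t => fst (g t)) x (fun t => proj1 (H t))).
  - exact (integral_derive (fun t => snd (g t)) x (fun t => proj2 (H t))).
Qed.

Lemma Ccontinuous_derive (y y' : R -> C) :
  (forall x, is_Cderive y x (y' x)) -> Ccontinuous y.
Proof.
  intros H x; destruct (H x) as [H1 H2].
  split; eapply continuous_of_derive; eassumption.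
Qed.

Lemma Ccontinuous_bounded (y : R -> C) (X : R) : Ccontinuous y ->
  exists K, 0 <= K /\ forall x, 0 <= x <= X -> Cmod (y x) <= K.
Proof.
  intros H.
  destruct (bounded_on_segment (fun t => fst (y t)) 0 X) as [A [A0 HA]]; [apply H |].
  destruct (bounded_on_segment (fun t => snd (y t)) 0 X) as [B [B0 HB]]; [apply H |].
  exists (sqrt 2 * (A + B)); split; [apply Rmult_le_pos; [apply sqrt_pos | lra] |].
  intros x Hx; eapply Rle_trans; [apply Cmod_2Rmax |].
  apply Rmult_le_compat_l; [apply sqrt_pos |].
  specialize (HA x Hx); specialize (HB x Hx); apply Rmax_case; lra.
Qed.

Lemma Cmod_sqr (z : C) : Cmod z ^ 2 = fst z ^ 2 + snd z ^ 2.
Proof.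
  unfold Cmod; rewrite pow2_sqrt; [reflexivity |].
  pose proof (pow2_ge_0 (fst z)); pose proof (pow2_ge_0 (snd z)); lra.
Qed.

Lemma Cmod_cauchy_schwarz (z w : C) : fst z * fst w + snd z * snd w <= Cmod z * Cmod w.
Proof.
  apply Rsqr_incr_0_var; [ | apply Rmult_le_pos; apply Cmod_ge_0].
  unfold Rsqr.
  replace (Cmod z * Cmod w * (Cmod z * Cmod w)) with (Cmod z ^ 2 * Cmod w ^ 2) by ring.
  rewrite !Cmod_sqr; pose proof (pow2_ge_0 (fst z * snd w - snd z * fst w)); lra.
Qed.

(* [y''' = - (mu + dq) y - q y' - g], which is [d/dx (L y) = mu y + g] when [dq = q']. *)
Definition is_forced (q dq : R -> R) (mu : C) (g y0 y1 y2 : R -> C) : Prop :=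
  forall x, 0 <= x ->
    is_Cderive y0 x (y1 x) /\ is_Cderive y1 x (y2 x) /\
    is_Cderive y2 x (- (mu + RtoC (dq x)) * y0 x - RtoC (q x) * y1 x - g x)%C.

(** Abstract in the operations, so that one formula serves the complex fundamental matrix and the
    real matrices of the trace computation. *)
Definition det3 {A : Type} (mul sub add : A -> A -> A) (M : nat -> nat -> A) : A :=
  add (sub (mul (M 0 0)%nat (sub (mul (M 1 1)%nat (M 2 2)%nat) (mul (M 1 2)%nat (M 2 1)%nat)))
           (mul (M 0 1)%nat (sub (mul (M 1 0)%nat (M 2 2)%nat) (mul (M 1 2)%nat (M 2 0)%nat))))
      (mul (M 0 2)%nat (sub (mul (M 1 0)%nat (M 2 1)%nat) (mul (M 1 1)%nat (M 2 0)%nat))).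

(* Last column of the inverse of [P], since [det P = 1]. *)
Definition cofactor2 (P : nat -> nat -> R -> C) (i : nat) (x : R) : C := (
  match i with
  | 0%nat => P 0%nat 1%nat x * P 1%nat 2%nat x - P 0%nat 2%nat x * P 1%nat 1%nat x
  | 1%nat => P 0%nat 2%nat x * P 1%nat 0%nat x - P 0%nat 0%nat x * P 1%nat 2%nat x
  | _ => P 0%nat 0%nat x * P 1%nat 1%nat x - P 0%nat 1%nat x * P 1%nat 0%nat x
  end)%C.

(** Component [k] of [- Phi(x)] times the integral of [Phi^-1 (0, 0, g)]: the solution with forcing
    [g] and zero initial data. With [P] given, this makes the derivatives in [mu] explicit. *)
Definition duhamel (P : nat -> nat -> R -> C) (g : R -> C) (k : nat) (x : R) : C := (
  - (P k 0%nat x * Cint (fun t => cofactor2 P 0 t * g t) x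
     + P k 1%nat x * Cint (fun t => cofactor2 P 1 t * g t) x
     + P k 2%nat x * Cint (fun t => cofactor2 P 2 t * g t) x))%C.

Section Linear.

Context (q dq : R -> R).
Context (qc : forall x, continuous q x) (dqc : forall x, continuous dq x).

Lemma forced_minus (mu : C) (g y0 y1 y2 g' z0 z1 z2 : R -> C) :
  is_forced q dq mu g y0 y1 y2 -> is_forced q dq mu g' z0 z1 z2 ->
  is_forced q dq mu (fun x => g x - g' x)%C (fun x => y0 x - z0 x)%C
    (fun x => y1 x - z1 x)%C (fun x => y2 x - z2 x)%C.
Proof.
  intros Hy Hz x Hx; destruct (Hy x Hx) as (A0 & A1 & A2).
  destruct (Hz x Hx) as (B0 & B1 & B2); split; [ | split].
  1-2: now apply is_Cderive_minus.
  eapply is_Cderive_eq; [apply is_Cderive_minus; eassumption | ring].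
Qed.

Lemma forced_scale (mu k : C) (g y0 y1 y2 : R -> C) :
  is_forced q dq mu g y0 y1 y2 ->
  is_forced q dq mu (fun x => k * g x)%C (fun x => k * y0 x)%C
    (fun x => k * y1 x)%C (fun x => k * y2 x)%C.
Proof.
  intros Hy x Hx; destruct (Hy x Hx) as (A0 & A1 & A2); split; [ | split];
    (eapply is_Cderive_eq;
      [apply is_Cderive_mult; [apply is_Cderive_const | eassumption] | cbv beta; ring]).
Qed.

(** A change of the spectral parameter is traded for forcing, so that solutions at different [mu]
    can be subtracted. *)
Lemma forced_shift (mu mu' : C) (g g' y0 y1 y2 : R -> C) :
  (forall x, 0 <= x -> g' x = g x + (mu - mu') * y0 x)%C ->
  is_forced q dq mu g y0 y1 y2 -> is_forced q dq mu' g' y0 y1 y2.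
Proof.
  intros Hg Hy x Hx; destruct (Hy x Hx) as (A0 & A1 & A2).
  split; [exact A0 | split; [exact A1 |]].
  eapply is_Cderive_eq; [exact A2 | rewrite Hg by exact Hx; ring].
Qed.

(** Gronwall for the sum of the squared moduli, with a constant uniform for [mu'] in a unit disc. In
    its rate [3 + 2 B], the 3 accounts for products of consecutive components and for [rho], and
    [2 B] for the coefficients of the equation. *)
Lemma forced_bound (mu : C) (X : R) : 0 <= X ->
  exists K, 0 <= K /\ forall (mu' : C) (g y0 y1 y2 : R -> C) (rho : R),
    Cmod (mu' - mu) <= 1 -> 0 <= rho -> is_forced q dq mu' g y0 y1 y2 ->
    y0 0 = RtoC 0 -> y1 0 = RtoC 0 -> y2 0 = RtoC 0 ->
    (forall x, 0 <= x <= X -> Cmod (g x) <= rho) ->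
    forall x, 0 <= x <= X ->
      Cmod (y0 x) <= K * rho /\ Cmod (y1 x) <= K * rho /\ Cmod (y2 x) <= K * rho.
Proof.
  intros HX.
  destruct (bounded_on_segment q 0 X qc) as [Q [Q0 HQ]].
  destruct (bounded_on_segment dq 0 X dqc) as [Q' [Q'0 HQ']].
  set (B := Cmod mu + 1 + Q + Q').
  assert (HB : 0 <= B) by (unfold B; pose proof (Cmod_ge_0 mu); lra).
  set (G := exp ((3 + 2 * B) * X)).
  assert (G1 : 1 <= G).
  { unfold G; rewrite <- exp_0 at 1.
    destruct (Rle_lt_or_eq_dec 0 ((3 + 2 * B) * X)) as [H | <-]; [ | | lra].
    - apply Rmult_le_pos; lra.
    - left; now apply exp_increasing. }
  exists G; split; [lra |].
  intros mu' g y0 y1 y2 rho Hmu Hrho Hy Z0 Z1 Z2 Hg x Hx.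
  assert (Hmu' : Cmod mu' <= Cmod mu + 1).
  { replace mu' with ((mu' - mu) + mu)%C by ring.
    eapply Rle_trans; [apply Cmod_triangle | lra]. }
  set (y3 := fun x => (- (mu' + RtoC (dq x)) * y0 x - RtoC (q x) * y1 x - g x)%C).
  set (N := fun x => fst (y0 x) ^ 2 + snd (y0 x) ^ 2 + (fst (y1 x) ^ 2 + snd (y1 x) ^ 2)
                     + (fst (y2 x) ^ 2 + snd (y2 x) ^ 2)).
  set (N' := fun x => 2 * (fst (y0 x) * fst (y1 x) + snd (y0 x) * snd (y1 x))
    + 2 * (fst (y1 x) * fst (y2 x) + snd (y1 x) * snd (y2 x))
    + 2 * (fst (y2 x) * fst (y3 x) + snd (y2 x) * snd (y3 x))).
  assert (A : N x + rho ^ 2 <= (N 0 + rho ^ 2) * exp ((3 + 2 * B) * x)).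
  { apply (gronwall N N' X); [ | | exact Hx].
    - intros t [Ht _]; destruct (Hy t Ht) as ([A1 A2] & [A3 A4] & [A5 A6]).
      unfold N; eapply is_derive_eq; [der | unfold N', y3; cbv beta; ring].
    - intros t Ht.
      assert (C3 : Cmod (y3 t) <= B * (Cmod (y0 t) + Cmod (y1 t)) + rho).
      { unfold y3, Cminus; eapply Rle_trans; [apply Cmod_triangle |].
        rewrite Cmod_opp; apply Rplus_le_compat; [ | apply Hg, Ht].
        eapply Rle_trans; [apply Cmod_triangle |].
        rewrite Cmod_opp, !Cmod_mult, Cmod_opp, Cmod_R.
        assert (Cmod (mu' + RtoC (dq t)) <= B).
        { eapply Rle_trans; [apply Cmod_triangle |]; rewrite Cmod_R.
          specialize (HQ' t Ht); unfold B; lra. }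
        assert (Rabs (q t) <= B).
        { specialize (HQ t Ht); unfold B; pose proof (Cmod_ge_0 mu); lra. }
        rewrite Rmult_plus_distr_l; apply Rplus_le_compat;
          (apply Rmult_le_compat_r; [apply Cmod_ge_0 | assumption]). }
      unfold N, N'; rewrite <- !Cmod_sqr.
      pose proof (Cmod_cauchy_schwarz (y0 t) (y1 t)).
      pose proof (Cmod_cauchy_schwarz (y1 t) (y2 t)).
      pose proof (Cmod_cauchy_schwarz (y2 t) (y3 t)).
      assert (Cmod (y2 t) * Cmod (y3 t) <=
        Cmod (y2 t) * (B * (Cmod (y0 t) + Cmod (y1 t)) + rho))
        by (apply Rmult_le_compat_l; [apply Cmod_ge_0 | exact C3]).
      set (a0 := Cmod (y0 t)) in *; set (a1 := Cmod (y1 t)) in *; set (a2 := Cmod (y2 t)) in *.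
      pose proof (pow2_ge_0 (a0 - a1)); pose proof (pow2_ge_0 (a1 - a2)).
      pose proof (pow2_ge_0 (a2 - a0)); pose proof (pow2_ge_0 (a2 - rho)).
      pose proof (pow2_ge_0 a0); pose proof (pow2_ge_0 a1); pose proof (pow2_ge_0 a2).
      pose proof (pow2_ge_0 rho).
      assert (HH : B * (2 * (a2 * (a0 + a1))) <= B * (2 * (a0 ^ 2 + a1 ^ 2 + a2 ^ 2 + rho ^ 2)))
        by (apply Rmult_le_compat_l; lra).
      lra. }
  assert (N0 : N 0 = 0) by (unfold N; rewrite Z0, Z1, Z2; simpl; ring).
  assert (HG : exp ((3 + 2 * B) * x) <= G) by (apply exp_growth; lra).
  assert (R : N x <= (G * rho) ^ 2).
  { rewrite N0 in A; pose proof (pow2_ge_0 rho).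
    apply Rle_trans with (rho ^ 2 * G).
    - assert (rho ^ 2 * exp ((3 + 2 * B) * x) <= rho ^ 2 * G)
        by (apply Rmult_le_compat_l; lra). lra.
    - rewrite Rpow_mult_distr, (Rmult_comm (G ^ 2)).
      apply Rmult_le_compat_l; [lra | nra]. }
  unfold N in R; rewrite <- !Cmod_sqr in R.
  assert (P : 0 <= G * rho) by (apply Rmult_le_pos; lra).
  pose proof (pow2_ge_0 (Cmod (y0 x))); pose proof (pow2_ge_0 (Cmod (y1 x))).
  pose proof (pow2_ge_0 (Cmod (y2 x))).
  repeat split; apply Rsqr_incr_0_var; try exact P; unfold Rsqr; lra.
Qed.

Lemma forced_unique (mu : C) (y0 y1 y2 : R -> C) :
  is_forced q dq mu (fun _ => RtoC 0) y0 y1 y2 ->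
  y0 0 = RtoC 0 -> y1 0 = RtoC 0 -> y2 0 = RtoC 0 ->
  forall x, 0 <= x -> y0 x = RtoC 0 /\ y1 x = RtoC 0 /\ y2 x = RtoC 0.
Proof.
  intros Hy Z0 Z1 Z2 x Hx; destruct (forced_bound mu x Hx) as [K [_ HK]].
  destruct (HK mu (fun _ => RtoC 0) y0 y1 y2 0) with (x := x) as (B0 & B1 & B2); auto; try lra.
  - replace (mu - mu)%C with (RtoC 0) by ring; rewrite Cmod_0; lra.
  - intros; rewrite Cmod_0; lra.
  - rewrite Rmult_0_r in *.
    repeat split; apply Cmod_eq_0; apply Rle_antisym; auto; apply Cmod_ge_0.
Qed.

(** A quadratic remainder, uniform in [x], instead of mere differentiability at one point: this form
    survives integration of the equation and so can be iterated. *)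
Definition is_expansion (X : R) (G G' : C -> R -> C) : Prop :=
  forall mu, exists K, 0 <= K /\ forall h, Cmod h <= 1 -> forall x, 0 <= x <= X ->
    Cmod (G (mu + h)%C x - G mu x) <= K * Cmod h /\
    Cmod (G (mu + h)%C x - G mu x - h * G' mu x) <= K * Cmod h ^ 2.

Lemma expansion_derive (X T : R) (G G' : C -> R -> C) (mu : C) :
  0 <= T <= X -> is_expansion X G G' ->
  is_derive (K := C_AbsRing) (V := C_NormedModule) (fun m => G m T) mu (G' mu T).
Proof.
  intros HT HG; destruct (HG mu) as [K [K0 HK]]; split.
  - apply (is_linear_scal_l (K := C_AbsRing) (V := C_NormedModule)).
  - intros z Hz.
    apply (is_filter_lim_locally_unique (V := AbsRing_NormedModule C_AbsRing)) in Hz; subst z.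
    intros eps; set (d := Rmin 1 (eps / (K + 1))).
    assert (Hd : 0 < d).
    { apply Rmin_case; [lra |]; apply Rdiv_lt_0_compat; [apply cond_pos | lra]. }
    exists (mkposreal d Hd).
    refine (fun (m : C) (Hm : Cmod (m - mu) < d) => _).
    change (Cmod (G m T - G mu T - (m - mu) * G' mu T) <= eps * Cmod (m - mu)).
    assert (H1 : Cmod (m - mu) <= 1)
      by (pose proof (Rmin_l 1 (eps / (K + 1))); unfold d in Hm; lra).
    destruct (HK (m - mu)%C H1 T HT) as [_ H2].
    replace (mu + (m - mu))%C with m in H2 by ring.
    eapply Rle_trans; [exact H2 |].
    replace (K * Cmod (m - mu) ^ 2) with (K * Cmod (m - mu) * Cmod (m - mu)) by ring.
    apply Rmult_le_compat_r; [apply Cmod_ge_0 |].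
    assert (Cmod (m - mu) <= eps / (K + 1))
      by (pose proof (Rmin_r 1 (eps / (K + 1))); unfold d in Hm; lra).
    apply Rle_trans with ((K + 1) * (eps / (K + 1))); [ | right; field; lra].
    apply Rmult_le_compat; try lra; apply Cmod_ge_0.
Qed.

(** Formally [Z] is the derivative of [Y] in [mu]: differentiating the equation adds [Y] to the
    differentiated forcing. Two applications of [forced_bound] make this rigorous: the increment of
    [Y] is [O(h)], and this makes the forcing of the remainder [O(h^2)]. *)
Lemma expansion_step (X : R) (G G' Y0 Y1 Y2 Z0 Z1 Z2 : C -> R -> C) :
  0 <= X -> is_expansion X G G' ->
  (forall mu, is_forced q dq mu (G mu) (Y0 mu) (Y1 mu) (Y2 mu)) ->
  (forall mu, is_forced q dq mu (fun x => G' mu x + Y0 mu x)%C (Z0 mu) (Z1 mu) (Z2 mu)) ->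
  (forall mu, Ccontinuous (Y0 mu)) ->
  (forall mu mu', Y0 mu 0 = Y0 mu' 0 /\ Y1 mu 0 = Y1 mu' 0 /\ Y2 mu 0 = Y2 mu' 0) ->
  (forall mu, Z0 mu 0 = RtoC 0 /\ Z1 mu 0 = RtoC 0 /\ Z2 mu 0 = RtoC 0) ->
  is_expansion X Y0 Z0 /\ is_expansion X Y1 Z1 /\ is_expansion X Y2 Z2.
Proof.
  intros HX HG HY HZ Yc Yi Zi.
  assert (Key : forall mu, exists K, 0 <= K /\ forall h, Cmod h <= 1 ->
    forall x, 0 <= x <= X ->
    (Cmod (Y0 (mu + h)%C x - Y0 mu x) <= K * Cmod h /\
     Cmod (Y1 (mu + h)%C x - Y1 mu x) <= K * Cmod h /\
     Cmod (Y2 (mu + h)%C x - Y2 mu x) <= K * Cmod h) /\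
    (Cmod (Y0 (mu + h)%C x - Y0 mu x - h * Z0 mu x) <= K * Cmod h ^ 2 /\
     Cmod (Y1 (mu + h)%C x - Y1 mu x - h * Z1 mu x) <= K * Cmod h ^ 2 /\
     Cmod (Y2 (mu + h)%C x - Y2 mu x - h * Z2 mu x) <= K * Cmod h ^ 2)).
  { intros mu.
    destruct (HG mu) as [K [K0 HK]].
    destruct (forced_bound mu X HX) as [L [L0 HL]].
    destruct (Ccontinuous_bounded (Y0 mu) X (Yc mu)) as [B [B0 HB]].
    set (K1 := L * (K + B)). set (K2 := L * (K + K1)).
    assert (K10 : 0 <= K1) by (unfold K1; apply Rmult_le_pos; lra).
    assert (K20 : 0 <= K2) by (unfold K2; apply Rmult_le_pos; lra).
    exists (K1 + K2); split; [lra |]; intros h Hh.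
    assert (H0 := Cmod_ge_0 h).
    assert (E : forall x, 0 <= x <= X ->
      Cmod (Y0 (mu + h)%C x - Y0 mu x) <= K1 * Cmod h /\
      Cmod (Y1 (mu + h)%C x - Y1 mu x) <= K1 * Cmod h /\
      Cmod (Y2 (mu + h)%C x - Y2 mu x) <= K1 * Cmod h).
    { unfold K1; rewrite Rmult_assoc.
      apply (HL (mu + h)%C (fun x => G (mu + h)%C x - (G mu x + (mu - (mu + h)) * Y0 mu x))%C).
      - now replace (mu + h - mu)%C with h by ring.
      - apply Rmult_le_pos; lra.
      - apply forced_minus; [apply HY |].
        now apply (forced_shift mu (mu + h)%C (G mu)).
      - destruct (Yi (mu + h)%C mu) as (-> & _ & _); ring.
      - destruct (Yi (mu + h)%C mu) as (_ & -> & _); ring.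
      - destruct (Yi (mu + h)%C mu) as (_ & _ & ->); ring.
      - intros x Hx.
        replace (G (mu + h) x - (G mu x + (mu - (mu + h)) * Y0 mu x))%C
          with ((G (mu + h) x - G mu x) + h * Y0 mu x)%C by ring.
        eapply Rle_trans; [apply Cmod_triangle |]; rewrite Cmod_mult.
        destruct (HK h Hh x Hx) as [H1 _]; specialize (HB x Hx).
        assert (Cmod h * Cmod (Y0 mu x) <= Cmod h * B) by (apply Rmult_le_compat_l; lra).
        lra. }
    assert (R : forall x, 0 <= x <= X ->
      Cmod (Y0 (mu + h)%C x - Y0 mu x - h * Z0 mu x) <= K2 * Cmod h ^ 2 /\
      Cmod (Y1 (mu + h)%C x - Y1 mu x - h * Z1 mu x) <= K2 * Cmod h ^ 2 /\
      Cmod (Y2 (mu + h)%C x - Y2 mu x - h * Z2 mu x) <= K2 * Cmod h ^ 2).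
    { unfold K2; rewrite Rmult_assoc.
      apply (HL mu (fun x => G (mu + h)%C x + (mu + h - mu) * Y0 (mu + h)%C x - G mu x
                              - h * (G' mu x + Y0 mu x))%C).
      - replace (mu - mu)%C with (RtoC 0) by ring; rewrite Cmod_0; lra.
      - apply Rmult_le_pos; [lra | apply pow2_ge_0].
      - apply (forced_minus mu
          (fun x => G (mu + h)%C x + (mu + h - mu) * Y0 (mu + h)%C x - G mu x)%C).
        + apply forced_minus; [ | apply HY].
          now apply (forced_shift (mu + h)%C mu (G (mu + h)%C)).
        + apply forced_scale, HZ.
      - destruct (Yi (mu + h)%C mu) as (-> & _ & _), (Zi mu) as (-> & _ & _); ring.
      - destruct (Yi (mu + h)%C mu) as (_ & -> & _), (Zi mu) as (_ & -> & _); ring.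
      - destruct (Yi (mu + h)%C mu) as (_ & _ & ->), (Zi mu) as (_ & _ & ->); ring.
      - intros x Hx.
        replace (G (mu + h) x + (mu + h - mu) * Y0 (mu + h) x - G mu x
                 - h * (G' mu x + Y0 mu x))%C
          with ((G (mu + h) x - G mu x - h * G' mu x) + h * (Y0 (mu + h) x - Y0 mu x))%C
          by ring.
        eapply Rle_trans; [apply Cmod_triangle |]; rewrite Cmod_mult.
        destruct (HK h Hh x Hx) as [_ H1]; destruct (E x Hx) as [H2 _].
        assert (Cmod h * Cmod (Y0 (mu + h)%C x - Y0 mu x) <= Cmod h * (K1 * Cmod h))
          by (apply Rmult_le_compat_l; lra).
        lra. }
    intros x Hx; destruct (E x Hx) as (E0 & E1 & E2); destruct (R x Hx) as (R0 & R1 & R2).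
    assert (0 <= K2 * Cmod h) by (apply Rmult_le_pos; lra).
    assert (0 <= K1 * Cmod h ^ 2) by (apply Rmult_le_pos; [lra | apply pow2_ge_0]).
    rewrite !Rmult_plus_distr_r; repeat split; lra. }
  repeat split; intros mu; destruct (Key mu) as [K [K0 HK]]; exists K;
    (split; [exact K0 |]); intros h Hh x Hx; destruct (HK h Hh x Hx) as [H1 H2]; split;
    first [apply H1 | apply H2].
Qed.

Section Fundamental.

Context (mu : C) (P : nat -> nat -> R -> C).
Context (P01 : forall j x, (j < 3)%nat -> is_Cderive (P 0 j) x (P 1%nat j x)).
Context (P12 : forall j x, (j < 3)%nat -> is_Cderive (P 1 j) x (P 2%nat j x)).
Context (P23 : forall j x, (j < 3)%nat -> is_Cderive (P 2 j) x
  (- (mu + RtoC (dq x)) * P 0%nat j x - RtoC (q x) * P 1%nat j x)%C).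
Context (Pinit : forall i j, (i < 3)%nat -> (j < 3)%nat ->
  P i j 0 = if Nat.eqb i j then RtoC 1 else RtoC 0).

(** The coefficient matrix has trace zero. *)
Lemma liouville (x : R) : 0 <= x ->
  det3 Cmult Cminus Cplus (fun i j => P i j x) = RtoC 1.
Proof.
  intros Hx.
  assert (D : forall t, is_Cderive (fun t => det3 Cmult Cminus Cplus (fun i j => P i j t)) t
                          (RtoC 0)).
  { intros t.
    pose proof (P01 0 t ltac:(lia)); pose proof (P01 1 t ltac:(lia)).
    pose proof (P01 2 t ltac:(lia)); pose proof (P12 0 t ltac:(lia)).
    pose proof (P12 1 t ltac:(lia)); pose proof (P12 2 t ltac:(lia)).
    pose proof (P23 0 t ltac:(lia)); pose proof (P23 1 t ltac:(lia)).
    pose proof (P23 2 t ltac:(lia)).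
    unfold det3; eapply is_Cderive_eq.
    - Cder.
    - ring. }
  destruct (mean_value _ (fun _ => 0) 0 x Hx (fun t _ => proj1 (D t))) as [s [_ E1]].
  destruct (mean_value _ (fun _ => 0) 0 x Hx (fun t _ => proj2 (D t))) as [s' [_ E2]].
  assert (I0 : det3 Cmult Cminus Cplus (fun i j => P i j 0) = RtoC 1).
  { unfold det3; rewrite !Pinit by lia; simpl; ring. }
  rewrite I0 in E1, E2; simpl in E1, E2.
  apply injective_projections; simpl; lra.
Qed.

Lemma duhamel_forced (g : R -> C) : Ccontinuous g ->
  is_forced q dq mu g (duhamel P g 0) (duhamel P g 1) (duhamel P g 2) /\
  Ccontinuous (duhamel P g 0) /\ forall k, duhamel P g k 0 = RtoC 0.
Proof.
  intros Hg.
  assert (HP : forall j, (j < 3)%nat -> Ccontinuous (P 0%nat j) /\ Ccontinuous (P 1%nat j)).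
  { intros j Hj; split; eapply Ccontinuous_derive; intros x; [now apply P01 | now apply P12]. }
  assert (Cm : forall y z, Ccontinuous y -> Ccontinuous z -> Ccontinuous (fun x => y x * z x)%C).
  { intros y z Hy Hz x; destruct (Hy x), (Hz x); split; simpl.
    - apply (continuous_minus (V := R_NormedModule));
        apply (continuous_mult (K := R_AbsRing)); assumption.
    - apply (continuous_plus (V := R_NormedModule));
        apply (continuous_mult (K := R_AbsRing)); assumption. }
  assert (Cs : forall y z, Ccontinuous y -> Ccontinuous z -> Ccontinuous (fun x => y x - z x)%C).
  { intros y z Hy Hz x; destruct (Hy x), (Hz x); split; simpl;
      apply (continuous_minus (V := R_NormedModule)); assumption. }
  destruct (HP 0%nat ltac:(lia)) as [c00 c10].
  destruct (HP 1%nat ltac:(lia)) as [c01 c11].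
  destruct (HP 2%nat ltac:(lia)) as [c02 c12].
  assert (DI : forall i x, is_Cderive (Cint (fun t => cofactor2 P i t * g t)%C) x
                             (cofactor2 P i x * g x)%C).
  { intros i x; apply is_Cderive_Cint; destruct i as [ | [ | i]]; unfold cofactor2; auto. }
  assert (Yz : forall k, duhamel P g k 0 = RtoC 0).
  { intros k; unfold duhamel, Cint; rewrite !RInt_point.
    change ((zero : R), (zero : R)) with (RtoC 0); ring. }
  assert (Dy0 : forall x, is_Cderive (duhamel P g 0) x (duhamel P g 1 x)).
  { intros x; pose proof (P01 0 x ltac:(lia)); pose proof (P01 1 x ltac:(lia)).
    pose proof (P01 2 x ltac:(lia)).
    pose proof (DI 0%nat x); pose proof (DI 1%nat x); pose proof (DI 2%nat x).
    eapply is_Cderive_eq; [unfold duhamel; Cder | unfold duhamel; simpl; ring]. }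
  split; [ | split; [exact (Ccontinuous_derive _ _ Dy0) | exact Yz]].
  intros x Hx.
  pose proof (P12 0 x ltac:(lia)); pose proof (P12 1 x ltac:(lia)).
  pose proof (P12 2 x ltac:(lia)); pose proof (P23 0 x ltac:(lia)).
  pose proof (P23 1 x ltac:(lia)); pose proof (P23 2 x ltac:(lia)).
  pose proof (DI 0%nat x); pose proof (DI 1%nat x); pose proof (DI 2%nat x).
  split; [apply Dy0 | split].
  - eapply is_Cderive_eq; [unfold duhamel; Cder | unfold duhamel; simpl; ring].
  - eapply is_Cderive_eq; [unfold duhamel; Cder |].
    (* The terms from differentiating the integrals expand a determinant along its last row; in
       components 0 and 1 the same expansion has a repeated row and vanishes. *)
    transitivity (- (mu + RtoC (dq x)) * duhamel P g 0 x - RtoC (q x) * duhamel P g 1 x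
      - det3 Cmult Cminus Cplus (fun i j => P i j x) * g x)%C.
    + unfold duhamel, det3; simpl; ring.
    + rewrite (liouville x Hx); ring.
Qed.

End Fundamental.

End Linear.

Lemma expansion_plus (X : R) (G G' Y Z : C -> R -> C) :
  is_expansion X G G' -> is_expansion X Y Z ->
  is_expansion X (fun m x => G m x + Y m x)%C (fun m x => G' m x + Z m x)%C.
Proof.
  intros H1 H2 mu; destruct (H1 mu) as [K [K0 HK]]; destruct (H2 mu) as [L [L0 HL]].
  exists (K + L); split; [lra |]; intros h Hh x Hx.
  destruct (HK h Hh x Hx) as [A1 A2]; destruct (HL h Hh x Hx) as [B1 B2]; split.
  - replace (G (mu + h) x + Y (mu + h) x - (G mu x + Y mu x))%C
      with ((G (mu + h) x - G mu x) + (Y (mu + h) x - Y mu x))%C by ring.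
    eapply Rle_trans; [apply Cmod_triangle | lra].
  - replace (G (mu + h) x + Y (mu + h) x - (G mu x + Y mu x) - h * (G' mu x + Z mu x))%C
      with ((G (mu + h) x - G mu x - h * G' mu x) + (Y (mu + h) x - Y mu x - h * Z mu x))%C
      by ring.
    eapply Rle_trans; [apply Cmod_triangle | lra].
Qed.

Lemma fst_le_Cmod (z : C) : Rabs (fst z) <= Cmod z.
Proof. eapply Rle_trans; [apply Rmax_l | apply Rmax_Cmod]. Qed.

Lemma snd_le_Cmod (z : C) : Rabs (snd z) <= Cmod z.
Proof. eapply Rle_trans; [apply Rmax_r | apply Rmax_Cmod]. Qed.

Lemma expansion_Cderive (X T m : R) (G G' : C -> R -> C) :
  0 <= T <= X -> is_expansion X G G' ->
  is_Cderive (fun t => G (RtoC t) T) m (G' (RtoC m) T).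
Proof.
  intros HT HG; destruct (HG (RtoC m)) as [K [K0 HK]].
  assert (A : forall eps, 0 < eps -> locally m (fun y =>
    Cmod (G (RtoC y) T - G (RtoC m) T - RtoC (y - m) * G' (RtoC m) T) <= eps * Rabs (y - m))).
  { intros eps He; apply locally_R; exists (Rmin 1 (eps / (K + 1))).
    split; [apply Rmin_case; [lra | apply Rdiv_lt_0_compat; lra] |]; intros y Hy.
    pose proof (Rmin_l 1 (eps / (K + 1))); pose proof (Rmin_r 1 (eps / (K + 1))).
    destruct (HK (RtoC (y - m))) with (x := T) as [_ H2]; [rewrite Cmod_R; lra | exact HT |].
    replace (RtoC m + RtoC (y - m))%C with (RtoC y) in H2 by (rewrite RtoC_minus; ring).
    eapply Rle_trans; [exact H2 |]; rewrite Cmod_R.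
    replace (K * Rabs (y - m) ^ 2) with (K * Rabs (y - m) * Rabs (y - m)) by ring.
    apply Rmult_le_compat_r; [apply Rabs_pos |].
    apply Rle_trans with ((K + 1) * (eps / (K + 1))); [ | right; field; lra].
    apply Rmult_le_compat; try lra; apply Rabs_pos. }
  split; apply derive_approx; intros eps He; generalize (A eps He); apply filter_imp;
    intros y Hy; eapply Rle_trans; [ | exact Hy | | exact Hy].
  - eapply Rle_trans; [ | apply fst_le_Cmod]; right; f_equal; simpl; ring.
  - eapply Rle_trans; [ | apply snd_le_Cmod]; right; f_equal; simpl; ring.
Qed.

(** * Limits and Taylor expansion at 0 *)

(** The limit is punctured, for use with quotients by powers of [h]. *)
Definition tends (g : R -> R) (l : R) : Prop := filterlim g (locally' 0) (locally l).

Lemma tends_ext (g g' : R -> R) (l : R) :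
  (forall h, h <> 0 -> g h = g' h) -> tends g l -> tends g' l.
Proof.
  intros He; apply filterlim_ext_loc.
  exists (mkposreal 1 Rlt_0_1); intros h _ Hh; now apply He.
Qed.

Lemma tends_unique (g : R -> R) (l l' : R) : tends g l -> tends g l' -> l = l'.
Proof.
  apply (filterlim_locally_unique (V := R_NormedModule) (F := locally' 0)
    (FF := Proper_StrongProper _ (Rbar_locally'_filter 0)) g).
Qed.

Lemma tends_plus (g g' : R -> R) (l l' : R) :
  tends g l -> tends g' l' -> tends (fun h => g h + g' h) (l + l').
Proof.
  intros H H'; eapply filterlim_comp_2; [exact H | exact H' |].
  apply (filterlim_plus (V := R_NormedModule)).
Qed.

Lemma tends_mult (g g' : R -> R) (l l' : R) :
  tends g l -> tends g' l' -> tends (fun h => g h * g' h) (l * l').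
Proof.
  intros H H'; eapply filterlim_comp_2; [exact H | exact H' |].
  apply (filterlim_mult (K := R_AbsRing)).
Qed.

Lemma tends_const (k : R) : tends (fun _ => k) k.
Proof. apply filterlim_const. Qed.

Lemma tends_opp (g : R -> R) (l : R) : tends g l -> tends (fun h => - g h) (- l).
Proof.
  intros H; replace (- l) with (-1 * l) by ring.
  apply (tends_ext (fun h => -1 * g h)); [intros; ring |].
  apply tends_mult; [apply tends_const | exact H].
Qed.

Lemma tends_minus (g g' : R -> R) (l l' : R) :
  tends g l -> tends g' l' -> tends (fun h => g h - g' h) (l - l').
Proof. intros H H'; apply tends_plus; [exact H | now apply tends_opp]. Qed.

Lemma tends_eps (g : R -> R) (l : R) :
  (forall eps, 0 < eps -> locally 0 (fun h => h <> 0 -> Rabs (g h - l) <= eps)) -> tends g l.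
Proof.
  intros H P [eps HP].
  assert (He : 0 < eps / 2) by (pose proof (cond_pos eps); lra).
  change (locally 0 (fun h => h <> 0 -> P (g h))).
  generalize (H _ He); apply filter_imp; intros h Hh Hn; apply HP.
  specialize (Hh Hn); change (Rabs (g h - l) < eps); lra.
Qed.

Lemma tends_linear_error (g : R -> R) (l K : R) :
  (forall h, h <> 0 -> Rabs h <= 1 -> Rabs (g h - l) <= K * Rabs h) -> tends g l.
Proof.
  intros H; apply tends_eps; intros eps He; apply locally_R.
  exists (Rmin 1 (eps / (Rabs K + 1))); pose proof (Rabs_pos K).
  split; [apply Rmin_case; [lra | apply Rdiv_lt_0_compat; lra] |].
  intros h Hh Hn; rewrite Rminus_0_r in Hh.
  pose proof (Rmin_l 1 (eps / (Rabs K + 1))); pose proof (Rmin_r 1 (eps / (Rabs K + 1))).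
  eapply Rle_trans; [apply H; [exact Hn | lra] |].
  apply Rle_trans with ((Rabs K + 1) * (eps / (Rabs K + 1))); [ | right; field; lra].
  pose proof (Rle_abs K); pose proof (Rabs_pos h).
  apply Rle_trans with ((Rabs K + 1) * Rabs h);
    [apply Rmult_le_compat_r | apply Rmult_le_compat_l]; lra.
Qed.

Lemma tends_continuous (g : R -> R) : continuous g 0 -> tends g (g 0).
Proof.
  intros H P HP; change (locally 0 (fun h => h <> 0 -> P (g h))).
  apply (filter_imp (fun h => P (g h))); [auto | exact (H P HP)].
Qed.

Lemma tends_id : tends (fun h => h) 0.
Proof. apply (tends_linear_error _ _ 1); intros; rewrite Rminus_0_r; lra. Qed.

Lemma integrate_bound (r r' : R -> R) (n : nat) :
  (forall t, is_derive r t (r' t)) -> r 0 = 0 ->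
  (forall eps, 0 < eps -> locally 0 (fun h => Rabs (r' h) <= eps * Rabs h ^ n)) ->
  forall eps, 0 < eps -> locally 0 (fun h => Rabs (r h) <= eps * Rabs h ^ S n).
Proof.
  intros D Z H eps He; destruct (proj1 (locally_R _ _) (H eps He)) as (d & Hd & Hb).
  apply locally_R; exists d; split; [exact Hd |]; intros h Hh; rewrite Rminus_0_r in Hh.
  replace (r h) with (r h - r 0) by (rewrite Z; ring).
  replace (eps * Rabs h ^ S n) with (eps * Rabs h ^ n * Rabs (h - 0))
    by (rewrite Rminus_0_r; simpl; ring).
  pose proof (Rabs_pos h).
  apply (mean_value_bound r r' (- Rabs h) (Rabs h)); [intros; apply D | | | lra].
  - intros t Ht; assert (Rabs t <= Rabs h) by (apply Rabs_le; lra).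
    eapply Rle_trans; [apply Hb; rewrite Rminus_0_r; lra |].
    apply Rmult_le_compat_l; [lra |]; apply pow_incr; split; [apply Rabs_pos | assumption].
  - pose proof (Rle_abs h); pose proof (Rle_abs (- h)) as Hn; rewrite Rabs_Ropp in Hn; lra.
Qed.

(** Peano's form of the remainder: the expansion starts from differentiability of [g2] at 0 and is
    integrated twice, so no continuity of [g3] enters. *)
Lemma taylor3 (g g1 g2 g3 : R -> R) :
  (forall t, is_derive g t (g1 t)) -> (forall t, is_derive g1 t (g2 t)) ->
  (forall t, is_derive g2 t (g3 t)) ->
  tends (fun h => (g h - (g 0 + g1 0 * h + g2 0 / 2 * h ^ 2 + g3 0 / 6 * h ^ 3)) / h ^ 3) 0.
Proof.
  intros D1 D2 D3.
  assert (B2 : forall eps, 0 < eps -> locally 0 (fun h =>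
    Rabs (g2 h - (g2 0 + g3 0 * h)) <= eps * Rabs h ^ 1)).
  { intros eps He; generalize (proj1 (derive_approx _ _ _) (D3 0) eps He); apply filter_imp.
    intros h Hh; rewrite Rminus_0_r in Hh.
    rewrite pow_1; replace (g2 h - (g2 0 + g3 0 * h)) with (g2 h - g2 0 - g3 0 * h) by ring.
    exact Hh. }
  assert (B1 := integrate_bound (fun h => g1 h - (g1 0 + g2 0 * h + g3 0 / 2 * h ^ 2))
    (fun h => g2 h - (g2 0 + g3 0 * h)) 1).
  assert (B0 := integrate_bound
    (fun h => g h - (g 0 + g1 0 * h + g2 0 / 2 * h ^ 2 + g3 0 / 6 * (h ^ 2 * h)))
    (fun h => g1 h - (g1 0 + g2 0 * h + g3 0 / 2 * h ^ 2)) 2).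
  apply tends_eps; intros eps He.
  refine (filter_imp _ _ _ (B0 _ _ (B1 _ _ B2) eps He)).
  - intros h Hh Hn; rewrite Rminus_0_r.
    assert (0 < Rabs h) by (apply Rabs_pos_lt, Hn).
    rewrite Rabs_div, <- RPow_abs by (apply pow_nonzero, Hn).
    apply Rle_div_l; [now apply pow_lt |].
    replace (h ^ 3) with (h ^ 2 * h) by ring; exact Hh.
  - intros t; eapply is_derive_eq; [der | cbv beta; field].
  - cbv beta; ring.
  - intros t; eapply is_derive_eq; [der | cbv beta; field].
  - cbv beta; ring.
Qed.

(** * Invariants of 3 by 3 matrices *)

(** Sum of the principal 2 by 2 minors, the second elementary symmetric function of the
    eigenvalues. *)
Definition e2_3 (A : nat -> nat -> R) : R :=
  A 0%nat 0%nat * A 1%nat 1%nat - A 0%nat 1%nat * A 1%nat 0%nat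
  + (A 0%nat 0%nat * A 2%nat 2%nat - A 0%nat 2%nat * A 2%nat 0%nat)
  + (A 1%nat 1%nat * A 2%nat 2%nat - A 1%nat 2%nat * A 2%nat 1%nat).

Definition tr3 (A : nat -> nat -> R) : R := A 0%nat 0%nat + A 1%nat 1%nat + A 2%nat 2%nat.

Definition Rdet3 : (nat -> nat -> R) -> R := det3 Rmult Rminus Rplus.

Definition mul3 (A B : nat -> nat -> R) (i j : nat) : R :=
  A i 0%nat * B 0%nat j + A i 1%nat * B 1%nat j + A i 2%nat * B 2%nat j.

Definition shift3 (A : nat -> nat -> R) (k : R) (i j : nat) : R :=
  A i j + (if Nat.eqb i j then k else 0).

Lemma det3_ext (A B : nat -> nat -> R) :
  (forall i j, (i < 3)%nat -> (j < 3)%nat -> A i j = B i j) -> Rdet3 A = Rdet3 B.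
Proof. intros H; unfold Rdet3, det3; now rewrite !H by lia. Qed.

Lemma det3_mul (A B : nat -> nat -> R) : Rdet3 (mul3 A B) = Rdet3 A * Rdet3 B.
Proof. unfold Rdet3, det3, mul3; ring. Qed.

Lemma det3_shift (A : nat -> nat -> R) (k : R) :
  Rdet3 (shift3 A k) = k ^ 3 + tr3 A * k ^ 2 + e2_3 A * k + Rdet3 A.
Proof. unfold Rdet3, det3, shift3, tr3, e2_3; simpl; ring. Qed.

(** [A] and [X] have the same characteristic polynomial; as it is cubic and monic, its values at
    three shifts determine the remaining coefficients. *)
Lemma similar3_invariants (A S X : nat -> nat -> R) : Rdet3 S <> 0 ->
  (forall i j, (i < 3)%nat -> (j < 3)%nat -> mul3 A S i j = mul3 S X i j) ->
  e2_3 A = e2_3 X /\ Rdet3 A = Rdet3 X.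
Proof.
  intros HS H.
  assert (D : forall k, Rdet3 (shift3 A k) = Rdet3 (shift3 X k)).
  { intros k; apply Rmult_eq_reg_l with (Rdet3 S); [ | exact HS].
    rewrite Rmult_comm, <- !det3_mul; apply det3_ext; intros i j Hi Hj.
    specialize (H i j Hi Hj); unfold mul3, shift3 in *.
    destruct i as [ | [ | [ | i]]]; [ | | | lia];
      (destruct j as [ | [ | [ | j]]]; [ | | | lia]); simpl in *; lra. }
  pose proof (D 0) as D0; pose proof (D 1) as D1; pose proof (D (-1)) as D2.
  rewrite !det3_shift in D0, D1, D2; split; lra.
Qed.

(* A bilinear form preserved by [M] and [M'] makes [M'] similar to the inverse of [M]. *)
Lemma form_trace (M M' : nat -> nat -> R) (q0 m : R) : m <> 0 -> Rdet3 M = 1 ->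
  (forall i j, (i < 3)%nat -> (j < 3)%nat ->
    let B := fun (v w : nat -> R) =>
      (v 2%nat + q0 * v 0%nat) * (w 2%nat + q0 * w 0%nat)
      - m * (w 0%nat * v 1%nat - v 0%nat * w 1%nat) in
    B (fun k => M k i) (fun k => M' k j) =
    B (fun k => if Nat.eqb k i then 1 else 0) (fun k => if Nat.eqb k j then 1 else 0)) ->
  tr3 M' = e2_3 M.
Proof.
  intros Hm Hd HB.
  (* The cofactor matrix, which is the inverse transpose of [M] because [det M = 1]; its trace is
     [e2_3 M]. *)
  set (C := fun k i : nat => match k, i with
    | 0%nat, 0%nat => M 1%nat 1%nat * M 2%nat 2%nat - M 1%nat 2%nat * M 2%nat 1%nat
    | 0%nat, 1%nat => M 1%nat 2%nat * M 2%nat 0%nat - M 1%nat 0%nat * M 2%nat 2%nat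
    | 0%nat, _ => M 1%nat 0%nat * M 2%nat 1%nat - M 1%nat 1%nat * M 2%nat 0%nat
    | 1%nat, 0%nat => M 2%nat 1%nat * M 0%nat 2%nat - M 2%nat 2%nat * M 0%nat 1%nat
    | 1%nat, 1%nat => M 2%nat 2%nat * M 0%nat 0%nat - M 2%nat 0%nat * M 0%nat 2%nat
    | 1%nat, _ => M 2%nat 0%nat * M 0%nat 1%nat - M 2%nat 1%nat * M 0%nat 0%nat
    | _, 0%nat => M 0%nat 1%nat * M 1%nat 2%nat - M 0%nat 2%nat * M 1%nat 1%nat
    | _, 1%nat => M 0%nat 2%nat * M 1%nat 0%nat - M 0%nat 0%nat * M 1%nat 2%nat
    | _, _ => M 0%nat 0%nat * M 1%nat 1%nat - M 0%nat 1%nat * M 1%nat 0%nat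
    end).
  assert (Cr : forall x0 x1 x2 y0 y1 y2,
    M 0%nat 0%nat * x0 + M 1%nat 0%nat * x1 + M 2%nat 0%nat * x2 = y0 ->
    M 0%nat 1%nat * x0 + M 1%nat 1%nat * x1 + M 2%nat 1%nat * x2 = y1 ->
    M 0%nat 2%nat * x0 + M 1%nat 2%nat * x1 + M 2%nat 2%nat * x2 = y2 ->
    x0 = C 0%nat 0%nat * y0 + C 0%nat 1%nat * y1 + C 0%nat 2%nat * y2 /\
    x1 = C 1%nat 0%nat * y0 + C 1%nat 1%nat * y1 + C 1%nat 2%nat * y2 /\
    x2 = C 2%nat 0%nat * y0 + C 2%nat 1%nat * y1 + C 2%nat 2%nat * y2).
  { intros x0 x1 x2 y0 y1 y2 <- <- <-.
    split; [ | split];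
      [transitivity (Rdet3 M * x0) | transitivity (Rdet3 M * x1) | transitivity (Rdet3 M * x2)];
      try (rewrite Hd; ring); unfold Rdet3, det3, C; ring. }
  assert (HC : C 0%nat 0%nat + C 1%nat 1%nat + C 2%nat 2%nat = e2_3 M)
    by (unfold C, e2_3; ring).
  clearbody C.
  (* column [j] of [G M'], with [G] the matrix of the form *)
  assert (Col : forall j, (j < 3)%nat ->
    let d := fun k => if Nat.eqb k j then 1 else 0 in
    let x0 := q0 * (M' 2%nat j + q0 * M' 0%nat j) + m * M' 1%nat j in
    let x1 := - m * M' 0%nat j in
    let x2 := M' 2%nat j + q0 * M' 0%nat j in
    let y0 := q0 * (d 2%nat + q0 * d 0%nat) + m * d 1%nat in
    let y1 := - m * d 0%nat in
    let y2 := d 2%nat + q0 * d 0%nat in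
    x0 = C 0%nat 0%nat * y0 + C 0%nat 1%nat * y1 + C 0%nat 2%nat * y2 /\
    x1 = C 1%nat 0%nat * y0 + C 1%nat 1%nat * y1 + C 1%nat 2%nat * y2 /\
    x2 = C 2%nat 0%nat * y0 + C 2%nat 1%nat * y1 + C 2%nat 2%nat * y2).
  { intros j Hj; simpl; apply Cr;
      [pose proof (HB 0%nat j ltac:(lia) Hj) as E | pose proof (HB 1%nat j ltac:(lia) Hj) as E
      | pose proof (HB 2%nat j ltac:(lia) Hj) as E]; simpl in E; lra. }
  destruct (Col 0%nat ltac:(lia)) as (_ & A1 & _).
  destruct (Col 1%nat ltac:(lia)) as (B0 & _ & B2).
  destruct (Col 2%nat ltac:(lia)) as (_ & C1 & C2).
  simpl in *.
  (* For [m <> 0] the form is nondegenerate, and the equations are solved for the diagonal of [M'],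
     with [M' 0 2] on the way to [M' 2 2]. *)
  assert (T0 : M' 0%nat 0%nat = - (C 1%nat 0%nat * q0 ^ 2 - C 1%nat 1%nat * m
                                   + C 1%nat 2%nat * q0) / m).
  { apply Rmult_eq_reg_l with (- m); [ | lra].
    transitivity (C 1%nat 0%nat * q0 ^ 2 - C 1%nat 1%nat * m + C 1%nat 2%nat * q0);
      [lra | field; exact Hm]. }
  assert (T1 : M' 1%nat 1%nat = C 0%nat 0%nat - q0 * C 2%nat 0%nat).
  { apply Rmult_eq_reg_l with m; [ | exact Hm].
    transitivity (C 0%nat 0%nat * m - q0 * (C 2%nat 0%nat * m)); [ | ring].
    replace (M' 2%nat 1%nat + q0 * M' 0%nat 1%nat) with (C 2%nat 0%nat * m) in B0 by lra.
    lra. }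
  assert (T2 : M' 0%nat 2%nat = - (C 1%nat 0%nat * q0 + C 1%nat 2%nat) / m).
  { apply Rmult_eq_reg_l with (- m); [ | lra].
    transitivity (C 1%nat 0%nat * q0 + C 1%nat 2%nat); [lra | field; exact Hm]. }
  assert (T3 : M' 2%nat 2%nat = C 2%nat 0%nat * q0 + C 2%nat 2%nat - q0 * M' 0%nat 2%nat)
    by lra.
  rewrite <- HC; unfold tr3; rewrite T3, T0, T1, T2; field; exact Hm.
Qed.

(** * The monodromy matrix: derivatives in [mu], symmetry, and jumps over a period *)

Lemma zero_derive_const (g : R -> R) (x : R) : (forall t, is_derive g t 0) -> g x = g 0.
Proof.
  intros H; destruct (Rle_dec 0 x).
  - destruct (mean_value g (fun _ => 0) 0 x) as [t [_ E]]; auto; lra.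
  - destruct (mean_value g (fun _ => 0) x 0) as [t [_ E]]; auto; lra.
Qed.

Lemma integral_of_derive (g g' : R -> R) (X : R) : 0 <= X ->
  (forall x, continuous g' x) -> (forall x, 0 <= x <= X -> is_derive g x (g' x)) ->
  RInt g' 0 X = g X - g 0.
Proof.
  intros HX Hc Hd; apply is_RInt_unique, (is_RInt_derive g g').
  - intros x; rewrite Rmin_left, Rmax_right by exact HX; apply Hd.
  - intros x _; apply Hc.
Qed.

Lemma RInt_lin (k l : R) (g h : R -> R) (A B : R) :
  (forall x, continuous g x) -> (forall x, continuous h x) ->
  RInt (fun x => k * g x + l * h x) A B = k * RInt g A B + l * RInt h A B.
Proof.
  intros Hg Hh.
  assert (I1 := continuous_ex_RInt g A B Hg). assert (I2 := continuous_ex_RInt h A B Hh).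
  rewrite (RInt_plus (V := R_CompleteNormedModule) (fun x => k * g x) (fun x => l * h x));
    [ | now apply (ex_RInt_scal (V := R_NormedModule))
      | now apply (ex_RInt_scal (V := R_NormedModule))].
  assert (E1 : RInt (fun x => k * g x) A B = k * RInt g A B)
    by exact (RInt_scal (V := R_CompleteNormedModule) g A B k I1).
  assert (E2 : RInt (fun x => l * h x) A B = l * RInt h A B)
    by exact (RInt_scal (V := R_CompleteNormedModule) h A B l I2).
  rewrite E1, E2; reflexivity.
Qed.

Lemma RInt_close (g h : R -> R) (X K : R) : 0 <= X ->
  (forall x, continuous g x) -> (forall x, continuous h x) ->
  (forall x, 0 <= x <= X -> Rabs (g x - h x) <= K) ->
  Rabs (RInt g 0 X - RInt h 0 X) <= X * K.
Proof.
  intros HX Hg Hh HK.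
  replace (RInt g 0 X - RInt h 0 X) with (1 * RInt g 0 X + -1 * RInt h 0 X) by ring.
  rewrite <- RInt_lin by assumption.
  rewrite <- (Rminus_0_r X) at 2; apply abs_RInt_le_const; [exact HX | |].
  - apply continuous_ex_RInt; intros x; apply (continuous_plus (V := R_NormedModule));
      apply (continuous_scal_r (V := R_NormedModule)); auto.
  - intros x Hx; replace (1 * g x + -1 * h x) with (g x - h x) by ring; now apply HK.
Qed.

Section Monodromy.

Context (q dq : R -> R).
Context (qd : forall x, is_derive q x (dq x)) (dqc : forall x, continuous dq x).
Context (P : C -> nat -> nat -> R -> C).
Context (P01 : forall mu j x, (j < 3)%nat -> is_Cderive (P mu 0%nat j) x (P mu 1%nat j x)).
Context (P12 : forall mu j x, (j < 3)%nat -> is_Cderive (P mu 1%nat j) x (P mu 2%nat j x)).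
Context (P23 : forall mu j x, (j < 3)%nat -> is_Cderive (P mu 2%nat j) x
  (- (mu + RtoC (dq x)) * P mu 0%nat j x - RtoC (q x) * P mu 1%nat j x)%C).
Context (Pinit : forall mu i j, (i < 3)%nat -> (j < 3)%nat ->
  P mu i j 0 = if Nat.eqb i j then RtoC 1 else RtoC 0).

Let qc (x : R) : continuous q x := continuous_of_derive q x (dq x) (qd x).

Lemma monodromy_expansions (X : R) : 0 <= X -> exists Y1 Y2 Y3 : nat -> nat -> C -> R -> C,
  forall k j, (k < 3)%nat -> (j < 3)%nat ->
    is_expansion X (fun mu => P mu k j) (Y1 k j) /\
    is_expansion X (Y1 k j) (Y2 k j) /\ is_expansion X (Y2 k j) (Y3 k j).
Proof.
  intros HX.
  (* By the Leibniz rule the [n]-th derivative in [mu] is forced by [n] times the previous one. The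
     sums are spelled out in the shape [G' + Y0] of [expansion_step], starting from zero forcing. *)
  pose (Y1 := fun k j mu => duhamel (P mu) (fun t => RtoC 0 + P mu 0%nat j t)%C k).
  pose (Y2 := fun k j mu => duhamel (P mu) (fun t => Y1 0%nat j mu t + Y1 0%nat j mu t)%C k).
  pose (Y3 := fun k j mu => duhamel (P mu)
    (fun t => (Y2 0%nat j mu t + Y2 0%nat j mu t) + Y2 0%nat j mu t)%C k).
  assert (Cp : forall y z, Ccontinuous y -> Ccontinuous z -> Ccontinuous (fun x => y x + z x)%C).
  { intros y z Hy Hz x; destruct (Hy x), (Hz x); split; simpl;
      apply (continuous_plus (V := R_NormedModule)); assumption. }
  exists Y1, Y2, Y3; intros k j Hk Hj.
  assert (C0 : forall mu, Ccontinuous (P mu 0%nat j)).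
  { intros mu; eapply Ccontinuous_derive; intros x; now apply P01. }
  assert (F0 : forall mu, is_forced q dq mu (fun _ => RtoC 0)
    (P mu 0%nat j) (P mu 1%nat j) (P mu 2%nat j)).
  { intros mu x _; split; [now apply P01 | split; [now apply P12 |]].
    eapply is_Cderive_eq; [now apply P23 | ring]. }
  assert (S1 := fun mu => duhamel_forced q dq mu (P mu) (P01 mu) (P12 mu) (P23 mu) (Pinit mu)
    (fun t => RtoC 0 + P mu 0%nat j t)%C).
  assert (S1' := fun mu => S1 mu (Cp _ _
    (Ccontinuous_derive _ _ (is_Cderive_const (RtoC 0))) (C0 mu))); clear S1.
  assert (S2 := fun mu => duhamel_forced q dq mu (P mu) (P01 mu) (P12 mu) (P23 mu) (Pinit mu)
    (fun t => Y1 0%nat j mu t + Y1 0%nat j mu t)%C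
    (Cp _ _ (proj1 (proj2 (S1' mu))) (proj1 (proj2 (S1' mu))))).
  assert (S3 := fun mu => duhamel_forced q dq mu (P mu) (P01 mu) (P12 mu) (P23 mu) (Pinit mu)
    (fun t => (Y2 0%nat j mu t + Y2 0%nat j mu t) + Y2 0%nat j mu t)%C
    (Cp _ _ (Cp _ _ (proj1 (proj2 (S2 mu))) (proj1 (proj2 (S2 mu))))
       (proj1 (proj2 (S2 mu))))).
  assert (E1 := expansion_step q dq qc dqc X (fun _ _ => RtoC 0) (fun _ _ => RtoC 0)
    (fun mu => P mu 0%nat j) (fun mu => P mu 1%nat j) (fun mu => P mu 2%nat j)
    (Y1 0%nat j) (Y1 1%nat j) (Y1 2%nat j) HX).
  destruct E1 as (A0 & A1 & A2).
  { intros mu; exists 0; split; [lra |]; intros h Hh x Hx; split.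
    - replace (RtoC 0 - RtoC 0)%C with (RtoC 0) by ring; rewrite Cmod_0; lra.
    - replace (RtoC 0 - RtoC 0 - h * RtoC 0)%C with (RtoC 0) by ring; rewrite Cmod_0; lra. }
  { exact F0. }
  { intros mu; apply S1'. }
  { exact C0. }
  { intros mu mu'; rewrite !Pinit by lia; auto. }
  { intros mu; split; [ | split]; apply S1'. }
  assert (E2 := expansion_step q dq qc dqc X (fun mu => P mu 0%nat j) (Y1 0%nat j)
    (Y1 0%nat j) (Y1 1%nat j) (Y1 2%nat j) (Y2 0%nat j) (Y2 1%nat j) (Y2 2%nat j) HX A0).
  destruct E2 as (B0 & B1 & B2).
  { intros mu; apply (forced_shift q dq mu mu (fun t => RtoC 0 + P mu 0%nat j t)%C);
      [intros; ring | apply S1']. }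
  { intros mu; apply S2. }
  { intros mu; apply S1'. }
  { intros mu mu'; unfold Y1; destruct (S1' mu) as (_ & _ & Z), (S1' mu') as (_ & _ & Z').
    now rewrite !Z, !Z'. }
  { intros mu; split; [ | split]; apply S2. }
  assert (E3 := expansion_step q dq qc dqc X
    (fun mu t => Y1 0%nat j mu t + Y1 0%nat j mu t)%C
    (fun mu t => Y2 0%nat j mu t + Y2 0%nat j mu t)%C
    (Y2 0%nat j) (Y2 1%nat j) (Y2 2%nat j) (Y3 0%nat j) (Y3 1%nat j) (Y3 2%nat j) HX
    (expansion_plus _ _ _ _ _ B0 B0)).
  destruct E3 as (D0 & D1 & D2).
  { intros mu; apply S2. }
  { intros mu; apply S3. }
  { intros mu; apply S2. }
  { intros mu mu'; unfold Y2; destruct (S2 mu) as (_ & _ & Z), (S2 mu') as (_ & _ & Z').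
    now rewrite !Z, !Z'. }
  { intros mu; split; [ | split]; apply S3. }
  destruct k as [ | [ | [ | k]]]; [auto | auto | auto | lia].
Qed.

Definition real_part (m : R) (k j : nat) (x : R) : R := fst (P (RtoC m) k j x).

Lemma real_part_init (m : R) (k j : nat) : (k < 3)%nat -> (j < 3)%nat ->
  real_part m k j 0 = if Nat.eqb k j then 1 else 0.
Proof. intros Hk Hj; unfold real_part; rewrite Pinit by assumption; now destruct (Nat.eqb k j). Qed.

Lemma real_part_derive (m : R) (j : nat) (x : R) : (j < 3)%nat ->
  is_derive (real_part m 0 j) x (real_part m 1 j x) /\
  is_derive (real_part m 1 j) x (real_part m 2 j x) /\
  is_derive (real_part m 2 j) x
    (- (m + dq x) * real_part m 0 j x - q x * real_part m 1 j x).
Proof.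
  intros Hj; split; [exact (proj1 (P01 (RtoC m) j x Hj)) |].
  split; [exact (proj1 (P12 (RtoC m) j x Hj)) |].
  eapply is_derive_eq; [exact (proj1 (P23 (RtoC m) j x Hj)) |].
  unfold real_part; simpl; ring.
Qed.

(** The imaginary part solves the same homogeneous equation, with real coefficients, and has zero
    initial data. *)
Lemma real_on_axis (m : R) (k j : nat) (x : R) : (k < 3)%nat -> (j < 3)%nat -> 0 <= x ->
  P (RtoC m) k j x = RtoC (real_part m k j x).
Proof.
  intros Hk Hj Hx.
  pose (y := fun k t => RtoC (snd (P (RtoC m) k j t))).
  assert (Hy : is_forced q dq (RtoC m) (fun _ => RtoC 0) (y 0%nat) (y 1%nat) (y 2%nat)).
  { intros t _; split; [ | split]; unfold y at 1.
    - exact (is_Cderive_RtoC _ _ _ (proj2 (P01 (RtoC m) j t Hj))).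
    - exact (is_Cderive_RtoC _ _ _ (proj2 (P12 (RtoC m) j t Hj))).
    - eapply is_Cderive_eq; [exact (is_Cderive_RtoC _ _ _ (proj2 (P23 (RtoC m) j t Hj))) |].
      unfold y; apply injective_projections; simpl; ring. }
  destruct (forced_unique q dq qc dqc (RtoC m) (y 0%nat) (y 1%nat) (y 2%nat) Hy)
    with (x := x) as (Z0 & Z1 & Z2); auto.
  1-3: unfold y; rewrite Pinit by lia; now destruct (Nat.eqb _ j).
  assert (Hz : y k x = RtoC 0)
    by (destruct k as [ | [ | [ | k]]]; [assumption | assumption | assumption | lia]).
  apply injective_projections; [reflexivity | exact (f_equal fst Hz)].
Qed.

Lemma real_part_det (m x : R) : 0 <= x -> Rdet3 (fun k j => real_part m k j x) = 1.
Proof.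
  intros Hx.
  assert (H := liouville q dq (RtoC m) (P (RtoC m)) (P01 _) (P12 _) (P23 _) (Pinit _) x Hx).
  unfold det3 in H; rewrite !real_on_axis in H by (lia || assumption).
  apply (f_equal fst) in H; simpl in H; unfold Rdet3, det3; rewrite <- H; ring.
Qed.

Lemma opposite_trace (m T : R) : m <> 0 -> 0 <= T -> q T = q 0 ->
  tr3 (fun k j => real_part (- m) k j T) = e2_3 (fun k j => real_part m k j T).
Proof.
  intros Hm HT HqT; apply (form_trace _ _ (q 0) m Hm (real_part_det m T HT)).
  intros i j Hi Hj; simpl.
  set (v := fun k => real_part m k i); set (w := fun k => real_part (- m) k j).
  (* [v 2 + q v 0] is [- L v], so this is the invariant form for solutions at [m] and [- m];
     [q T = q 0] makes it the same form at both ends. *)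
  pose (B := fun x => (v 2%nat x + q x * v 0%nat x) * (w 2%nat x + q x * w 0%nat x)
    - m * (w 0%nat x * v 1%nat x - v 0%nat x * w 1%nat x)).
  assert (HB : B T = B 0).
  { apply zero_derive_const; intros x.
    destruct (real_part_derive m i x Hi) as (V0 & V1 & V2).
    destruct (real_part_derive (- m) j x Hj) as (W0 & W1 & W2).
    fold (v 0%nat) in V0; fold (v 1%nat) in V1; fold (v 2%nat) in V2.
    fold (w 0%nat) in W0; fold (w 1%nat) in W1; fold (w 2%nat) in W2.
    unfold B; eapply is_derive_eq; [der | unfold v, w; cbv beta; ring]. }
  unfold B, v, w in HB; rewrite HqT in HB; rewrite HB, !real_part_init by lia.
  reflexivity.
Qed.

Definition real_solution (m p0 p1 p2 : R) (k : nat) (x : R) : R :=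
  real_part m k 0 x * p0 + real_part m k 1 x * p1 + real_part m k 2 x * p2.

Lemma real_solution_derive (m p0 p1 p2 x : R) :
  let Y := real_solution m p0 p1 p2 in
  is_derive (Y 0%nat) x (Y 1%nat x) /\ is_derive (Y 1%nat) x (Y 2%nat x) /\
  is_derive (Y 2%nat) x (- (m + dq x) * Y 0%nat x - q x * Y 1%nat x).
Proof.
  destruct (real_part_derive m 0 x ltac:(lia)) as (A0 & A1 & A2).
  destruct (real_part_derive m 1 x ltac:(lia)) as (B0 & B1 & B2).
  destruct (real_part_derive m 2 x ltac:(lia)) as (C0 & C1 & C2).
  intros Y; unfold Y, real_solution.
  split; [ | split]; (eapply is_derive_eq; [der | cbv beta; ring]).
Qed.

Lemma real_solution_init (m p0 p1 p2 : R) :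
  real_solution m p0 p1 p2 0 0 = p0 /\ real_solution m p0 p1 p2 1 0 = p1 /\
  real_solution m p0 p1 p2 2 0 = p2.
Proof.
  unfold real_solution; rewrite !real_part_init by lia; simpl.
  split; [ | split]; ring.
Qed.

(** The difference has zero initial data and is forced by the residual [r]. This compares exact
    solutions with the explicit approximate ones built from the variations. *)
Lemma approximate_solution (T : R) : 0 <= T -> exists K, 0 <= K /\
  forall (m rho : R) (z0 z1 z2 r : R -> R), Rabs m <= 1 ->
    (forall x, 0 <= x -> is_derive z0 x (z1 x)) ->
    (forall x, 0 <= x -> is_derive z1 x (z2 x)) ->
    (forall x, 0 <= x -> is_derive z2 x (- (m + dq x) * z0 x - q x * z1 x + r x)) ->
    (forall x, 0 <= x <= T -> Rabs (r x) <= rho) ->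
    let Y := real_solution m (z0 0) (z1 0) (z2 0) in
    forall x, 0 <= x <= T ->
      Rabs (Y 0%nat x - z0 x) <= K * rho /\ Rabs (Y 1%nat x - z1 x) <= K * rho /\
      Rabs (Y 2%nat x - z2 x) <= K * rho.
Proof.
  intros HT; destruct (forced_bound q dq qc dqc (RtoC 0) T HT) as [K [K0 HK]].
  exists K; split; [exact K0 |]; intros m rho z0 z1 z2 r Hm D0 D1 D2 Hr Y x Hx.
  destruct (real_solution_init m (z0 0) (z1 0) (z2 0)) as (I0 & I1 & I2).
  fold Y in I0, I1, I2; rewrite <- !Cmod_R.
  apply (HK (RtoC m) (fun t => RtoC (r t)) (fun t => RtoC (Y 0%nat t - z0 t))
    (fun t => RtoC (Y 1%nat t - z1 t)) (fun t => RtoC (Y 2%nat t - z2 t))).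
  - replace (RtoC m - RtoC 0)%C with (RtoC m) by ring; now rewrite Cmod_R.
  - eapply Rle_trans; [apply Rabs_pos | apply (Hr 0); lra].
  - intros t Ht; destruct (real_solution_derive m (z0 0) (z1 0) (z2 0) t) as (E0 & E1 & E2).
    fold Y in E0, E1, E2.
    split; [ | split].
    + apply is_Cderive_RtoC, is_derive_Rminus; auto.
    + apply is_Cderive_RtoC, is_derive_Rminus; auto.
    + eapply is_Cderive_eq; [apply is_Cderive_RtoC, is_derive_Rminus; [exact E2 | auto] |].
      apply injective_projections; simpl; ring.
  - rewrite I0; f_equal; ring.
  - rewrite I1; f_equal; ring.
  - rewrite I2; f_equal; ring.
  - intros t Ht; rewrite Cmod_R; now apply Hr.
  - exact Hx.
Qed.

Lemma solution_continuous (m p0 p1 p2 x : R) :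
  continuous (real_solution m p0 p1 p2 0) x.
Proof. exact (continuous_of_derive _ _ _ (proj1 (real_solution_derive m p0 p1 p2 x))). Qed.

Lemma mass_jump (m p0 p1 p2 T : R) : 0 <= T -> q T = q 0 ->
  let Y := real_solution m p0 p1 p2 in
  Y 2%nat T + q 0 * Y 0%nat T - (p2 + q 0 * p0) = - m * RInt (Y 0%nat) 0 T.
Proof.
  intros HT HqT Y; destruct (real_solution_init m p0 p1 p2) as (I0 & _ & I2).
  fold Y in I0, I2.
  pose (s := fun x => Y 2%nat x + q x * Y 0%nat x).
  assert (E : RInt (fun x => - m * Y 0%nat x + 0 * Y 0%nat x) 0 T = s T - s 0).
  { apply integral_of_derive; [exact HT | |].
    - intros x; eapply continuous_of_derive.
      destruct (real_solution_derive m p0 p1 p2 x) as (E0 & _); fold Y in E0; der.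
    - intros x _; destruct (real_solution_derive m p0 p1 p2 x) as (E0 & E1 & E2).
      fold Y in E0, E1, E2; unfold s; eapply is_derive_eq; [der | cbv beta; ring]. }
  rewrite RInt_lin in E by apply solution_continuous.
  unfold s in E; rewrite HqT, I0, I2 in E; lra.
Qed.

(** Integration by parts of [U (L Y)']: the remaining integral vanishes because [L U1 = 0], and the
    boundary terms survive only through [U = um] and [U2 = b]. *)
Lemma momentum_jump (m p0 p1 p2 T um b : R) (U U1 U2 : R -> R) : 0 <= T -> q T = q 0 ->
  (forall x, is_derive U x (U1 x)) -> (forall x, is_derive U1 x (U2 x)) ->
  (forall x, is_derive U2 x (- q x * U1 x)) ->
  U 0 = um -> U T = um -> U1 0 = 0 -> U1 T = 0 -> U2 0 = b -> U2 T = b ->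
  let Y := real_solution m p0 p1 p2 in
  um * (Y 2%nat T + q 0 * Y 0%nat T - (p2 + q 0 * p0)) + b * (Y 0%nat T - p0) =
    - m * RInt (fun x => U x * Y 0%nat x) 0 T.
Proof.
  intros HT HqT D0 D1 D2 U00 U0T U10 U1T U20 U2T Y.
  destruct (real_solution_init m p0 p1 p2) as (I0 & I1 & I2).
  fold Y in I0, I1, I2.
  pose (s := fun x => U x * (Y 2%nat x + q x * Y 0%nat x) - U1 x * Y 1%nat x + U2 x * Y 0%nat x).
  assert (Cc : forall x, continuous (fun x => U x * Y 0%nat x) x).
  { intros x; eapply continuous_of_derive.
    destruct (real_solution_derive m p0 p1 p2 x) as (E0 & _); fold Y in E0; der. }
  assert (E : RInt (fun x => - m * (U x * Y 0%nat x) + 0 * (U x * Y 0%nat x)) 0 T = s T - s 0).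
  { apply integral_of_derive; [exact HT | |].
    - intros x; apply (continuous_plus (V := R_NormedModule));
        apply (continuous_scal_r (V := R_NormedModule)); apply Cc.
    - intros x _; destruct (real_solution_derive m p0 p1 p2 x) as (E0 & E1 & E2).
      fold Y in E0, E1, E2; unfold s; eapply is_derive_eq; [der | cbv beta; ring]. }
  rewrite (RInt_lin (- m) 0 (fun x => U x * Y 0%nat x) (fun x => U x * Y 0%nat x)) in E
    by exact Cc.
  unfold s in E; rewrite HqT, I0, I1, I2, U00, U0T, U10, U1T, U20, U2T in E; lra.
Qed.

End Monodromy.

(** * Expansion of the monodromy matrix *)

Section Trace.

Context (q dq : R -> R).
Context (qd : forall x, is_derive q x (dq x)) (dqc : forall x, continuous dq x).
Context (P : C -> nat -> nat -> R -> C).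
Context (P01 : forall mu j x, (j < 3)%nat -> is_Cderive (P mu 0%nat j) x (P mu 1%nat j x)).
Context (P12 : forall mu j x, (j < 3)%nat -> is_Cderive (P mu 1%nat j) x (P mu 2%nat j x)).
Context (P23 : forall mu j x, (j < 3)%nat -> is_Cderive (P mu 2%nat j) x
  (- (mu + RtoC (dq x)) * P mu 0%nat j x - RtoC (q x) * P mu 1%nat j x)%C).
Context (Pinit : forall mu i j, (i < 3)%nat -> (j < 3)%nat ->
  P mu i j 0 = if Nat.eqb i j then RtoC 1 else RtoC 0).
Context (T um b : R) (HT : 0 < T) (Hb : 0 < b) (HqT : q T = q 0).
Context (U U1 U2 : R -> R).
Context (DU : forall x, is_derive U x (U1 x)) (DU1 : forall x, is_derive U1 x (U2 x)).
Context (DU2 : forall x, is_derive U2 x (- q x * U1 x)).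
Context (U0 : U 0 = um) (UT : U T = um) (U10 : U1 0 = 0) (U1T : U1 T = 0)
  (U20 : U2 0 = b) (U2T : U2 T = b).

(** [v] is the derivative of the profile in the direction [(da, dE, dc)]. Its jump over a period is
    minus the derivative of the period times [u_x], which vanishes at [T] with slope [b]: hence
    [v T = v 0], while [- v1 T / b] is the derivative of the period. *)
Definition is_variation (da dE dc : R) (v v1 : R -> R) : Prop :=
  (forall x, is_derive v x (v1 x)) /\
  (forall x, 0 <= x -> is_derive v1 x (- q x * v x + da + dc * U x)) /\
  v 0 = - (da * um + dE + dc / 2 * um ^ 2) / b /\ v1 0 = 0 /\ v T = v 0.

(** Green's identity for the self-adjoint [L]; zero slopes at 0 and equal values at both ends reduce
    the boundary terms to the slopes at [T]. *)
Lemma variation_wronskian (da dE dc da' dE' dc' : R) (v v1 w w1 : R -> R) :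
  is_variation da dE dc v v1 -> is_variation da' dE' dc' w w1 ->
  da' * RInt v 0 T + dc' * RInt (fun x => U x * v x) 0 T
  - (da * RInt w 0 T + dc * RInt (fun x => U x * w x) 0 T)
  = v 0 * w1 T - w 0 * v1 T.
Proof.
  intros (Dv & Dv1 & _ & v10 & vT) (Dw & Dw1 & _ & w10 & wT).
  assert (Cv : forall x, continuous v x) by (intros; eapply continuous_of_derive, Dv).
  assert (Cw : forall x, continuous w x) by (intros; eapply continuous_of_derive, Dw).
  assert (CUv : forall x, continuous (fun x => U x * v x) x)
    by (intros; eapply continuous_of_derive; der).
  assert (CUw : forall x, continuous (fun x => U x * w x) x)
    by (intros; eapply continuous_of_derive; der).
  pose (g := fun x => da' * v x + dc' * (U x * v x)).
  pose (h := fun x => da * w x + dc * (U x * w x)).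
  assert (Cg : forall x, continuous g x)
    by (intros; unfold g; eapply continuous_of_derive; der).
  assert (Ch : forall x, continuous h x)
    by (intros; unfold h; eapply continuous_of_derive; der).
  assert (E : RInt (fun x => 1 * g x + (-1) * h x) 0 T
    = (v T * w1 T - w T * v1 T) - (v 0 * w1 0 - w 0 * v1 0)).
  { apply (integral_of_derive (fun x => v x * w1 x - w x * v1 x)); [lra | |].
    - intros x; eapply continuous_of_derive; unfold g, h; der.
    - intros x Hx; pose proof (Dv1 x ltac:(lra)); pose proof (Dw1 x ltac:(lra)).
      unfold g, h; eapply is_derive_eq; [der | cbv beta; ring]. }
  rewrite RInt_lin in E by assumption.
  unfold g, h in E; rewrite !RInt_lin in E by assumption.
  rewrite v10, w10, vT, wT in E; lra.
Qed.

Context (va va1 vE vE1 vc vc1 : R -> R).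
Context (Va : is_variation 1 0 0 va va1) (VE : is_variation 0 1 0 vE vE1)
  (Vc : is_variation 0 0 1 vc vc1).

(* Symmetry of the second derivatives of the action, whose gradient in (a, E, c)
   is (M, T, P / 2). *)
Lemma maxwell_relations :
  RInt vE 0 T = - va1 T / b - um * (- vE1 T / b) :> R /\
  RInt (fun x => U x * vE x) 0 T = - vc1 T / b - um ^ 2 / 2 * (- vE1 T / b) :> R /\
  RInt (fun x => U x * va x) 0 T - RInt vc 0 T
    = um * (- vc1 T / b) - um ^ 2 / 2 * (- va1 T / b).
Proof.
  pose proof (variation_wronskian _ _ _ _ _ _ _ _ _ _ VE Va) as E1.
  pose proof (variation_wronskian _ _ _ _ _ _ _ _ _ _ VE Vc) as E2.
  pose proof (variation_wronskian _ _ _ _ _ _ _ _ _ _ Va Vc) as E3.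
  destruct Va as (_ & _ & Ea & _), VE as (_ & _ & EE & _), Vc as (_ & _ & Ec & _).
  rewrite Ea, EE in E1; rewrite EE, Ec in E2; rewrite Ea, Ec in E3.
  assert (Alg : forall ma mE mc pa pE pc : R,
    1 * mE + 0 * pE - (0 * ma + 0 * pa)
      = - (0 * um + 1 + 0 / 2 * um ^ 2) / b * va1 T - - (1 * um + 0 + 0 / 2 * um ^ 2) / b * vE1 T ->
    0 * mE + 1 * pE - (0 * mc + 0 * pc)
      = - (0 * um + 1 + 0 / 2 * um ^ 2) / b * vc1 T - - (0 * um + 0 + 1 / 2 * um ^ 2) / b * vE1 T ->
    0 * ma + 1 * pa - (1 * mc + 0 * pc)
      = - (1 * um + 0 + 0 / 2 * um ^ 2) / b * vc1 T - - (0 * um + 0 + 1 / 2 * um ^ 2) / b * va1 T ->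
    mE = - va1 T / b - um * (- vE1 T / b) /\
    pE = - vc1 T / b - um ^ 2 / 2 * (- vE1 T / b) /\
    pa - mc = um * (- vc1 T / b) - um ^ 2 / 2 * (- va1 T / b)).
  { intros ma mE mc pa pE pc H1 H2 H3; split; [ | split].
    - transitivity (1 * mE + 0 * pE - (0 * ma + 0 * pa)); [ring | rewrite H1; field; lra].
    - transitivity (0 * mE + 1 * pE - (0 * mc + 0 * pc)); [ring | rewrite H2; field; lra].
    - transitivity (0 * ma + 1 * pa - (1 * mc + 0 * pc)); [ring | rewrite H3; field; lra]. }
  exact (Alg _ _ _ _ _ _ E1 E2 E3).
Qed.

Let r := real_part P.
Let Y := real_solution P.

Lemma U_continuous (x : R) : continuous U x.
Proof. eapply continuous_of_derive, DU. Qed.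

(** For [dc = 0] the variation solves the equation at [m = 0] exactly, so at [m] its residual is
    [m v], and the exact solution with the same data is within a multiple of [|m|]. *)
Lemma column_limits (da dE : R) (v v1 : R -> R) : is_variation da dE 0 v v1 ->
  let S := fun m => Y m (v 0) 0 (- q 0 * v 0 + da) in
  tends (fun m => S m 1%nat T) (v1 T) /\
  tends (fun m => RInt (S m 0%nat) 0 T) (RInt v 0 T) /\
  tends (fun m => RInt (fun x => U x * S m 0%nat x) 0 T) (RInt (fun x => U x * v x) 0 T).
Proof.
  intros (Dv & Dv1 & _ & v10 & _) S.
  assert (Cv : forall x, continuous v x) by (intros; eapply continuous_of_derive, Dv).
  destruct (bounded_on_segment v 0 T Cv) as [B [B0 HB]].
  destruct (bounded_on_segment U 0 T U_continuous) as [L [L0 HL]].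
  destruct (approximate_solution q dq qd dqc P P01 P12 P23 Pinit T ltac:(lra))
    as [K [K0 HK]].
  assert (A : forall m, Rabs m <= 1 -> forall x, 0 <= x <= T ->
    Rabs (S m 0%nat x - v x) <= K * (Rabs m * B) /\
    Rabs (S m 1%nat x - v1 x) <= K * (Rabs m * B)).
  { intros m Hm x Hx.
    pose (v2 := fun x => - q x * v x + da).
    assert (H := HK m (Rabs m * B) v v1 v2 (fun x => m * v x) Hm (fun x _ => Dv x)).
    rewrite v10 in H; unfold v2 at 2 in H; fold Y in H.
    destruct H with (x := x) as (H0 & H1 & _); [ | | | exact Hx | now split].
    - intros t Ht; eapply is_derive_eq; [now apply Dv1 | unfold v2; ring].
    - intros t Ht; unfold v2; eapply is_derive_eq; [der | cbv beta; ring].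
    - intros t Ht; rewrite Rabs_mult; apply Rmult_le_compat_l; [apply Rabs_pos | auto]. }
  assert (CS : forall m x, continuous (S m 0%nat) x)
    by (intros; apply (solution_continuous q dq P P01 P12 P23)).
  split; [ | split].
  - apply (tends_linear_error _ _ (K * B)); intros m _ Hm.
    destruct (A m Hm T) as [_ H]; [lra |].
    replace (K * B * Rabs m) with (K * (Rabs m * B)) by ring; exact H.
  - apply (tends_linear_error _ _ (T * (K * B))); intros m _ Hm.
    replace (T * (K * B) * Rabs m) with (T * (K * (Rabs m * B))) by ring.
    apply RInt_close; [lra | apply CS | exact Cv | intros; now apply A].
  - apply (tends_linear_error _ _ (T * (L * (K * B)))); intros m _ Hm.
    replace (T * (L * (K * B)) * Rabs m) with (T * (L * (K * (Rabs m * B)))) by ring.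
    apply RInt_close; [lra | | |].
    + intros x; apply (continuous_mult (K := R_AbsRing)); [apply U_continuous | apply CS].
    + intros x; apply (continuous_mult (K := R_AbsRing)); [apply U_continuous | apply Cv].
    + intros x Hx; replace (U x * S m 0%nat x - U x * v x) with (U x * (S m 0%nat x - v x)) by ring.
      rewrite Rabs_mult; apply Rmult_le_compat; try apply Rabs_pos; [now apply HL |].
      now apply A.
Qed.

(** The residual of [u_x - m u_c] is of order [m^2], and [u_x] itself contributes nothing: its slope
    returns to [b], and both [u_x] and [u u_x] integrate to 0 over a period. Division by [m]
    therefore leaves the terms of [u_c]. *)
Lemma translation_column_limits :
  let S := fun m => Y m (- m * vc 0) b (- m * (- q 0 * vc 0 + um)) in
  tends (fun m => (S m 1%nat T - b) / m) (- vc1 T) /\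
  tends (fun m => RInt (S m 0%nat) 0 T / m) (- RInt vc 0 T) /\
  tends (fun m => RInt (fun x => U x * S m 0%nat x) 0 T / m)
    (- RInt (fun x => U x * vc x) 0 T).
Proof.
  destruct Vc as (Dv & Dv1 & _ & v10 & _); intros S.
  assert (Cv : forall x, continuous vc x) by (intros; eapply continuous_of_derive, Dv).
  destruct (bounded_on_segment vc 0 T Cv) as [B [B0 HB]].
  destruct (bounded_on_segment U 0 T U_continuous) as [L [L0 HL]].
  destruct (approximate_solution q dq qd dqc P P01 P12 P23 Pinit T ltac:(lra))
    as [K [K0 HK]].
  assert (A : forall m, Rabs m <= 1 -> forall x, 0 <= x <= T ->
    Rabs (S m 0%nat x - (1 * U1 x + (- m) * vc x)) <= K * (Rabs m ^ 2 * B) /\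
    Rabs (S m 1%nat x - (U2 x - m * vc1 x)) <= K * (Rabs m ^ 2 * B)).
  { intros m Hm x Hx.
    pose (z0 := fun x => 1 * U1 x + (- m) * vc x).
    pose (z1 := fun x => U2 x - m * vc1 x).
    pose (z2 := fun x => - q x * U1 x - m * (- q x * vc x + U x)).
    assert (H := HK m (Rabs m ^ 2 * B) z0 z1 z2 (fun x => - m ^ 2 * vc x) Hm).
    replace (z0 0) with (- m * vc 0) in H by (unfold z0; rewrite U10; ring).
    replace (z1 0) with b in H by (unfold z1; rewrite U20, v10; ring).
    replace (z2 0) with (- m * (- q 0 * vc 0 + um)) in H
      by (unfold z2; rewrite U10, U0; ring).
    fold Y in H.
    destruct H with (x := x) as (H0 & H1 & _); [ | | | | exact Hx | now split].
    - intros t Ht; unfold z0, z1; eapply is_derive_eq; [der | cbv beta; ring].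
    - intros t Ht; pose proof (Dv1 t Ht).
      unfold z1, z2; eapply is_derive_eq; [der | cbv beta; ring].
    - intros t Ht; unfold z0, z1, z2; eapply is_derive_eq; [der | cbv beta; ring].
    - intros t Ht; rewrite Rabs_mult, Rabs_Ropp, <- RPow_abs.
      apply Rmult_le_compat_l; [apply pow_le, Rabs_pos | auto]. }
  assert (CS : forall m x, continuous (S m 0%nat) x)
    by (intros; apply (solution_continuous q dq P P01 P12 P23)).
  assert (CU1 : forall x, continuous U1 x) by (intros; eapply continuous_of_derive, DU1).
  assert (IU : RInt U1 0 T = 0 :> R).
  { rewrite (integral_of_derive U U1 T); auto; [ | lra]; rewrite UT, U0; apply Rminus_diag. }
  assert (CUU : forall x, continuous (fun x => U x * U1 x) x)
    by (intros; eapply continuous_of_derive; der).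
  assert (CUv : forall x, continuous (fun x => U x * vc x) x)
    by (intros; eapply continuous_of_derive; der).
  assert (IUU : RInt (fun x => U x * U1 x) 0 T = 0 :> R).
  { rewrite (integral_of_derive (fun x => / 2 * U x ^ 2) _ T); auto; [ | lra |].
    - rewrite UT, U0; ring.
    - intros; eapply is_derive_eq; [der | field]. }
  assert (Q : forall m x y K', m <> 0 -> Rabs (x + m * y) <= K' * Rabs m ^ 2 ->
    Rabs (x / m - - y) <= K' * Rabs m).
  { intros m x y K' Hm H; assert (0 < Rabs m) by (apply Rabs_pos_lt, Hm).
    replace (x / m - - y) with ((x + m * y) / m) by (field; exact Hm).
    rewrite Rabs_div by exact Hm; apply Rle_div_l; [assumption |].
    replace (K' * Rabs m * Rabs m) with (K' * Rabs m ^ 2) by ring; exact H. }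
  split; [ | split].
  - apply (tends_linear_error _ _ (K * B)); intros m Hn Hm; apply Q; [exact Hn |].
    destruct (A m Hm T) as [_ H]; [lra |]; rewrite U2T in H.
    replace (S m 1%nat T - b + m * vc1 T) with (S m 1%nat T - (b - m * vc1 T)) by ring.
    replace (K * B * Rabs m ^ 2) with (K * (Rabs m ^ 2 * B)) by ring; exact H.
  - apply (tends_linear_error _ _ (T * (K * B))); intros m Hn Hm; apply Q; [exact Hn |].
    replace (T * (K * B) * Rabs m ^ 2) with (T * (K * (Rabs m ^ 2 * B))) by ring.
    replace (RInt (S m 0%nat) 0 T + m * RInt vc 0 T)
      with (RInt (S m 0%nat) 0 T - (1 * RInt U1 0 T + (- m) * RInt vc 0 T))
      by (rewrite IU; ring).
    rewrite <- RInt_lin by assumption.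
    apply RInt_close; [lra | apply CS | | intros; now apply A].
    intros x; eapply continuous_of_derive; der.
  - apply (tends_linear_error _ _ (T * (L * (K * B)))); intros m Hn Hm; apply Q; [exact Hn |].
    replace (T * (L * (K * B)) * Rabs m ^ 2) with (T * (L * (K * (Rabs m ^ 2 * B)))) by ring.
    replace (RInt (fun x => U x * S m 0%nat x) 0 T + m * RInt (fun x => U x * vc x) 0 T)
      with (RInt (fun x => U x * S m 0%nat x) 0 T
        - (1 * RInt (fun x => U x * U1 x) 0 T + (- m) * RInt (fun x => U x * vc x) 0 T))
      by (rewrite IUU; ring).
    rewrite <- RInt_lin by assumption.
    apply RInt_close; [lra | | |].
    + intros x; apply (continuous_mult (K := R_AbsRing)); [apply U_continuous | apply CS].
    + intros x; eapply continuous_of_derive; der.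
    + intros x Hx.
      replace (U x * S m 0%nat x - (1 * (U x * U1 x) + - m * (U x * vc x)))
        with (U x * (S m 0%nat x - (1 * U1 x + - m * vc x))) by ring.
      rewrite Rabs_mult; apply Rmult_le_compat; try apply Rabs_pos; [now apply HL |].
      now apply A.
Qed.

(* Columns: initial data of solutions extending [u_x - m u_c], [u_a] and [u_E]. *)
Definition frame (m : R) (i j : nat) : R :=
  match i, j with
  | 0%nat, 0%nat => - m * vc 0 | 1%nat, 0%nat => b | _, 0%nat => - m * (- q 0 * vc 0 + um)
  | 0%nat, 1%nat => va 0 | 1%nat, 1%nat => 0 | _, 1%nat => - q 0 * va 0 + 1
  | 0%nat, _ => vE 0 | 1%nat, _ => 0 | _, _ => - q 0 * vE 0 + 0
  end.

(** The product of [M(m) - 1] with the frame, entry by entry. *)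
Let J (m : R) (i j : nat) : R := Y m (frame m 0 j) (frame m 1 j) (frame m 2 j) i T - frame m i j.

(* [M - 1] in the frame, for the monodromy matrix [M].  At [m = 0] the coordinates
   of [(y, y', y'')] along [u_x], [u_a], [u_E] are [y' / b], [y'' + q y] and
   [- um (y'' + q y) - b y]. *)
Definition frame_monodromy (m : R) (i j : nat) : R :=
  match i with
  | 0%nat => J m 1 j / b
  | 1%nat => J m 2 j + q 0 * J m 0 j + m * um * (J m 1 j / b)
  | _ => - (um * (J m 2 j + q 0 * J m 0 j) + b * J m 0 j) - m * um ^ 2 / 2 * (J m 1 j / b)
  end.

Lemma frame_similar (m : R) :
  e2_3 (shift3 (fun i j => r m i j T) (-1)) = e2_3 (frame_monodromy m) /\
  Rdet3 (shift3 (fun i j => r m i j T) (-1)) = Rdet3 (frame_monodromy m).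
Proof.
  destruct Va as (_ & _ & Ea & _), VE as (_ & _ & EE & _), Vc as (_ & _ & Ec & _).
  apply (similar3_invariants _ (frame m)).
  - unfold Rdet3, det3, frame; rewrite Ea, EE, Ec.
    (* The frame has determinant [-1] for every [m], because [b * vE 0 = -1]. *)
    replace (_ + _) with (-1); [lra | field; lra].
  - intros i j Hi Hj.
    (* With [S] the frame and [X] the matrix [frame_monodromy m], [J] is both [(M - 1) S] and
       [S X]. *)
    transitivity (J m i j).
    + unfold mul3, shift3, J, Y, real_solution, r.
      destruct i as [ | [ | [ | i]]]; [ | | | lia]; simpl; ring.
    + unfold mul3, frame_monodromy.
      destruct i as [ | [ | [ | i]]]; [ | | | lia];
        generalize (J m 0 j), (J m 1 j), (J m 2 j); intros j0 j1 j2;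
        unfold frame; rewrite ?Ea, ?EE, ?Ec; field; lra.
Qed.

(** Order of vanishing: the integrated identities give the last two rows a factor [m], and column 0
    has one more because [u_x] is periodic. Every term of the determinant then scales as [m^3] and
    every principal 2 by 2 minor as [m^2]. *)
Definition frame_scale (m : R) (i j : nat) : R :=
  (if Nat.eqb i 0 then 1 else m) * (if Nat.eqb j 0 then m else 1).

(** In terms of period, mass and momentum the columns are [(T_c, M_c, - P_c / 2)],
    [(- T_a, - M_a, P_a / 2)] and [(- T_E, - M_E, P_E / 2)]. *)
Definition frame_limit (i j : nat) : R :=
  let col v v1 := match i with
    | 0%nat => v1 T / b
    | 1%nat => - RInt v 0 T + um * (v1 T / b)
    | _ => RInt (fun x => U x * v x) 0 T - um ^ 2 / 2 * (v1 T / b) end in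
  match j with
  | 0%nat => - col vc vc1
  | 1%nat => col va va1
  | _ => col vE vE1
  end.

Lemma frame_tends (i j : nat) : (i < 3)%nat -> (j < 3)%nat ->
  tends (fun m => frame_monodromy m i j / frame_scale m i j) (frame_limit i j).
Proof.
  intros Hi Hj.
  assert (Hm := fun m => mass_jump q dq qd P P01 P12 P23 Pinit m
    (frame m 0 j) (frame m 1 j) (frame m 2 j) T ltac:(lra) HqT).
  assert (Hp := fun m => momentum_jump q dq qd P P01 P12 P23 Pinit m
    (frame m 0 j) (frame m 1 j) (frame m 2 j) T um b U U1 U2 ltac:(lra) HqT DU DU1 DU2
    U0 UT U10 U1T U20 U2T).
  fold Y in Hm, Hp; cbv zeta in Hm, Hp.
  set (I0 := (fun m => RInt (Y m (frame m 0 j) (frame m 1 j) (frame m 2 j) 0%nat) 0 T) : R -> R)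
    in Hm.
  set (I1 := (fun m =>
    RInt (fun x => U x * Y m (frame m 0 j) (frame m 1 j) (frame m 2 j) 0%nat x) 0 T) : R -> R)
    in Hp.
  set (y1 := fun m => Y m (frame m 0 j) (frame m 1 j) (frame m 2 j) 1%nat T - frame m 1 j).
  assert (R0 : forall m, frame_monodromy m 0 j = y1 m / b) by reflexivity.
  (* The jump identities exhibit the factor [m] of the last two rows exactly, before any limit is
     taken. *)
  assert (R1 : forall m, frame_monodromy m 1 j = - m * I0 m + m * um * (y1 m / b)).
  { intros m; specialize (Hm m); fold (I0 m) in Hm; rewrite <- Hm.
    unfold frame_monodromy, J, y1; ring. }
  assert (R2 : forall m, frame_monodromy m 2 j = m * I1 m - m * um ^ 2 / 2 * (y1 m / b)).
  { intros m; specialize (Hp m); fold (I1 m) in Hp.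
    replace (m * I1 m) with (- (- m * I1 m)) by ring; rewrite <- Hp.
    unfold frame_monodromy, J, y1; ring. }
  destruct j as [ | [ | [ | j]]]; [ | | | lia].
  - destruct translation_column_limits as (L1 & L2 & L3).
    change (tends (fun m => y1 m / m) (- vc1 T)) in L1.
    change (tends (fun m => I0 m / m) (- RInt vc 0 T)) in L2.
    change (tends (fun m => I1 m / m) (- RInt (fun x => U x * vc x) 0 T)) in L3.
    assert (L1' := tends_mult _ _ _ _ L1 (tends_const (/ b))).
    destruct i as [ | [ | [ | i]]]; [ | | | lia].
    + replace (frame_limit 0 0) with (- vc1 T * / b) by (unfold frame_limit; field; lra).
      refine (tends_ext _ _ _ _ L1'); intros m Hn.
      rewrite R0; unfold frame_scale; simpl; field; repeat split; (exact Hn || lra).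
    + replace (frame_limit 1 0) with (- - RInt vc 0 T + um * (- vc1 T * / b))
        by (unfold frame_limit; field; lra).
      refine (tends_ext _ _ _ _ (tends_plus _ _ _ _ (tends_opp _ _ L2)
        (tends_mult _ _ _ _ (tends_const um) L1'))); intros m Hn.
      rewrite R1; unfold frame_scale; simpl; field; repeat split; (exact Hn || lra).
    + replace (frame_limit 2 0)
        with (- RInt (fun x => U x * vc x) 0 T - um ^ 2 / 2 * (- vc1 T * / b))
        by (unfold frame_limit; field; lra).
      refine (tends_ext _ _ _ _ (tends_minus _ _ _ _ L3
        (tends_mult _ _ _ _ (tends_const (um ^ 2 / 2)) L1'))); intros m Hn.
      rewrite R2; unfold frame_scale; simpl; field; repeat split; (exact Hn || lra).
  - destruct (column_limits _ _ _ _ Va) as (L1 & L2 & L3).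
    assert (L1' : tends y1 (va1 T)).
    { refine (tends_ext _ _ _ _ L1); intros m _; unfold y1; simpl; ring. }
    assert (L1b := tends_mult _ _ _ _ L1' (tends_const (/ b))).
    change (tends I0 (RInt va 0 T)) in L2.
    change (tends I1 (RInt (fun x => U x * va x) 0 T)) in L3.
    destruct i as [ | [ | [ | i]]]; [ | | | lia].
    + refine (tends_ext _ _ _ _ L1b); intros m Hn.
      rewrite R0; unfold frame_scale; simpl; field; lra.
    + refine (tends_ext _ _ _ _ (tends_plus _ _ _ _ (tends_opp _ _ L2)
        (tends_mult _ _ _ _ (tends_const um) L1b))); intros m Hn.
      rewrite R1; unfold frame_scale; simpl; field; repeat split; (exact Hn || lra).
    + refine (tends_ext _ _ _ _ (tends_minus _ _ _ _ L3
        (tends_mult _ _ _ _ (tends_const (um ^ 2 / 2)) L1b))); intros m Hn.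
      rewrite R2; unfold frame_scale; simpl; field; repeat split; (exact Hn || lra).
  - destruct (column_limits _ _ _ _ VE) as (L1 & L2 & L3).
    assert (L1' : tends y1 (vE1 T)).
    { refine (tends_ext _ _ _ _ L1); intros m _; unfold y1; simpl; ring. }
    assert (L1b := tends_mult _ _ _ _ L1' (tends_const (/ b))).
    change (tends I0 (RInt vE 0 T)) in L2.
    change (tends I1 (RInt (fun x => U x * vE x) 0 T)) in L3.
    destruct i as [ | [ | [ | i]]]; [ | | | lia].
    + refine (tends_ext _ _ _ _ L1b); intros m Hn.
      rewrite R0; unfold frame_scale; simpl; field; lra.
    + refine (tends_ext _ _ _ _ (tends_plus _ _ _ _ (tends_opp _ _ L2)
        (tends_mult _ _ _ _ (tends_const um) L1b))); intros m Hn.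
      rewrite R1; unfold frame_scale; simpl; field; repeat split; (exact Hn || lra).
    + refine (tends_ext _ _ _ _ (tends_minus _ _ _ _ L3
        (tends_mult _ _ _ _ (tends_const (um ^ 2 / 2)) L1b))); intros m Hn.
      rewrite R2; unfold frame_scale; simpl; field; repeat split; (exact Hn || lra).
Qed.

Ltac tend :=
  lazymatch goal with
  | |- tends (fun h => @?f h + @?g h) _ => apply (tends_plus f g); [tend | tend]
  | |- tends (fun h => @?f h - @?g h) _ => apply (tends_minus f g); [tend | tend]
  | |- tends (fun h => @?f h * @?g h) _ => apply (tends_mult f g); [tend | tend]
  | |- _ => idtac
  end.

(** The third order expansions of [t] at [m] and [- m] are inserted into the two trace identities.
    Once [t 0 = 3] and [t1 0 = 0] are known, [t (- m) - 2 t m + 3] has leading coefficient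
    [- t2 0 / 2] at order 2, and [t m - t (- m)] has [t3 0 / 3] at order 3. *)
Lemma trace_derivatives (t t1 t2 t3 : R -> R) :
  (forall m, t m = tr3 (fun i j => r m i j T)) ->
  (forall m, is_derive t m (t1 m)) -> (forall m, is_derive t1 m (t2 m)) ->
  (forall m, is_derive t2 m (t3 m)) ->
  t2 0 = - 2 * e2_3 frame_limit /\ t3 0 = 3 * Rdet3 frame_limit.
Proof.
  intros Ht D1 D2 D3.
  pose (X := fun m i j => frame_monodromy m i j / frame_scale m i j).
  assert (HX : forall i j, (i < 3)%nat -> (j < 3)%nat -> tends (fun m => X m i j) (frame_limit i j))
    by (intros; now apply frame_tends).
  assert (Le : tends (fun m => e2_3 (X m)) (e2_3 frame_limit)).
  { unfold e2_3; tend; apply HX; lia. }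
  assert (Ld : tends (fun m => Rdet3 (X m)) (Rdet3 frame_limit)).
  { unfold Rdet3, det3; tend; apply HX; lia. }
  assert (Rel : forall m, m <> 0 ->
    t (- m) - 2 * t m + 3 = m ^ 2 * e2_3 (X m) /\ t m - t (- m) = m ^ 3 * Rdet3 (X m)).
  { intros m Hn.
    assert (Hd := real_part_det q dq qd dqc P P01 P12 P23 Pinit m T ltac:(lra)).
    assert (Ho := opposite_trace q dq qd dqc P P01 P12 P23 Pinit m T Hn ltac:(lra) HqT).
    destruct (frame_similar m) as [F1 F2].
    assert (G1 : e2_3 (frame_monodromy m) = m ^ 2 * e2_3 (X m)).
    { unfold X; generalize (frame_monodromy m); intros Z.
      unfold e2_3, frame_scale; simpl; field; exact Hn. }
    assert (G2 : Rdet3 (frame_monodromy m) = m ^ 3 * Rdet3 (X m)).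
    { unfold X; generalize (frame_monodromy m); intros Z.
      unfold Rdet3, det3, frame_scale; simpl; field; exact Hn. }
    rewrite <- G1, <- G2, <- F1, <- F2, !Ht, det3_shift.
    fold r in Hd, Ho; rewrite Ho, Hd.
    split; [unfold e2_3, tr3, shift3; simpl; ring | ring]. }
  (* As [m] tends to 0 the first identity becomes [3 - t 0 = 0]. *)
  assert (t0 : t 0 = 3).
  { assert (C1 : continuous t 0) by (eapply continuous_of_derive, D1).
    assert (C2 : continuous (fun m => t (- m) - 2 * t m + 3) 0).
    { assert (Dm : is_derive (fun m => t (- m)) 0 (- t1 0)).
      { eapply is_derive_eq.
        - apply (is_derive_comp t (fun m => - m)); [rewrite Ropp_0; apply D1 | der].
        - unfold scal; simpl; unfold mult; simpl; ring. }
      eapply continuous_of_derive; der. }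
    assert (L1 : tends (fun m => t (- m) - 2 * t m + 3) (t (- 0) - 2 * t 0 + 3)).
    { exact (tends_continuous _ C2). }
    assert (L2 : tends (fun m => t (- m) - 2 * t m + 3) (0 ^ 2 * e2_3 frame_limit)).
    { apply (tends_ext (fun m => m * m * e2_3 (X m))).
      - intros m Hn; rewrite (proj1 (Rel m Hn)); ring.
      - replace (0 ^ 2) with (0 * 0) by ring.
        apply tends_mult; [apply tends_mult; apply tends_id | exact Le]. }
    pose proof (tends_unique _ _ _ L1 L2) as E; rewrite Ropp_0 in E; lra. }
  pose (p := fun h => (t h - (t 0 + t1 0 * h + t2 0 / 2 * h ^ 2 + t3 0 / 6 * h ^ 3)) / h ^ 3).
  pose (n := fun h => (t (- h) - (t (- 0) + (- t1 (- 0)) * h + t2 (- 0) / 2 * h ^ 2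
    + (- t3 (- 0)) / 6 * h ^ 3)) / h ^ 3).
  assert (Lp : tends p 0) by now apply taylor3.
  assert (Ln : tends n 0).
  { apply (taylor3 (fun h => t (- h)) (fun h => - t1 (- h)) (fun h => t2 (- h))
      (fun h => - t3 (- h))); intros h.
    - eapply is_derive_eq.
      + apply (is_derive_comp t (fun h => - h)); [apply D1 | der].
      + unfold scal; simpl; unfold mult; simpl; ring.
    - eapply is_derive_eq.
      + apply is_derive_Ropp, (is_derive_comp t1 (fun h => - h)); [apply D2 | der].
      + unfold scal; simpl; unfold mult; simpl; ring.
    - eapply is_derive_eq.
      + apply (is_derive_comp t2 (fun h => - h)); [apply D3 | der].
      + unfold scal; simpl; unfold mult; simpl; ring. }
  assert (Hp : forall h, h <> 0 -> t h = t 0 + t1 0 * h + t2 0 / 2 * h ^ 2 + t3 0 / 6 * h ^ 3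
                                         + p h * h ^ 3)
    by (intros h Hh; unfold p; field; exact Hh).
  assert (Hn : forall h, h <> 0 -> t (- h) = t 0 - t1 0 * h + t2 0 / 2 * h ^ 2
                                         - t3 0 / 6 * h ^ 3 + n h * h ^ 3)
    by (intros h Hh; unfold n; rewrite Ropp_0; field; exact Hh).
  (* The difference [t m - t (- m)] is of order [m^3], so its linear coefficient [2 t1 0]
     vanishes. *)
  assert (Z1 : t1 0 = 0).
  { assert (L : tends (fun m => m * m * (Rdet3 (X m) - t3 0 / 3 - p m + n m) * / 2) (t1 0)).
    { apply (tends_ext (fun _ => t1 0)); [ | apply tends_const].
      intros m Hm; destruct (Rel m Hm) as [_ E]; rewrite (Hp m Hm), (Hn m Hm) in E.
      apply Rmult_eq_reg_l with (2 * m); [ | lra].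
      transitivity (m ^ 3 * Rdet3 (X m) - m ^ 3 * (t3 0 / 3 + p m - n m));
        [rewrite <- E; field | field]. }
    assert (L' : tends (fun m => m * m * (Rdet3 (X m) - t3 0 / 3 - p m + n m) * / 2)
      (0 * 0 * (Rdet3 frame_limit - t3 0 / 3 - 0 + 0) * / 2)).
    { tend; first [apply tends_id | exact Ld | exact Lp | exact Ln | apply tends_const]. }
    rewrite (tends_unique _ _ _ L L'); ring. }
  split.
  - assert (L : tends (fun m => e2_3 (X m) + m * (t3 0 / 2 + 2 * p m - n m)) (- t2 0 / 2)).
    { apply (tends_ext (fun _ => - t2 0 / 2)); [ | apply tends_const].
      intros m Hm; destruct (Rel m Hm) as [E _]; rewrite (Hp m Hm), (Hn m Hm), t0, Z1 in E.
      apply Rmult_eq_reg_l with (m ^ 2); [ | now apply pow_nonzero].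
      rewrite Rmult_plus_distr_l, <- E; field. }
    assert (L' : tends (fun m => e2_3 (X m) + m * (t3 0 / 2 + 2 * p m - n m))
      (e2_3 frame_limit + 0 * (t3 0 / 2 + 2 * 0 - 0))).
    { tend; first [apply tends_id | exact Le | exact Lp | exact Ln | apply tends_const]. }
    pose proof (tends_unique _ _ _ L L'); lra.
  - assert (L : tends (fun m => Rdet3 (X m) - p m + n m) (t3 0 / 3)).
    { apply (tends_ext (fun _ => t3 0 / 3)); [ | apply tends_const].
      intros m Hm; destruct (Rel m Hm) as [_ E]; rewrite (Hp m Hm), (Hn m Hm), Z1 in E.
      apply Rmult_eq_reg_l with (m ^ 3); [ | now apply pow_nonzero].
      transitivity (m ^ 3 * Rdet3 (X m) - m ^ 3 * (p m - n m)); [rewrite <- E; field | ring]. }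
    assert (L' : tends (fun m => Rdet3 (X m) - p m + n m) (Rdet3 frame_limit - 0 + 0)).
    { apply tends_plus; [ | exact Ln]; now apply tends_minus. }
    pose proof (tends_unique _ _ _ L L'); lra.
Qed.

End Trace.

(** * Partial derivatives, entries of the fundamental matrix, and conclusion *)

Lemma locally_path (a E c da dE dc : R) (Q : R * R * R -> Prop) :
  locally (a, E, c) Q -> locally 0 (fun h => Q (a + h * da, E + h * dE, c + h * dc)).
Proof.
  intros [eps HQ]; apply locally_R; set (k := Rabs da + Rabs dE + Rabs dc + 1).
  pose proof (Rabs_pos da); pose proof (Rabs_pos dE); pose proof (Rabs_pos dc).
  assert (Hk : 0 < k) by (unfold k; lra). assert (He := cond_pos eps).
  exists (eps / k); split; [now apply Rdiv_lt_0_compat |]; intros h Hh.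
  rewrite Rminus_0_r in Hh; apply Rlt_div_r in Hh; [ | exact Hk].
  assert (B : forall x d, Rabs d <= k -> ball x eps (x + h * d)).
  { intros x d Hd; change (Rabs (x + h * d - x) < eps).
    replace (x + h * d - x) with (h * d) by ring; rewrite Rabs_mult.
    apply Rle_lt_trans with (Rabs h * k); [ | exact Hh].
    apply Rmult_le_compat_l; [apply Rabs_pos | exact Hd]. }
  apply HQ; split; [split |]; simpl; apply B; unfold k; lra.
Qed.

Lemma directional_partials (g : R -> R -> R -> R) (a E c l : R) :
  (is_derive (fun h => g (a + h * 1) (E + h * 0) (c + h * 0)) 0 l -> d_a g a E c = l) /\
  (is_derive (fun h => g (a + h * 0) (E + h * 1) (c + h * 0)) 0 l -> d_E g a E c = l) /\
  (is_derive (fun h => g (a + h * 0) (E + h * 0) (c + h * 1)) 0 l -> d_c g a E c = l).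
Proof.
  assert (S : forall (p : R -> R) x, is_derive p 0 l -> is_derive (fun t => p (t - x)) x l).
  { intros p x Hp; eapply is_derive_eq.
    - apply (is_derive_comp p (fun t => t - x)); [ | der].
      rewrite Rminus_diag; exact Hp.
    - unfold scal; simpl; unfold mult; simpl; ring. }
  split; [ | split]; intros H; apply is_derive_unique; (eapply is_derive_ext; [ | apply S, H]);
    intros t; simpl; f_equal; ring.
Qed.

Lemma real_stability_index (x y : R) :
  (RtoC (/ 2) * RtoC x ^ 3 - RtoC 3 * RtoC y ^ 2)%C = RtoC (/ 2 * x ^ 3 - 3 * y ^ 2).
Proof. apply injective_projections; simpl; ring. Qed.

Section Fundamental.

Context (f : R -> R) (c : R) (u : R -> R) (Phi : C -> R -> @matrix C 3 3).
Context (fundamental : forall mu : C, is_fundamental_matrix f c u mu (Phi mu)).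

(** Row [k] holds the [k]-th derivative of the scalar solution in column [j]. *)
Definition entry (mu : C) (k j : nat) (x : R) : C :=
  @coeff_mat C 3 3 (zero : C_AbelianMonoid) (Phi mu x) k j.

Definition coefficient_derivative (x : R) : R := Derive u x * Derive_n f 2 (u x).

Lemma entry_init (mu : C) (i j : nat) : (i < 3)%nat -> (j < 3)%nat ->
  entry mu i j 0 = if Nat.eqb i j then RtoC 1 else RtoC 0.
Proof.
  intros Hi Hj; unfold entry; destruct (fundamental mu) as [-> _].
  destruct i as [ | [ | [ | i]]]; [ | | | lia];
    (destruct j as [ | [ | [ | j]]]; [ | | | lia]); reflexivity.
Qed.

Lemma entry_derive (mu : C) (j : nat) (x : R) : (j < 3)%nat ->
  is_Cderive (entry mu 0 j) x (entry mu 1 j x) /\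
  is_Cderive (entry mu 1 j) x (entry mu 2 j x) /\
  is_Cderive (entry mu 2 j) x (- (mu + RtoC (coefficient_derivative x)) * entry mu 0 j x
    - RtoC (linear_coefficient f c u x) * entry mu 1 j x)%C.
Proof.
  intros Hj; destruct (fundamental mu) as [_ H].
  assert (D : forall i, (i < 3)%nat -> is_Cderive (entry mu i j) x
    (coeff_mat (zero : C) (spectral_matrix f c u mu x) i 0 * entry mu 0 j x
     + coeff_mat (zero : C) (spectral_matrix f c u mu x) i 1 * entry mu 1 j x
     + coeff_mat (zero : C) (spectral_matrix f c u mu x) i 2 * entry mu 2 j x)%C).
  { intros i Hi; eapply is_Cderive_eq; [exact (is_derive_C _ _ _ (H x i j Hi Hj)) |].
    unfold Mmult; etransitivity; [exact (coeff_mat_bij _ _ i j Hi Hj) |].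
    simpl Nat.pred; rewrite !sum_Sn, sum_O; reflexivity. }
  split; [ | split].
  - eapply is_Cderive_eq; [apply (D 0%nat); lia |].
    change (RtoC 0 * entry mu 0 j x + RtoC 1 * entry mu 1 j x + RtoC 0 * entry mu 2 j x
      = entry mu 1 j x)%C; ring.
  - eapply is_Cderive_eq; [apply (D 1%nat); lia |].
    change (RtoC 0 * entry mu 0 j x + RtoC 0 * entry mu 1 j x + RtoC 1 * entry mu 2 j x
      = entry mu 2 j x)%C; ring.
  - eapply is_Cderive_eq; [apply (D 2%nat); lia |].
    change ((- mu - RtoC (Derive u x * Derive_n f 2 (u x))) * entry mu 0 j x
      + RtoC (- Derive f (u x) + c) * entry mu 1 j x + RtoC 0 * entry mu 2 j x
      = - (mu + RtoC (coefficient_derivative x)) * entry mu 0 j x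
        - RtoC (linear_coefficient f c u x) * entry mu 1 j x)%C.
    unfold linear_coefficient, coefficient_derivative.
    rewrite RtoC_plus, RtoC_opp, RtoC_minus; ring.
Qed.

End Fundamental.

(** At [mu = 0] the third order equation says that [L e] is constant, and the initial second
    derivative [q 0 / b] makes this constant 0: the fundamental matrix supplies the solution of the
    second order equation. *)
Lemma energy_variation_exists (f F : R -> R) (a E c um up : R) (u : R -> R)
    (Phi : C -> R -> @matrix C 3 3) :
  is_C2 f -> (forall v, is_derive F v (f v)) ->
  is_well F a E c um up -> is_profile f F a E c um u ->
  (forall mu : C, is_fundamental_matrix f c u mu (Phi mu)) ->
  (forall x, is_derive (linear_coefficient f c u) x (coefficient_derivative f u x)) ->
  exists e e1, is_energy_variation (a - f um + c * um) (linear_coefficient f c u) e e1.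
Proof.
  intros Hf HF W O Hfund Dq.
  pose proof (well_curvature_pos f F a E c um up HF W) as Hb.
  set (b := a - f um + c * um) in *; set (q := linear_coefficient f c u) in *.
  set (dq := coefficient_derivative f u) in *.
  pose (P := entry Phi).
  assert (H01 := fun mu j x Hj => proj1 (entry_derive f c u Phi Hfund mu j x Hj)).
  assert (H12 := fun mu j x Hj => proj1 (proj2 (entry_derive f c u Phi Hfund mu j x Hj))).
  assert (H23 := fun mu j x Hj => proj2 (proj2 (entry_derive f c u Phi Hfund mu j x Hj))).
  pose (Y := real_solution P 0 (- / b) 0 (q 0 * / b)).
  assert (D : forall x, is_derive (Y 0%nat) x (Y 1%nat x) /\
    is_derive (Y 1%nat) x (Y 2%nat x) /\
    is_derive (Y 2%nat) x (- (0 + dq x) * Y 0%nat x - q x * Y 1%nat x))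
    by exact (real_solution_derive q dq P H01 H12 H23 0 (- / b) 0 (q 0 * / b)).
  assert (I := real_solution_init P (entry_init f c u Phi Hfund) 0 (- / b) 0 (q 0 * / b)).
  fold Y in I; destruct I as (I0 & I1 & I2).
  exists (Y 0%nat), (Y 1%nat); split; [exact (fun x => proj1 (D x)) | split; [ | now split]].
  intros x; eapply is_derive_eq; [exact (proj1 (proj2 (D x))) |].
  assert (K : Y 2%nat x + q x * Y 0%nat x = Y 2%nat 0 + q 0 * Y 0%nat 0).
  { apply (zero_derive_const (fun x => Y 2%nat x + q x * Y 0%nat x)); intros t.
    destruct (D t) as (D0 & D1 & D2); specialize (Dq t).
    eapply is_derive_eq; [der | cbv beta; ring]. }
  rewrite I0, I2 in K; lra.
Qed.

Section Main.

Context (f F : R -> R) (u_minus u_plus : R -> R -> R -> R) (u : R -> R -> R -> R -> R).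
Context (a E c : R) (f_C2 : is_C2 f) (F_primitive : forall v, is_derive F v (f v)).
Context (roots : is_root_branch F u_minus u_plus a E c).
Context (profiles : is_profile_family f F u_minus u a E c).

Let T := period F u_minus u_plus.
Let um := u_minus a E c.
Let U := u a E c.
Let b := a - f um + c * um.
Let q := linear_coefficient f c U.

Context (e e1 : R -> R) (He : is_energy_variation b q e e1).

Lemma base_point :
  is_well F a E c um (u_plus a E c) /\ is_profile f F a E c um U /\
  is_half_period U (u_plus a E c) (T a E c / 2) /\ U (T a E c) = um /\
  Derive U (T a E c) = 0.
Proof.
  assert (W := locally_singleton _ _ (proj1 roots)).
  assert (O := locally_singleton _ _ profiles); cbv beta iota in W, O.
  split; [exact W | split; [exact O |]].
  exact (period_spec f F u_minus u_plus a E c U f_C2 F_primitive W O).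
Qed.

Lemma coefficient_derive (x : R) : is_derive q x (coefficient_derivative f U x).
Proof.
  destruct base_point as (_ & O & _).
  pose proof (profile_derive f F a E c um U O x) as D.
  unfold q, linear_coefficient.
  assert (is_derive (fun t => Derive f (U t)) x (Derive_n f 2 (U x) * Derive U x)).
  { eapply is_derive_eq;
      [apply (is_derive_comp (Derive f) U); [now apply C2_derive2 | exact D] |].
    unfold scal; simpl; unfold mult; simpl; ring. }
  eapply is_derive_eq; [der | unfold coefficient_derivative; ring].
Qed.

Lemma coefficient_derive_continuous (x : R) : continuous (coefficient_derivative f U) x.
Proof.
  destruct base_point as (_ & O & _).
  apply (continuous_mult (K := R_AbsRing)).
  - eapply continuous_of_derive, profile_derive2, O.
  - apply (continuous_comp U (Derive_n f 2)); [ | apply f_C2].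
    eapply continuous_of_derive, profile_derive, O.
Qed.

Lemma directional_derivatives (da dE dc : R) :
  let w := variation U e da dE dc in
  let w1 := variation1 f U e e1 a c da dE dc in
  is_derive (fun h => T (a + h * da) (E + h * dE) (c + h * dc)) 0 (- w1 (T a E c) / b) /\
  is_derive (fun h => mass T u (a + h * da) (E + h * dE) (c + h * dc)) 0
    (um * (- w1 (T a E c) / b) + RInt w 0 (T a E c)) /\
  is_derive (fun h => momentum T u (a + h * da) (E + h * dE) (c + h * dc)) 0
    (um ^ 2 * (- w1 (T a E c) / b) + 2 * RInt (fun x => U x * w x) 0 (T a E c)) /\
  is_variation q (T a E c) um b U da dE dc w w1.
Proof.
  intros w w1; destruct base_point as (W & O & HP & HT & HT1).
  destruct roots as (R1 & R2 & R3).
  assert (Z : a + 0 * da = a /\ E + 0 * dE = E /\ c + 0 * dc = c) by (repeat split; ring).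
  destruct Z as (Za & ZE & Zc).
  set (vh := fun h => u_minus (a + h * da) (E + h * dE) (c + h * dc)).
  set (wh := fun h => u_plus (a + h * da) (E + h * dE) (c + h * dc)).
  set (uh := fun h => u (a + h * da) (E + h * dE) (c + h * dc)).
  set (Th := fun h => T (a + h * da) (E + h * dE) (c + h * dc)).
  assert (v0 : vh 0 = um) by (unfold vh; now rewrite Za, ZE, Zc).
  assert (w0 : wh 0 = u_plus a E c) by (unfold wh; now rewrite Za, ZE, Zc).
  assert (T0 : Th 0 = T a E c) by (unfold Th; now rewrite Za, ZE, Zc).
  assert (vc : continuous vh 0).
  { intros Q HQ; rewrite v0 in HQ; exact (locally_path a E c da dE dc _ (R2 Q HQ)). }
  assert (wc : continuous wh 0).
  { intros Q HQ; rewrite w0 in HQ; exact (locally_path a E c da dE dc _ (R3 Q HQ)). }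
  assert (HW : locally 0 (fun h =>
    is_well F (a + h * da) (E + h * dE) (c + h * dc) (vh h) (wh h) /\
    is_profile f F (a + h * da) (E + h * dE) (c + h * dc) (vh h) (uh h))).
  { exact (filter_and _ _ (locally_path a E c da dE dc _ R1)
      (locally_path a E c da dE dc _ profiles)). }
  assert (Hhp : locally 0 (fun h =>
    is_half_period (uh h) (wh h) (Th h / 2) /\ Derive (uh h) (Th h) = 0)).
  { revert HW; apply filter_imp; intros h [W' O'].
    destruct (period_spec f F u_minus u_plus _ _ _ (uh h) f_C2 F_primitive W' O')
      as (H1 & _ & H2); now split. }
  assert (HP0 : is_half_period U (u_plus a E c) (Th 0 / 2) /\ U (Th 0) = um /\
    Derive U (Th 0) = 0) by (now rewrite T0).
  destruct (family_derivatives f F a E c um (u_plus a E c) U da dE dc f_C2 F_primitive W O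
    e e1 He vh wh Th uh HW v0 vc w0 wc Hhp HP0) as (D1 & D2 & D3).
  rewrite T0 in D1, D2, D3.
  assert (Dw : forall x, is_derive w x (w1 x))
    by exact (variation_derive f F a E c um U da dE dc O e e1 He).
  assert (CU := profile_derive f F a E c um U O).
  assert (Cw : forall x, continuous (fun x => U x * w x) x)
    by (intros; eapply continuous_of_derive; der).
  split; [exact D1 | split; [exact D2 | split]].
  - eapply is_derive_eq; [exact D3 |].
    assert (I : RInt (fun x => 2 * (U x * w x) + 0 * (U x * w x)) 0 (T a E c)
      = 2 * RInt (fun x => U x * w x) 0 (T a E c) + 0 * RInt (fun x => U x * w x) 0 (T a E c))
      by (apply RInt_lin; exact Cw).
    assert (Alg : forall A : R, 2 * A + 0 * A = 2 * A) by (intros; ring).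
    apply Rplus_eq_compat_l; rewrite <- Alg; refine (eq_trans _ I).
    assert (Alg' : forall p r : R, 2 * p * r = 2 * (p * r) + 0 * (p * r)) by (intros; ring).
    apply RInt_ext; intros x _; exact (Alg' (U x) (w x)).
  - destruct (variation_start f F a E c um (u_plus a E c) U da dE dc F_primitive W O e e1 He)
      as [S0 S1].
    split; [exact Dw | split; [ | split; [exact S0 | split; [exact S1 |]]]].
    + exact (variation_derive2 f F a E c um (u_plus a E c) U da dE dc f_C2 F_primitive W O
        e e1 He).
    (* At [T] the velocity vanishes, so the Wronskian gives [e T = - / b], and only the first term
       of [variation] remains, with its value at 0. *)
    + pose proof (well_curvature_pos f F a E c um (u_plus a E c) F_primitive W) as Hb; fold b in Hb.
      destruct HP as (Hpos & _).
      pose proof (energy_wronskian f F a E c um (u_plus a E c) U f_C2 F_primitive W O e e1 He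
        (T a E c) ltac:(lra)) as Wr.
      rewrite HT1, HT in Wr; fold b in Wr.
      unfold w at 2; rewrite S0; unfold w, variation; rewrite HT1, HT.
      replace (e (T a E c)) with (- / b); [fold b; field; lra |].
      apply Rmult_eq_reg_l with (- b); [ | lra].
      transitivity 1; [field; lra | lra].
Qed.

End Main.

Theorem theorem3 (f F : R -> R)
    (u_minus u_plus : R -> R -> R -> R) (u : R -> R -> R -> R -> R)
    (a E c : R) (Phi : C -> R -> @matrix C 3 3)
    (f_C2 : is_C2 f)
    (F_primitive : forall v, is_derive F v (f v))
    (roots : is_root_branch F u_minus u_plus a E c)
    (profiles : is_profile_family f F u_minus u a E c)
    (fundamental : forall mu : C,
        is_fundamental_matrix f c (u a E c) mu (Phi mu)) :
  let T := period F u_minus u_plus in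
  let M := mass T u in
  let P := momentum T u in
  let monodromy := fun mu : C => Phi mu (T a E c) in
  (d_a T a E c <> 0 \/ d_E T a E c <> 0) ->
  exists M_mu M_mumu M_mumumu : C -> @matrix C 3 3,
    is_mu_derivative monodromy M_mu /\
    is_mu_derivative M_mu M_mumu /\
    is_mu_derivative M_mumu M_mumumu /\
    mat_trace (M_mumu (RtoC 0)) =
      RtoC (jacobian2 d_E d_c T P a E c + 2 * jacobian2 d_a d_E M P a E c) /\
    mat_trace (M_mumumu (RtoC 0)) =
      RtoC (- (3 / 2) * jacobian3 d_a d_E d_c T M P a E c) /\
    stability_index (M_mumu (RtoC 0)) (M_mumumu (RtoC 0)) =
      RtoC (/ 2 * (jacobian2 d_E d_c T P a E c
                   + 2 * jacobian2 d_a d_E M P a E c) ^ 3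
            - 3 * (3 / 2 * jacobian3 d_a d_E d_c T M P a E c) ^ 2).
Proof.
  intros T M P monodromy _.
  destruct (base_point f F u_minus u_plus u a E c f_C2 F_primitive roots profiles)
    as (W & O & HP & HT & HT1).
  fold T in HP, HT, HT1.
  set (um := u_minus a E c) in *; set (U := u a E c) in *.
  set (tau := T a E c) in *.
  set (b := a - f um + c * um); set (q := linear_coefficient f c U).
  set (dq := coefficient_derivative f U).
  assert (Hb : 0 < b) by exact (well_curvature_pos f F a E c um _ F_primitive W).
  assert (Hq : forall x, is_derive q x (dq x)) by
    exact (coefficient_derive f F u_minus u_plus u a E c f_C2 F_primitive roots profiles).
  assert (Hdq : forall x, continuous dq x) by
    exact (coefficient_derive_continuous f F u_minus u_plus u a E c f_C2 F_primitive
      roots profiles).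
  assert (Htau : 0 < tau) by (destruct HP as (H & _); lra).
  assert (HqT : q tau = q 0).
  { destruct (profile_start f F a E c um U O) as [S0 _].
    unfold q, linear_coefficient; now rewrite HT, S0. }
  destruct (energy_variation_exists f F a E c um _ U Phi f_C2 F_primitive W O fundamental Hq)
    as (e & e1 & He); fold b q in He.
  pose (G := entry Phi).
  assert (H01 := fun mu j x Hj => proj1 (entry_derive f c U Phi fundamental mu j x Hj)).
  assert (H12 := fun mu j x Hj => proj1 (proj2 (entry_derive f c U Phi fundamental mu j x Hj))).
  assert (H23 := fun mu j x Hj => proj2 (proj2 (entry_derive f c U Phi fundamental mu j x Hj))).
  assert (Hi := entry_init f c U Phi fundamental).
  fold G dq q in H01, H12, H23, Hi.
  destruct (monodromy_expansions q dq Hq Hdq G H01 H12 H23 Hi tau ltac:(lra))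
    as (Y1 & Y2 & Y3 & HY).
  pose (mat := fun (Y : nat -> nat -> C -> R -> C) mu =>
    mk_matrix 3 3 (fun i j => Y i j mu tau) : @matrix C 3 3).
  assert (Hmat : forall Y Z : nat -> nat -> C -> R -> C,
    (forall i j, (i < 3)%nat -> (j < 3)%nat -> is_expansion tau (Y i j) (Z i j)) ->
    is_mu_derivative (mat Y) (mat Z)).
  { intros Y Z H mu i j Hi' Hj'.
    unfold mat; rewrite coeff_mat_bij by assumption.
    eapply is_derive_ext; [intros m; symmetry; exact (coeff_mat_bij _ _ i j Hi' Hj') |].
    apply (expansion_derive tau); [lra | now apply H]. }
  assert (Htr : forall Y mu, mat_trace (mat Y mu) =
    (Y 0%nat 0%nat mu tau + Y 1%nat 1%nat mu tau + Y 2%nat 2%nat mu tau)%C).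
  { intros Y mu; unfold mat_trace; simpl Nat.pred; rewrite !sum_Sn, sum_O; reflexivity. }
  pose (tr := fun (Y : nat -> nat -> C -> R -> C) m =>
    (Y 0%nat 0%nat (RtoC m) tau + Y 1%nat 1%nat (RtoC m) tau + Y 2%nat 2%nat (RtoC m) tau)%C).
  assert (Dtr : forall Y Z : nat -> nat -> C -> R -> C,
    (forall i j, (i < 3)%nat -> (j < 3)%nat -> is_expansion tau (Y i j) (Z i j)) ->
    forall m, is_Cderive (tr Y) m (tr Z m)).
  { intros Y Z H m; unfold tr; repeat apply is_Cderive_plus;
      (apply (expansion_Cderive tau); [lra | apply H; lia]). }
  pose (Y0 := fun k j mu => G mu k j).
  assert (E0 := Dtr Y0 Y1 (fun i j Hi' Hj' => proj1 (HY i j Hi' Hj'))).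
  assert (E1 := Dtr Y1 Y2 (fun i j Hi' Hj' => proj1 (proj2 (HY i j Hi' Hj')))).
  assert (E2 := Dtr Y2 Y3 (fun i j Hi' Hj' => proj2 (proj2 (HY i j Hi' Hj')))).
  (* The derivative along the real axis of a real-valued function is real, so the traces are
     determined by their real parts. *)
  assert (Zero : forall y y' : R -> C, (forall m, snd (y m) = 0) ->
    (forall m, is_Cderive y m (y' m)) -> forall m, snd (y' m) = 0).
  { intros y y' Hy Dy m; destruct (Dy m) as [_ D].
    apply (is_derive_ext _ (fun _ => 0)) in D; [ | exact Hy].
    rewrite <- (is_derive_unique _ _ _ D); apply Derive_const. }
  assert (I0 : forall m, snd (tr Y0 m) = 0).
  { intros m; unfold tr, Y0.
    rewrite !(real_on_axis q dq Hq Hdq G H01 H12 H23 Hi) by (lia || lra); simpl; ring. }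
  assert (I1 := Zero _ _ I0 E0); assert (I2 := Zero _ _ I1 E1); assert (I3 := Zero _ _ I2 E2).
  destruct (directional_derivatives f F u_minus u_plus u a E c f_C2 F_primitive roots profiles
    e e1 He 1 0 0) as (Ta & Ma & Pa & Va).
  destruct (directional_derivatives f F u_minus u_plus u a E c f_C2 F_primitive roots profiles
    e e1 He 0 1 0) as (TE & ME & PE & VE).
  destruct (directional_derivatives f F u_minus u_plus u a E c f_C2 F_primitive roots profiles
    e e1 He 0 0 1) as (Tc & Mc & Pc & Vc).
  fold T in Ta, Ma, Pa, Va, TE, ME, PE, VE, Tc, Mc, Pc, Vc.
  fold M in Ma, ME, Mc; fold P in Pa, PE, Pc.
  apply (proj1 (directional_partials T a E c _)) in Ta.
  apply (proj1 (directional_partials M a E c _)) in Ma.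
  apply (proj1 (directional_partials P a E c _)) in Pa.
  apply (proj1 (proj2 (directional_partials T a E c _))) in TE.
  apply (proj1 (proj2 (directional_partials M a E c _))) in ME.
  apply (proj1 (proj2 (directional_partials P a E c _))) in PE.
  apply (proj2 (proj2 (directional_partials T a E c _))) in Tc.
  apply (proj2 (proj2 (directional_partials M a E c _))) in Mc.
  apply (proj2 (proj2 (directional_partials P a E c _))) in Pc.
  fold um U tau q b in Ta, Ma, Pa, Va, TE, ME, PE, VE, Tc, Mc, Pc, Vc.
  set (va := variation U e 1 0 0) in *; set (va1 := variation1 f U e e1 a c 1 0 0) in *.
  set (vE := variation U e 0 1 0) in *; set (vE1 := variation1 f U e e1 a c 0 1 0) in *.
  set (vc := variation U e 0 0 1) in *; set (vc1 := variation1 f U e e1 a c 0 0 1) in *.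
  pose proof (profile_start f F a E c um U O) as [S0 S1].
  pose (U2 := fun x => a - f (U x) + c * U x).
  assert (D0 : forall x, is_derive U x (Derive U x)) by exact (profile_derive f F a E c um U O).
  assert (D1 : forall x, is_derive (Derive U) x (U2 x))
    by exact (profile_derive2 f F a E c um U O).
  assert (D2 : forall x, is_derive U2 x (- q x * Derive U x))
    by exact (profile_derive3 f F a E c um U f_C2 O).
  assert (B0 : U2 0 = b) by (unfold U2; now rewrite S0).
  assert (BT : U2 tau = b) by (unfold U2; now rewrite HT).
  destruct (trace_derivatives q dq Hq Hdq G H01 H12 H23 Hi tau um b Htau Hb HqT
    U (Derive U) U2 D0 D1 D2 S0 HT S1 HT1 B0 BT va va1 vE vE1 vc vc1 Va VE Vc
    (fun m => fst (tr Y0 m)) (fun m => fst (tr Y1 m)) (fun m => fst (tr Y2 m))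
    (fun m => fst (tr Y3 m)) (fun m => eq_refl) (fun m => proj1 (E0 m))
    (fun m => proj1 (E1 m)) (fun m => proj1 (E2 m))) as [R2 R3].
  destruct (maxwell_relations q tau um b Htau Hb U (Derive U) D0 va va1 vE vE1 vc vc1 Va VE Vc)
    as (X1 & X2 & X3).
  assert (X3' : RInt (fun x => U x * va x) 0 tau = RInt vc 0 tau
      + (um * (- vc1 tau / b) - um ^ 2 / 2 * (- va1 tau / b)) :> R)
    by (rewrite <- X3; exact (eq_sym (Rplus_minus _ _))).
  (* [e2_3] contains [T_a M_c - T_c M_a], which the Maxwell relations turn into
     [(M_E P_a - M_a P_E) / 2], a second copy of a minor already present; hence the factor 2 in
     front of [{M,P}]. *)
  assert (J2 : - 2 * e2_3 (frame_limit tau um b U va va1 vE vE1 vc vc1)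
    = jacobian2 d_E d_c T P a E c + 2 * jacobian2 d_a d_E M P a E c).
  { unfold jacobian2; rewrite TE, Tc, Ma, ME, Pa, PE, Pc.
    unfold e2_3, frame_limit; rewrite X1, X2, X3'; field; lra. }
  (* Pulling the signs and the factor 1/2 out of rows and columns leaves [- 1/2] times the Jacobian;
     passing from the order [c, a, E] to [a, E, c] is an even permutation. *)
  assert (J3 : 3 * Rdet3 (frame_limit tau um b U va va1 vE vE1 vc vc1)
    = - (3 / 2) * jacobian3 d_a d_E d_c T M P a E c).
  { unfold jacobian3, jacobian2; rewrite Ta, TE, Tc, Ma, ME, Mc, Pa, PE, Pc.
    unfold Rdet3, det3, frame_limit; field; lra. }
  assert (T2 : mat_trace (mat Y2 (RtoC 0)) =
    RtoC (jacobian2 d_E d_c T P a E c + 2 * jacobian2 d_a d_E M P a E c)).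
  { rewrite Htr, <- J2, <- R2; apply injective_projections; [reflexivity | exact (I2 0)]. }
  assert (T3 : mat_trace (mat Y3 (RtoC 0)) =
    RtoC (- (3 / 2) * jacobian3 d_a d_E d_c T M P a E c)).
  { rewrite Htr, <- J3, <- R3; apply injective_projections; [reflexivity | exact (I3 0)]. }
  exists (mat Y1), (mat Y2), (mat Y3); split; [ | split; [ | split; [ | split; [ | split]]]].
  - intros mu i j Hi' Hj'; unfold mat; rewrite coeff_mat_bij by assumption.
    apply (expansion_derive tau tau (fun m => G m i j) (Y1 i j)); [lra | now apply HY].
  - apply Hmat; intros; now apply HY.
  - apply Hmat; intros; now apply HY.
  - exact T2.
  - exact T3.
  - unfold stability_index; rewrite T2, T3, real_stability_index; f_equal; ring.
Qed.
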